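(* Let $\delta>0$. There is a constant $c>0$, depending only on $\delta$, such that the following holds. Suppose that $d\ge c^{-1}$ and that there exists a query algorithm which, for any Gaussian target distribution $\pi=\mathcal{N}(0,\Sigma)$ on $\mathbb{R}^d$ with $c\,d^{-2}I_d\preceq\Sigma^{-1}\preceq c^{-1}I_d$, outputs a sample from a distribution $\widehat\pi$ such that either $\|\widehat\pi-\pi\|_{\mathrm{TV}}\le c$ or $\sqrt{c\,d^{-2}}\;W_2(\widehat\pi,\pi)\le c$, using $n$ queries to $\pi$. Then, given $W\sim\mathrm{Wishart}(d)$, there exists an algorithm which makes at most $c^{-1}n$ matrix-vector queries to $W$ and outputs an estimator $\widehat{\mathrm{tr}}$ such that $$\tfrac12\operatorname{tr}(W^{-1})\ \le\ \widehat{\mathrm{tr}}\ \le\ 2\operatorname{tr}(W^{-1})$$ with probability at least $1-\delta$.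
   Context: $W\sim\mathrm{Wishart}(d)$ means $W=XX^\top$ where $X\in\mathbb{R}^{d\times d}$ has i.i.d. $\mathcal{N}(0,1/d)$ entries. A query to $\pi=\mathcal{N}(0,\Sigma)$ at $x\in\mathbb{R}^d$ returns $V(x)$ and $\nabla V(x)$ for $V(x)=\frac12\langle x,\Sigma^{-1}x\rangle$, equivalently $\Sigma^{-1}x$. A matrix-vector query to $W$ at $v\in\mathbb{R}^d$ returns $Wv$. Algorithms may be adaptive and randomized; the sampling algorithm always makes at most $n$ queries. $W_2$ is the $2$-Wasserstein distance. Probability is over $W$ and the algorithm's randomness. *)

(* Defs.v *)
From HB Require Import structures.
From mathcomp Require Import all_boot all_order all_algebra.
From mathcomp Require Import all_classical all_reals all_analysis.
From mathcomp Require Import measurable_realfun.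

Set Implicit Arguments.
Unset Strict Implicit.
Unset Printing Implicit Defensive.

Import Order.TTheory GRing.Theory Num.Theory.
Import numFieldNormedType.Exports.

Local Open Scope classical_set_scope.
Local Open Scope ring_scope.

(* The Borel sigma-algebra of the space of m x n real matrices, presented as
   the product sigma-algebra of the m * n coordinates. *)
Definition measure_matrix_display : measure_display. Proof. exact. Qed.

Section measurable_matrix.
Variables (R : realType) (m n : nat).

Let coors : 'I_(m * n) -> 'M[R]_(m, n) -> R :=
  fun k M => mxvec M 0 k.

Let matrix_set0 : g_sigma_preimage coors set0.
Proof. exact: sigma_algebra0. Qed.

Let matrix_setC A : g_sigma_preimage coors A -> g_sigma_preimage coors (~` A).
Proof. exact: sigma_algebraC. Qed.

Let matrix_bigcup (F : (set 'M[R]_(m, n))^nat) :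
  (forall i, g_sigma_preimage coors (F i)) ->
  g_sigma_preimage coors (\bigcup_i (F i)).
Proof. exact: sigma_algebra_bigcup. Qed.

HB.instance Definition _ := @isMeasurable.Build measure_matrix_display
  'M[R]_(m, n) (g_sigma_preimage coors) matrix_set0 matrix_setC matrix_bigcup.

Lemma measurable_mxvec (k : 'I_(m * n)) :
  measurable_fun [set: 'M[R]_(m, n)] (fun M => mxvec M 0 k : R).
Proof.
move=> _ Y mY; rewrite setTI; apply: sub_sigma_algebra => /=.
rewrite -bigcup_seq/=; exists k => /=; first by rewrite mem_index_enum.
by exists Y => //; rewrite setTI.
Qed.

Lemma measurable_entry (i : 'I_m) (j : 'I_n) :
  measurable_fun [set: 'M[R]_(m, n)] (fun M => M i j : R).
Proof.
have := measurable_mxvec (mxvec_index i j).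
by under eq_fun do rewrite mxvecE.
Qed.

End measurable_matrix.

Section measurable_fun_matrix.
Context d (T : measurableType d) (R : realType) (m n : nat).

Lemma measurable_fun_entryP (f : T -> 'M[R]_(m, n)) :
  (forall i j, measurable_fun setT (fun x => f x i j : R)) ->
  measurable_fun setT f.
Proof.
move=> mf.
suff preS : g_sigma_preimage (fun k x => mxvec (f x) 0 k : R)
    `<=` measurable.
  move=> _ A mA; rewrite setTI; apply: preS.
  rewrite (g_sigma_preimage_comp
    (fun k (M : 'M[R]_(m, n)) => mxvec M 0 k : R) f).
  by exists A => //; rewrite setTI.
apply: smallest_sub; first exact: sigma_algebra_measurable.
move=> A; rewrite -bigcup_seq => -[k _ [B mB <-]].
case/mxvec_indexP: k => i j.
under eq_fun do rewrite mxvecE.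
exact: mf.
Qed.

End measurable_fun_matrix.

Section iid.
Context d (T : measurableType d) (R : realType).

Definition tuple_cons n (z : T * n.-tuple T) : n.+1.-tuple T :=
  [the n.+1.-tuple T of z.1 :: z.2].

Lemma measurable_tuple_cons n : measurable_fun setT (@tuple_cons n).
Proof. exact: measurable_cons. Qed.

HB.instance Definition _ n :=
  isMeasurableFun.Build _ _ _ _ (@tuple_cons n) (@measurable_tuple_cons n).

(* joint law of n independent random variables of common law P *)
Fixpoint iid_tuple (P : probability T R) n : probability (n.-tuple T) R :=
  match n with
  | 0%N => \d_([tuple] : 0.-tuple T)
  | k.+1 => distribution (P \x iid_tuple P k)%E (@tuple_cons k)
  end.

End iid.

Section gaussian.
Variable R : realType.

Definition mx_of_tuple m n (t : (m * n).-tuple (measurableTypeR R)) : 'M[R]_(m, n) :=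
  \matrix_(i, j) tnth t (mxvec_index i j).

Lemma measurable_mx_of_tuple m n : measurable_fun setT (@mx_of_tuple m n).
Proof.
apply: measurable_fun_entryP => i j; under eq_fun do rewrite mxE.
exact: measurable_tnth.
Qed.

HB.instance Definition _ m n :=
  isMeasurableFun.Build _ _ _ _ (@mx_of_tuple m n) (@measurable_mx_of_tuple m n).

(* law of an m x n matrix with independent N(0, s ^+ 2) entries *)
Definition gaussian_mx m n (s : R) : probability 'M[R]_(m, n) R :=
  distribution
    (iid_tuple (normal_prob 0 s : probability (measurableTypeR R) R) (m * n))
    (@mx_of_tuple m n).

Definition gram n (X : 'M[R]_n) : 'M[R]_n := X *m X^T.

Lemma measurable_gram n : measurable_fun setT (@gram n).
Proof.
apply: measurable_fun_entryP => i j; rewrite /gram.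
under eq_fun do rewrite mxE.
apply: measurable_sum => k.
under eq_fun do rewrite mxE.
by apply: measurable_funM; exact: measurable_entry.
Qed.

HB.instance Definition _ n :=
  isMeasurableFun.Build _ _ _ _ (@gram n) (@measurable_gram n).

Definition wishart d : probability 'M[R]_d R :=
  distribution (gaussian_mx d d (Num.sqrt d%:R^-1)) (@gram d).

(* P = N(0, Sigma): P is the law of A g for g a standard Gaussian vector and
   A A^T = Sigma. The law does not depend on the choice of A. *)
Definition is_gaussian d (Sigma : 'M[R]_d) (P : probability 'cV[R]_d R) :=
  exists2 A : 'M[R]_d, A *m A^T = Sigma &
    forall B, measurable B ->
      P B = pushforward (gaussian_mx d 1 1) (fun g : 'cV[R]_d => A *m g) B.

End gaussian.

Section euclidean.
Variable R : realType.

Definition dotv d (x y : 'cV[R]_d) : R := (x^T *m y) 0 0.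

Definition loewner_le d (A B : 'M[R]_d) :=
  (B - A)^T = B - A /\ forall x : 'cV[R]_d, 0 <= dotv x ((B - A) *m x).

(* sup_B |mu B - nu B|, with values in [0, 1] for probability measures *)
Definition tv_dist d (T : measurableType d) (mu nu : set T -> \bar R) : \bar R :=
  ereal_sup [set `|mu B - nu B|%E | B in measurable].

Definition coupling d (T : measurableType d) (mu nu : set T -> \bar R)
    (g : probability (T * T)%type R) :=
  forall B, measurable B ->
    pushforward g fst B = mu B /\ pushforward g snd B = nu B.

(* The ambient distance is the Euclidean one, not the library's (sup) norm on
   matrices. *)
Definition wasserstein2 d (mu nu : set 'cV[R]_d -> \bar R) : \bar R :=
  (ereal_inf [set \int[g]_z (dotv (z.1 - z.2) (z.1 - z.2))%:E
             | g in coupling mu nu] `^ 2^-1)%E.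

End euclidean.

(* An adaptive randomized algorithm that makes n queries at points of X,
   receives answers in A and returns an element of O. It draws a random seed
   once; the next query is a function of the seed and of the answers received so
   far (past queries are themselves determined by these), the most recent answer
   coming first. An algorithm stopping early is one that ignores the
   answers to its remaining queries, so this models at most n queries. *)
Record query_algorithm (R : realType) dX dA dO (X : measurableType dX)
    (A : measurableType dA) (O : measurableType dO) (n : nat) := QueryAlgorithm {
  seed_display : measure_display ;
  seed : measurableType seed_display ;
  seed_law : probability seed R ;
  query : forall k, seed * k.-tuple A -> X ;
  output : seed * n.-tuple A -> O ;
  measurable_query : forall k, measurable_fun setT (@query k) ;
  measurable_output : measurable_fun setT output }.

Arguments query {R dX dA dO X A O n} q k.

Section run.
Context (R : realType) dX dA dO (X : measurableType dX) (A : measurableType dA)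
  (O : measurableType dO) (n : nat).
Variables (alg : query_algorithm R X A O n) (oracle : X -> A).

Fixpoint transcript (w : seed alg) k : k.-tuple A :=
  match k with
  | 0%N => [tuple]
  | j.+1 => let h := transcript w j in
            [the j.+1.-tuple A of oracle (query alg j (w, h)) :: h]
  end.

Definition run (w : seed alg) : O := output (w, transcript w n).

Definition output_law : set O -> \bar R := pushforward (seed_law alg) run.

End run.

Arguments transcript {R dX dA dO X A O n} alg oracle w k.
Arguments run {R dX dA dO X A O n} alg oracle w.
Arguments output_law {R dX dA dO X A O n} alg oracle _.

Section problems.
Variable R : realType.

Definition potential d (Sigma : 'M[R]_d) (x : 'cV[R]_d) : R :=
  2^-1 * dotv x (invmx Sigma *m x).

(* value and gradient at x of the potential of N(0, Sigma); the gradient is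
   Sigma^-1 x since Sigma is symmetric *)
Definition gaussian_oracle d (Sigma : 'M[R]_d) (x : 'cV[R]_d) :
    R * 'cV[R]_d :=
  (potential Sigma x, invmx Sigma *m x).

Definition sampler d n :=
  query_algorithm R 'cV[R]_d (R * 'cV[R]_d)%type 'cV[R]_d n.

Definition sampler_correct d n (c : R) (S : sampler d n) :=
  forall (Sigma : 'M[R]_d) (P : probability 'cV[R]_d R),
    Sigma \in unitmx ->
    loewner_le (c / d%:R ^+ 2)%:M (invmx Sigma) ->
    loewner_le (invmx Sigma) c^-1%:M ->
    is_gaussian Sigma P ->
    let Phat := output_law S (gaussian_oracle Sigma) in
    (tv_dist Phat P <= c%:E)%E \/
    ((Num.sqrt (c / d%:R ^+ 2))%:E * wasserstein2 Phat P <= c%:E)%E.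

Definition matvec_estimator d m :=
  query_algorithm R 'cV[R]_d 'cV[R]_d R m.

(* W is independent of the seed. invmx is a total function, but a
   Wishart matrix is almost surely invertible. *)
Definition trace_inv_success d m (T : matvec_estimator d m) : \bar R :=
  (seed_law T \x wishart R d)%E
    [set z | let t := \tr (invmx z.2) in
             2^-1 * t <= run T (fun v => z.2 *m v) z.1 <= 2 * t].

End problems.

(* Main.v *)
(* Proof idea. For Sigma = W^-1 the gradient oracle of N(0, Sigma) is v |-> W v,
   and the value of the potential at a query point is half the inner product of
   the point with the answer, so a sampler from N(0, W^-1) runs on matrix-vector
   queries to W. With high probability W = X X^T satisfies e^2/d^2 <= W <= K^2
   and tr (W^-1) >= eta d^2. The mean of |Y|^2 over k independent samples Y of
   N(0, W^-1) concentrates around tr (W^-1) by Chebyshev's inequality, and a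
   constant k suffices. If the sampler is c-close in total variation, the k-fold
   product law changes by at most k c; if it is close in the Wasserstein distance,
   k independent copies of a good coupling change the mean of |Y|^2 by O(c d^2) in
   expectation, which is small compared with tr (W^-1).

   The spectral estimates for a Gaussian matrix G are averaged over an independent
   Gaussian vector instead of a net: if |G^T x| is too large (too small) for some x,
   then |G z| (|G^-1 z|) is large with non-negligible probability over z. By rotation
   invariance |G z| is distributed as |z| |g| with g Gaussian, and |G^-1 z| as
   |z| / |g_0| with g_0 one Gaussian coordinate. *)
From HB Require Import structures.
From mathcomp Require Import all_boot all_order all_algebra.
From mathcomp Require Import all_classical all_reals all_analysis.
From mathcomp Require Import measurable_realfun ring lra.
Require Import Defs.
Set Implicit Arguments.
Unset Strict Implicit.
Unset Printing Implicit Defensive.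
Import Order.TTheory GRing.Theory Num.Theory.
Import numFieldNormedType.Exports.
Local Open Scope classical_set_scope.
Local Open Scope ring_scope.

(** * Gaussian matrices *)

(** Averaging over a random vector divides the failure probability by the probability that this
    vector witnesses a bad direction. For the largest eigenvalue the witness has probability only
    about [exp (- 4 d)]; this is affordable because the norm tail is [exp (d - K d / 4)] and [K] is
    free. For the smallest eigenvalue only a tail linear in [e] is available, but there a witness of
    probability 1/2 suffices, namely [|x . v| >= |x| / 2].

    Which alternative of the sampler's guarantee holds may change with the covariance. The analysis
    of the samples is therefore done for a fixed good factor [X] of [W], with a failure bound that
    covers both alternatives, and is integrated over [X] only at the end.

    Gaussian laws are handled through integrals of nonnegative functions, so that Tonelli's theorem
    and substitutions apply without integrability conditions. In particular [1 / |g_0|], which has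
    infinite mean, causes no difficulty. *)

Lemma iid_tuple_rect (R : realType) d (T : measurableType d) (P : probability T R) n
    (B : 'I_n -> set T) : (forall i, measurable (B i)) ->
  iid_tuple P n [set t | forall i, B i (tnth t i)] =
    (\prod_(i < n) fine (P (B i)))%:E.
Proof.
elim: n B => [|n IH] B mB.
  rewrite big_ord0 /= diracE (_ : _ \in _ = true)//.
  by apply/mem_set => -[].
rewrite big_ord_recl EFinM fineK ?fin_num_measure// -IH; last by move=> i; exact: mB.
rewrite -product_measure1E//=; last first.
  rewrite (_ : [set _ | _] = \bigcap_(i in [set: 'I_n])
     ((fun t => tnth t i) @^-1` B (lift ord0 i))); last first.
    by apply/seteqP; split => [t h i _|t h i] /=; [exact: h|exact: (h i I)].
  apply: fin_bigcap_measurable => // i _.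
  by rewrite -[_ @^-1` _]setTI; apply: measurable_tnth.
rewrite /distribution /pushforward; congr product_measure1.
apply/seteqP; split => [[x t] /= h|[x t] /= [h1 h2] i].
  split; first by have := h ord0; rewrite (tnth_nth x).
  by move=> i; have := h (lift ord0 i); rewrite !(tnth_nth x).
case: (unliftP ord0 i) => [j ->|->]; last by rewrite (tnth_nth x).
by have := h2 j; rewrite !(tnth_nth x).
Qed.

Definition mx_rect (R : realType) m n (B : 'I_m -> 'I_n -> set R) : set 'M[R]_(m, n) :=
  [set M | forall i j, B i j (M i j)].

Lemma measurable_mx_rect (R : realType) m n (B : 'I_m -> 'I_n -> set R) :
  (forall i j, measurable (B i j)) -> measurable (mx_rect B).
Proof.
move=> mB; rewrite (_ : mx_rect B = \bigcap_(i in [set: 'I_m])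
   \bigcap_(j in [set: 'I_n]) ((fun M : 'M[R]_(m, n) => M i j : R) @^-1` B i j)).
  apply: fin_bigcap_measurable => // i _; apply: fin_bigcap_measurable => // j _.
  by rewrite -[_ @^-1` _]setTI; apply: measurable_entry.
by apply/seteqP; split => [M h i _ j _|M h i j] /=; [exact: h|exact: (h i I j I)].
Qed.

(** Rectangles form a pi-system, and every coordinate preimage that generates the sigma-algebra is a
    rectangle with all other sides full. *)
Lemma mx_measure_unique (R : realType) m n (P Q : probability 'M[R]_(m, n) R) :
  (forall B, (forall i j, measurable (B i j)) -> P (mx_rect B) = Q (mx_rect B)) ->
  forall A, measurable A -> P A = Q A.
Proof.
move=> PQ A mA.
pose G := [set X | exists2 B : 'I_m -> 'I_n -> set R,
   (forall i j, measurable (B i j)) & X = mx_rect B].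
apply: (@g_sigma_algebra_measure_unique _ _ _ G _ (fun=> setT)) => //.
- by move=> _ [B mB ->]; exact: measurable_mx_rect.
- by move=> _; exists (fun _ _ => setT) => //; apply/seteqP; split.
- by rewrite bigcup_const//; exists 0%N.
- move=> _ _ [B mB ->] [C mC ->]; exists (fun i j => B i j `&` C i j).
    by move=> i j; exact: measurableI.
  apply/seteqP; split => [M [h1 h2] i j|M h]; first by split; [exact: h1|exact: h2].
  by split => i j; have [] := h i j.
- by move=> _ [B mB ->]; exact: PQ.
- by move=> k; rewrite (le_lt_trans (probability_le1 _ _)) ?ltry.
move: A mA; apply: smallest_sub; first exact: smallest_sigma_algebra.
move=> A; rewrite -bigcup_seq => -[k _ [B mB <-]].
case/mxvec_indexP: k => i j; apply: sub_sigma_algebra.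
exists (fun i' j' => if (i' == i) && (j' == j) then B else setT).
  by move=> i' j'; case: ifP.
rewrite setTI; apply/seteqP; split => [M /= h i' j'|M /(_ i j)] /=.
  by case: ifP => // /andP[/eqP -> /eqP ->]; rewrite mxvecE in h.
by rewrite !eqxx /= mxvecE.
Qed.

Lemma gaussian_mx_rect (R : realType) m n (s : R) (B : 'I_m -> 'I_n -> set R) :
  (forall i j, measurable (B i j)) ->
  gaussian_mx m n s (mx_rect B) =
    (\prod_i \prod_j fine (normal_prob 0 s (B i j)))%:E.
Proof.
move=> mB.
(* [C] lists the sides in the order in which [mx_of_tuple] reads the entries. *)
pose C (k : 'I_(m * n)) := let p := enum_val (cast_ord (esym (mxvec_cast m n)) k) in
  B p.1 p.2.
have CE i j : C (mxvec_index i j) = B i j.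
  by rewrite /C /mxvec_index cast_ordK enum_rankK.
transitivity (iid_tuple (normal_prob 0 s : probability (measurableTypeR R) R) (m * n)
   [set t | forall i, C i (tnth t i)]).
  rewrite /gaussian_mx /distribution /pushforward; congr (iid_tuple _ _ _).
  apply/seteqP; split => [t h k|t h i j] /=.
    by case/mxvec_indexP: k => i j; have := h i j; rewrite mxE CE.
  by rewrite mxE -CE.
rewrite iid_tuple_rect; last by case/mxvec_indexP => i j; rewrite CE; exact: mB.
congr EFin; rewrite pair_bigA /= (reindex _ (curry_mxvec_bij _ _)) /=.
by apply: eq_bigr => -[i j] _ /=; rewrite CE.
Qed.

(** The two laws are compared on measurable sets only, the form in which [is_gaussian] and
    [coupling] supply them. *)
Lemma ge0_integral_law (R : realType) d1 d2 (T : measurableType d1) (U : measurableType d2)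
    (P : probability T R) (Q : probability U R) (phi : T -> U) :
  measurable_fun setT phi ->
  (forall A, measurable A -> Q A = P (phi @^-1` A)) ->
  forall f : U -> \bar R, measurable_fun setT f -> (forall x, 0 <= f x)%E ->
  (\int[Q]_x f x = \int[P]_x f (phi x))%E.
Proof.
move=> mphi QP f mf f0.
rewrite -[RHS](@ge0_integral_pushforward _ _ _ _ _ _ mphi P setT f)//.
by apply: eq_measure_integral => A mA _; exact: QP.
Qed.

Lemma gaussian_mx_law (R : realType) m n (s : R) d (T : measurableType d)
    (P : probability T R) (phi : T -> 'M[R]_(m, n)) :
  measurable_fun setT phi ->
  (forall B, (forall i j, measurable (B i j)) -> P (phi @^-1` mx_rect B) =
    (\prod_i \prod_j fine (normal_prob 0 s (B i j)))%:E) ->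
  forall A, measurable A -> gaussian_mx m n s A = P (phi @^-1` A).
Proof.
move=> mphi h A mA.
pose f : {mfun T >-> 'M[R]_(m, n)} := HB.pack phi (isMeasurableFun.Build _ _ _ _ phi mphi).
apply: (@mx_measure_unique _ _ _ _ (distribution P f)) => // B mB.
by rewrite gaussian_mx_rect//= /distribution /pushforward -h.
Qed.

Lemma measurable_invr (R : realType) : measurable_fun [set: R] (fun x : R => x^-1).
Proof.
(* The inverse is [x] times a power of the nonnegative number [x ^+ 2], and [powR] is measurable; at
   0 both sides are 0. *)
rewrite (_ : (fun x => _) = fun x : R => x * (x ^+ 2) `^ (-1)).
  apply: measurable_funM => //.
  apply: (measurableT_comp (f := fun y : R => y `^ (-1))); last exact: measurable_funX.
  exact: measurable_powR.
apply/funext => x; rewrite powR_inv1 ?sqr_ge0//.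
by have [->|x0] := eqVneq x 0; [rewrite invr0 mul0r|rewrite expr2 invfM mulrA divff ?mul1r].
Qed.

Section measurable_matrix_operations.
Context d (T : measurableType d) (R : realType).

Lemma measurable_fun_mxP m n (f : T -> 'M[R]_(m, n)) :
  measurable_fun setT f <-> forall i j, measurable_fun setT (fun x => f x i j : R).
Proof.
split=> [mf i j|]; last exact: measurable_fun_entryP.
exact: (measurableT_comp (measurable_entry i j) mf).
Qed.

Lemma measurable_mulmx m n p (f : T -> 'M[R]_(m, n)) (g : T -> 'M[R]_(n, p)) :
  measurable_fun setT f -> measurable_fun setT g ->
  measurable_fun setT (fun x => f x *m g x).
Proof.
move=> /measurable_fun_mxP mf /measurable_fun_mxP mg; apply/measurable_fun_mxP => i j.
under eq_fun do rewrite mxE.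
by apply: measurable_sum => k; exact: measurable_funM.
Qed.

Lemma measurable_scalemx m n (f : T -> R) (g : T -> 'M[R]_(m, n)) :
  measurable_fun setT f -> measurable_fun setT g ->
  measurable_fun setT (fun x => f x *: g x).
Proof.
move=> mf /measurable_fun_mxP mg; apply/measurable_fun_mxP => i j.
by under eq_fun do rewrite mxE; exact: measurable_funM.
Qed.

Lemma measurable_submx m n (f g : T -> 'M[R]_(m, n)) :
  measurable_fun setT f -> measurable_fun setT g ->
  measurable_fun setT (fun x => f x - g x).
Proof.
move=> /measurable_fun_mxP mf /measurable_fun_mxP mg; apply/measurable_fun_mxP => i j.
by under eq_fun do rewrite !mxE; exact: measurable_funB.
Qed.

Lemma measurable_trmx m n (f : T -> 'M[R]_(m, n)) :
  measurable_fun setT f -> measurable_fun setT (fun x => (f x)^T).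
Proof.
move=> /measurable_fun_mxP mf; apply/measurable_fun_mxP => i j.
by under eq_fun do rewrite mxE; exact: mf.
Qed.

Lemma measurable_col_mx m1 m2 n (f : T -> 'M[R]_(m1, n)) (g : T -> 'M[R]_(m2, n)) :
  measurable_fun setT f -> measurable_fun setT g ->
  measurable_fun setT (fun x => col_mx (f x) (g x)).
Proof.
move=> /measurable_fun_mxP mf /measurable_fun_mxP mg; apply/measurable_fun_mxP => i j.
by case: (split_ordP i) => k ->; [under eq_fun do rewrite col_mxEu; exact: mf|
  under eq_fun do rewrite col_mxEd; exact: mg].
Qed.

Lemma measurable_row_mx m n1 n2 (f : T -> 'M[R]_(m, n1)) (g : T -> 'M[R]_(m, n2)) :
  measurable_fun setT f -> measurable_fun setT g ->
  measurable_fun setT (fun x => row_mx (f x) (g x)).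
Proof.
move=> /measurable_fun_mxP mf /measurable_fun_mxP mg; apply/measurable_fun_mxP => i j.
by case: (split_ordP j) => k ->; [under eq_fun do rewrite row_mxEl; exact: mf|
  under eq_fun do rewrite row_mxEr; exact: mg].
Qed.

Lemma measurable_det n (f : T -> 'M[R]_n) :
  measurable_fun setT f -> measurable_fun setT (fun x => \det (f x)).
Proof.
move=> /measurable_fun_mxP mf; rewrite /determinant.
apply: measurable_sum => s; apply: measurable_funM => //.
by apply: measurable_prod => i _; exact: mf.
Qed.

Lemma measurable_cofactor n (f : T -> 'M[R]_n) i j :
  measurable_fun setT f -> measurable_fun setT (fun x => cofactor (f x) i j).
Proof.
move=> /measurable_fun_mxP mf; rewrite /cofactor.
apply: measurable_funM => //; apply: measurable_det; apply/measurable_fun_mxP => k l.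
by under eq_fun do rewrite !mxE; exact: mf.
Qed.

Lemma measurable_invmx n (f : T -> 'M[R]_n) :
  measurable_fun setT f -> measurable_fun setT (fun x => invmx (f x)).
Proof.
(* [invmx] returns a singular matrix unchanged; the adjugate formula covers the others. *)
move=> mf; rewrite (_ : (fun x => _) =
   fun x => if \det (f x) != 0 then (\det (f x))^-1 *: \adj (f x) else f x); last first.
  by apply/funext => x; rewrite /invmx unitmxE unitfE.
apply: measurable_fun_ifT => //.
  apply: (measurableT_comp (f := fun y : R => y != 0)); last exact: measurable_det.
  by apply: measurable_neg; apply: measurable_fun_eqr.
apply: measurable_scalemx.
  by apply: measurableT_comp; [exact: measurable_invr|exact: measurable_det].
apply/measurable_fun_mxP => i j; under eq_fun do rewrite mxE.
exact: measurable_cofactor.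
Qed.

Lemma measurable_dotv n (f g : T -> 'cV[R]_n) :
  measurable_fun setT f -> measurable_fun setT g ->
  measurable_fun setT (fun x => dotv (f x) (g x)).
Proof.
move=> mf mg; apply: (measurableT_comp (measurable_entry 0 0)).
by apply: measurable_mulmx => //; exact: measurable_trmx.
Qed.

Lemma measurable_mxtrace n (f : T -> 'M[R]_n) :
  measurable_fun setT f -> measurable_fun setT (fun x => \tr (f x)).
Proof.
by move=> /measurable_fun_mxP mf; apply: measurable_sum => i.
Qed.

End measurable_matrix_operations.

(** * Splitting a Gaussian matrix into independent blocks *)

Section gaussian_mx_structure.
Variable R : realType.
Local Open Scope ereal_scope.

Lemma integral_gaussian_col_mx m1 m2 n (s : R) (f : 'M[R]_(m1 + m2, n) -> \bar R) :
  measurable_fun setT f -> (forall x, 0 <= f x) ->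
  \int[gaussian_mx (m1 + m2) n s]_M f M =
  \int[gaussian_mx m1 n s]_A \int[gaussian_mx m2 n s]_B f (col_mx A B).
Proof.
move=> mf f0.
have mc : measurable_fun setT
   (fun z : 'M[R]_(m1, n) * 'M[R]_(m2, n) => col_mx z.1 z.2).
  exact: measurable_col_mx.
rewrite (@ge0_integral_law _ _ _ _ _ (gaussian_mx m1 n s \x gaussian_mx m2 n s)
  _ _ mc)//.
  by rewrite fubini_tonelli1//; exact: measurableT_comp.
apply: gaussian_mx_law => // B mB.
rewrite (_ : _ @^-1` _ = mx_rect (fun i => B (lshift m2 i)) `*`
    mx_rect (fun i => B (rshift m1 i))).
  rewrite [LHS]product_measure1E//; try exact: measurable_mx_rect.
  by rewrite [LHS]/= !gaussian_mx_rect// -EFinM big_split_ord.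
apply/seteqP; split => [[M N] /= h|[M N] /= [h1 h2] i j].
  split => i j; first by have := h (lshift m2 i) j; rewrite col_mxEu.
  by have := h (rshift m1 i) j; rewrite col_mxEd.
by case: (split_ordP i) => k ->; rewrite ?col_mxEu ?col_mxEd; [exact: h1|exact: h2].
Qed.

Lemma integral_gaussian_trmx m n (s : R) (f : 'M[R]_(m, n) -> \bar R) :
  measurable_fun setT f -> (forall x, 0 <= f x) ->
  \int[gaussian_mx m n s]_M f M = \int[gaussian_mx n m s]_M f (M^T).
Proof.
move=> mf f0; apply: ge0_integral_law => //; first exact: measurable_trmx.
apply: gaussian_mx_law; first exact: measurable_trmx.
move=> B mB; rewrite (_ : _ @^-1` _ = mx_rect (fun i j => B j i)).
  by rewrite [LHS]gaussian_mx_rect// exchange_big.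
by apply/seteqP; split => [M h i j|M h i j]; have := h j i; rewrite mxE.
Qed.

Lemma integral_gaussian_row_mx m n1 n2 (s : R) (f : 'M[R]_(m, n1 + n2) -> \bar R) :
  measurable_fun setT f -> (forall x, 0 <= f x) ->
  \int[gaussian_mx m (n1 + n2) s]_M f M =
  \int[gaussian_mx m n1 s]_A \int[gaussian_mx m n2 s]_B f (row_mx A B).
Proof.
move=> mf f0; rewrite integral_gaussian_trmx// integral_gaussian_col_mx//; last first.
  by apply: measurableT_comp => //; exact: measurable_trmx.
have m1 : measurable_fun setT
   (fun z : 'M[R]_(m, n1) * 'M[R]_(m, n2) => f (row_mx z.1 z.2)).
  by apply: measurableT_comp => //; exact: measurable_row_mx.
rewrite [RHS]integral_gaussian_trmx//; last 2 first.
- exact: (measurable_fun_fubini_tonelli_F _ m1).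
- by move=> A; exact: integral_ge0.
apply: eq_integral => A _; rewrite [RHS]integral_gaussian_trmx//; last first.
  by apply: measurableT_comp => //; exact: measurable_row_mx.
by apply: eq_integral => B _; rewrite tr_col_mx.
Qed.

Lemma gaussian_mx11 (s : R) (f : 'M[R]_1 -> \bar R) :
  measurable_fun setT f -> (forall x, 0 <= f x) ->
  \int[gaussian_mx 1 1 s]_M f M = \int[normal_prob 0 s]_x f (x%:M).
Proof.
move=> mf f0.
have mc : measurable_fun setT (fun x : measurableTypeR R => x%:M : 'M[R]_1).
  by apply/measurable_fun_mxP => i j; under eq_fun do rewrite mxE !ord1; exact: measurable_id.
apply: (@ge0_integral_law _ _ _ _ _
  (normal_prob 0 s : probability (measurableTypeR R) R)) => //.
apply: gaussian_mx_law => // B mB.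
rewrite !big_ord1 fineK; last first.
  by apply: (@fin_num_measure _ (measurableTypeR R) R (normal_prob 0 s : probability (measurableTypeR R) R)); exact: mB.
congr (normal_prob _ _ _).
apply/seteqP; split => [x /(_ 0%R 0%R)|x h i j] /=; first by rewrite mxE.
by rewrite !ord1 mxE.
Qed.

End gaussian_mx_structure.

(** * Rotation invariance *)

Section lebesgue_affine.
Variable R : realType.
Local Notation mu := (@lebesgue_measure R).

Lemma lebesgue_measure_affine (a b : R) (A : set (measurableTypeR R)) : a != 0 -> measurable A ->
  mu A = (`|a|%:E * mu ((fun x => a * x + b)%R @^-1` A))%E.
Proof.
move=> a0 mA.
have mphi : measurable_fun setT (fun x : measurableTypeR R => a * x + b : measurableTypeR R).
  by apply: measurable_funD => //; apply: measurable_funM.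
have na0 : 0 <= `|a| by [].
pose nu := mscale (NngNum na0) (measure_function_pushforward__canonical__measure_function_Measure mu mphi).
rewrite (@lebesgue_measure_unique _ nu) //.
move=> _ [[u v]] /= _ <-; rewrite /nu /mscale /= /pushforward /=.
have [a_gt0|a_lt0|] := ltgtP a 0; last by move/eqP; rewrite (negbTE a0).
  (* Here [a] is negative, despite the name [a_gt0]: orientation is reversed, and the preimage of
     []u, v]] is closed on the left. *)
  rewrite (_ : _ @^-1` _ = `[(v - b) / a, (u - b) / a[%classic); last first.
    apply/seteqP; split => x /=; rewrite !in_itv /= ler_ndivrMr// ltr_ndivlMr//.
      by rewrite [x * a]mulrC ltrBlDr lerBrDr andbC.
    by rewrite [x * a]mulrC ltrBlDr lerBrDr andbC.
  rewrite !lebesgue_measure_itv /= !lte_fin ltr_ndivrMr// divfK// ltrD2r.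
  case: ifP => _; last by rewrite mule0.
  by rewrite -!EFinB -EFinM ltr0_norm//; congr EFin; field.
rewrite (_ : _ @^-1` _ = `](u - b) / a, (v - b) / a]%classic); last first.
  apply/seteqP; split => x /=; rewrite !in_itv /= ler_pdivlMr// ltr_pdivrMr//.
    by rewrite [x * a]mulrC ltrBlDr lerBrDr.
  by rewrite [x * a]mulrC ltrBlDr lerBrDr.
rewrite !lebesgue_measure_itv /= !lte_fin ltr_pdivrMr// divfK// ltrD2r.
case: ifP => _; last by rewrite mule0.
by rewrite -!EFinB -EFinM gtr0_norm//; congr EFin; field.
Qed.

Lemma integral_affine (a b : R) (f : R -> \bar R) : a != 0 ->
  measurable_fun setT f -> (forall x, 0 <= f x)%E ->
  (\int[mu]_x f x = `|a|%:E * \int[mu]_x f (a * x + b)%R)%E.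
Proof.
move=> a0 mf f0.
have mphi : measurable_fun setT (fun x : measurableTypeR R => a * x + b : measurableTypeR R).
  by apply: measurable_funD => //; apply: measurable_funM.
have na0 : 0 <= `|a| by [].
pose g : {mfun (measurableTypeR R) >-> (measurableTypeR R)} :=
  HB.pack (fun x : measurableTypeR R => a * x + b : measurableTypeR R)
    (isMeasurableFun.Build _ _ _ _ _ mphi).
rewrite -(@ge0_integral_pushforward _ _ _ _ _ g mphi mu setT f)//.
rewrite -(@ge0_integral_mscale _ _ _ (measure_function_pushforward__canonical__measure_function_Measure mu mphi) setT measurableT (NngNum na0))//.
apply: eq_measure_integral => A mA _.
exact: (lebesgue_measure_affine b a0 mA).
Qed.

End lebesgue_affine.

(** * The normal density under scaling and plane rotations *)

Section normal_density_integral.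
Variable R : realType.
Local Notation mu := (@lebesgue_measure R).

Lemma integral_normal_prob (s : R) (f : R -> \bar R) :
  measurable_fun setT f -> (forall x, 0 <= f x)%E ->
  (\int[normal_prob 0 s]_x f x = \int[mu]_x (f x * (normal_pdf 0 s x)%:E))%E.
Proof.
move=> mf f0.
rewrite -(Radon_Nikodym_SigmaFinite.change_of_variables (@normal_prob_dominates R 0 s))//.
have mpdf : measurable_fun setT (fun x : R => (normal_pdf 0 s x)%:E).
  by apply/measurable_EFinP; exact: measurable_normal_pdf.
have ig := Radon_Nikodym_SigmaFinite.f_integrable (@normal_prob_dominates R 0 s).
apply: ae_eq_integral => //.
- by apply: emeasurable_funM => //; exact: measurable_int ig.
- exact: emeasurable_funM.
apply: ae_eqe_mul2l.
(* The Radon-Nikodym derivative and [normal_pdf] have the same integral over every measurable set,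
   hence agree almost everywhere. *)
apply: integral_ae_eq => // A _ mA.
by rewrite -(Radon_Nikodym_SigmaFinite.f_integral (@normal_prob_dominates R 0 s) mA).
Qed.

Lemma normal_prob_scale (s : R) (f : R -> \bar R) : s != 0 ->
  measurable_fun setT f -> (forall x, 0 <= f x)%E ->
  (\int[normal_prob 0 s]_x f x = \int[normal_prob 0 1]_x f (s * x)%R)%E.
Proof.
move=> s0 mf f0.
have mfs : measurable_fun setT (fun x : R => f (s * x)).
  by apply: measurableT_comp => //; exact: measurable_funM.
rewrite (integral_normal_prob s mf f0) (integral_normal_prob 1 mfs (fun x => f0 _)).
rewrite [LHS](@integral_affine _ s 0 _ s0); first last.
- by move=> x; rewrite mule_ge0// lee_fin normal_pdf_ge0.
- by apply: emeasurable_funM => //; apply/measurable_EFinP; exact: measurable_normal_pdf.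
rewrite -[LHS]ge0_integralZl; first last.
- by rewrite lee_fin.
- by move=> x _; rewrite mule_ge0// lee_fin normal_pdf_ge0.
- apply: emeasurable_funM.
    by apply: measurableT_comp => //; apply: measurable_funD.
  apply/measurable_EFinP; apply: measurableT_comp; first exact: measurable_normal_pdf.
  by apply: measurable_funD.
- exact: measurableT.
apply: eq_integral => x _; rewrite addr0 muleCA -EFinM; congr (_ * _%:E)%E.
rewrite !normal_pdfE// ?oner_neq0// /normal_peak /normal_fun !subr0.
rewrite mulrA; congr (_ * expR _).
  rewrite expr1n mul1r -[(s ^+ 2 * pi *+ 2)]mulrnAr sqrtrM ?sqr_ge0// sqrtr_sqr invfM mulrA divff ?mul1r//.
  by rewrite normr_eq0.
by rewrite exprMn expr1n; field.
Qed.

Lemma normal_pdf_rotation (c s x y : R) : c ^+ 2 + s ^+ 2 = 1 ->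
  normal_pdf 0 1 (s * x + c * y) * normal_pdf 0 1 (c * x - s * y) =
  normal_pdf 0 1 y * normal_pdf 0 1 x.
Proof.
move=> cs; rewrite !normal_pdfE ?oner_neq0// /normal_fun.
rewrite mulrACA [RHS]mulrACA -!expRD; congr (_ * expR _).
rewrite !subr0 expr1n -!mulrDl; congr (_ / _).
transitivity (- ((c ^+ 2 + s ^+ 2) * (x ^+ 2 + y ^+ 2))); first by ring.
by rewrite cs mul1r; ring.
Qed.

Lemma lebesgue_tonelli (g : R * R -> \bar R) :
  measurable_fun setT g -> (forall z, 0 <= g z)%E ->
  (\int[mu]_x \int[mu]_y g (x, y) = \int[mu]_y \int[mu]_x g (x, y))%E.
Proof. exact: (fubini_tonelli (m1 := mu) (m2 := mu)). Qed.

Lemma measurable_lebesgue_section (g : R * R -> \bar R) :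
  measurable_fun setT g -> (forall z, 0 <= g z)%E ->
  measurable_fun setT (fun x : R => \int[mu]_y g (x, y))%E.
Proof. exact: (measurable_fun_fubini_tonelli_F (m2 := mu)). Qed.

Lemma measurable_linear_pair (a b a' b' : R) :
  measurable_fun setT (fun z : R * R => (a * z.1 + b * z.2, a' * z.1 + b' * z.2)).
Proof.
apply: measurable_fun_pair => /=.
  by apply: measurable_funD; apply: measurable_funM.
by apply: measurable_funD; apply: measurable_funM.
Qed.

(* The rotation is a composition of two shears with diagonal scalings, each of
   which changes a single variable. *)
Lemma lebesgue_rotation (c s : R) (F : R * R -> \bar R) : c != 0 -> c ^+ 2 + s ^+ 2 = 1 ->
  measurable_fun setT F -> (forall z, 0 <= F z)%E ->
  (\int[mu]_x \int[mu]_y F (c * x + (- s) * y, s * x + c * y)%R =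
   \int[mu]_x \int[mu]_y F (x, y))%E.
Proof.
move=> c0 cs mF F0.
have ci0 : c^-1 != 0 by rewrite invr_eq0.
have mFrot := measurableT_comp mF (measurable_linear_pair c (- s) s c).
have mG := measurableT_comp mF (measurable_linear_pair 0 1 c^-1 (s / c)).
rewrite (lebesgue_tonelli mFrot (fun z => F0 _)).
(* For fixed [y], substituting [x = (u + s * y) / c] turns the first argument into [u] and, as
   [c ^+ 2 + s ^+ 2 = 1], the second into [(y + s * u) / c]. After Tonelli, [y = c * v - s * u] does
   the rest; the two Jacobians cancel. *)
transitivity (\int[mu]_y (`|c^-1|%:E *
    \int[mu]_u F (0 * y + 1 * u, c^-1 * y + s / c * u)%R))%E.
  apply: eq_integral => y _.
  rewrite (integral_affine (s * y / c) ci0); first last.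
  - by move=> x; exact: F0.
  - exact: (measurableT_comp mFrot (measurable_pair2 y)).
  congr (_ * _)%E; apply: eq_integral => u _ /=; congr (F (_, _)).
    by field.
  transitivity ((s * u + (c ^+ 2 + s ^+ 2) * y) / c); first by field.
  by rewrite cs; field.
rewrite [LHS]ge0_integralZl; first last.
- by rewrite lee_fin.
- by move=> y _; exact: integral_ge0.
- exact: (measurable_lebesgue_section mG (fun z => F0 _)).
- exact: measurableT.
rewrite (lebesgue_tonelli mG (fun z => F0 _)).
transitivity (`|c^-1|%:E * \int[mu]_u (`|c|%:E * \int[mu]_v F (u, v)))%E.
  congr (_ * _)%E; apply: eq_integral => u _.
  rewrite (integral_affine (- (s * u)) c0); first last.
  - by move=> x; exact: F0.
  - exact: (measurableT_comp mG (measurable_pair2 u)).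
  by congr (_ * _)%E; apply: eq_integral => v _ /=; congr (F (_, _)); field.
rewrite [X in (_ * X)%E]ge0_integralZl; first last.
- by rewrite lee_fin.
- by move=> y _; exact: integral_ge0.
- exact: measurable_lebesgue_section.
- exact: measurableT.
by rewrite muleA -EFinM -normrM mulVf// normr1 mul1e.
Qed.

Lemma integral_normal_prob2 (g : R * R -> \bar R) :
  measurable_fun setT g -> (forall x, 0 <= g x)%E ->
  (\int[normal_prob 0 1]_x \int[normal_prob 0 1]_y g (x, y) =
   \int[mu]_x \int[mu]_y (g (x, y) * (normal_pdf 0 1 y * normal_pdf 0 1 x)%:E))%E.
Proof.
move=> mg g0.
have mpdf : measurable_fun setT (fun x : R => (normal_pdf 0 1 x)%:E).
  by apply/measurable_EFinP; exact: measurable_normal_pdf.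
have p0 x : (0 <= (normal_pdf 0 1 x)%:E :> \bar R)%E by rewrite lee_fin normal_pdf_ge0.
rewrite [LHS]integral_normal_prob; first last.
- by move=> x; exact: integral_ge0.
- exact: (measurable_fun_fubini_tonelli_F (m2 := (normal_prob 0 1 : probability (measurableTypeR R) R)) g).
apply: eq_integral => x _.
have mgx : measurable_fun setT (fun y => g (x, y)) by exact: measurableT_comp.
rewrite (integral_normal_prob 1 mgx (fun y => g0 _)) -[LHS]ge0_integralZr//; last 2 first.
- exact: emeasurable_funM.
- by move=> y _; rewrite mule_ge0.
by apply: eq_integral => y _; rewrite EFinM muleA.
Qed.

Lemma normal_rotation (c s : R) (f : R * R -> \bar R) : c != 0 -> c ^+ 2 + s ^+ 2 = 1 ->
  measurable_fun setT f -> (forall x, 0 <= f x)%E ->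
  (\int[normal_prob 0 1]_x \int[normal_prob 0 1]_y f (c * x + (- s) * y, s * x + c * y)%R =
   \int[normal_prob 0 1]_x \int[normal_prob 0 1]_y f (x, y))%E.
Proof.
move=> c0 cs mf f0.
rewrite (integral_normal_prob2 (measurableT_comp mf (measurable_linear_pair c (- s) s c)) (fun z => f0 _)).
rewrite (integral_normal_prob2 mf f0).
have mpdf : measurable_fun setT (fun x : R => normal_pdf 0 1 x) by exact: measurable_normal_pdf.
have mF : measurable_fun setT (fun z : R * R => f z * (normal_pdf 0 1 z.2 * normal_pdf 0 1 z.1)%:E)%E.
  apply: emeasurable_funM => //; apply/measurable_EFinP; apply: measurable_funM.
    exact: (measurableT_comp mpdf measurable_snd).
  exact: (measurableT_comp mpdf measurable_fst).
rewrite -[RHS](lebesgue_rotation c0 cs mF); last first.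
  by move=> z; rewrite mule_ge0// lee_fin mulr_ge0// normal_pdf_ge0.
apply: eq_integral => x _; apply: eq_integral => y _ /=.
by rewrite mulNr (normal_pdf_rotation x y cs).
Qed.

Lemma normal_rotationT (c s : R) (f : R * R -> \bar R) : c ^+ 2 + s ^+ 2 = 1 ->
  measurable_fun setT f -> (forall x, 0 <= f x)%E ->
  (\int[normal_prob 0 1]_x \int[normal_prob 0 1]_y f (c * x + (- s) * y, s * x + c * y)%R =
   \int[normal_prob 0 1]_x \int[normal_prob 0 1]_y f (x, y))%E.
Proof.
move=> cs mf f0; have [c0|c0] := eqVneq c 0; last exact: normal_rotation.
have s2 : s ^+ 2 = 1 by rewrite -cs c0 expr0n add0r.
(* A quarter turn is the product of two rotations with nonzero cosine. *)
pose a : R := 3 / 5; pose b : R := 4 / 5.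
have ab : a ^+ 2 + b ^+ 2 = 1 by rewrite /a /b; field.
have a0 : a != 0 by rewrite /a; apply: lt0r_neq0; lra.
have b0 : s * b != 0.
  rewrite mulf_neq0//; last by rewrite /b; apply: lt0r_neq0; lra.
  by apply/eqP => h; move: s2; rewrite h expr0n /= => /eqP; rewrite eq_sym oner_eq0.
have sab : (s * b) ^+ 2 + (s * a) ^+ 2 = 1.
  by transitivity (s ^+ 2 * (a ^+ 2 + b ^+ 2)); [ring|rewrite ab s2 mulr1].
rewrite -(normal_rotation a0 ab mf f0).
rewrite -[RHS](normal_rotation b0 sab (measurableT_comp mf (measurable_linear_pair a (- b) b a)) (fun z => f0 _)).
by apply: eq_integral => x _; apply: eq_integral => y _ /=; congr (f (_, _)); rewrite c0 /a /b; field.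
Qed.

End normal_density_integral.

(** * Rotation invariance of Gaussian vectors and matrices *)

Section gaussian_rotations.
Variable R : realType.

Lemma dotvE n (x y : 'cV[R]_n) : dotv x y = \sum_i x i 0 * y i 0.
Proof. by rewrite /dotv mxE; apply: eq_bigr => i _; rewrite mxE. Qed.

Lemma dotv_col_mx m n (x x' : 'cV[R]_m) (y y' : 'cV[R]_n) :
  dotv (col_mx x y) (col_mx x' y') = dotv x x' + dotv y y'.
Proof. by rewrite /dotv tr_col_mx mul_row_col mxE. Qed.

Lemma dotv_scalar (a b : R) : dotv (a%:M : 'cV[R]_1) b%:M = a * b.
Proof. by rewrite dotvE big_ord1 !mxE. Qed.

(** Invariance of the law is part of the predicate, so that it has to be proved only for plane
    rotations and then propagates through products and blocks. These already provide a rotation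
    taking any given vector to the first axis. *)
Definition gaussian_rotation n (Q : 'M[R]_n) := Q^T *m Q = 1%:M /\
  forall f : 'cV[R]_n -> \bar R, measurable_fun setT f -> (forall x, 0 <= f x)%E ->
    (\int[gaussian_mx n 1 1]_g f (Q *m g) = \int[gaussian_mx n 1 1]_g f g)%E.

Lemma measurable_mulmxl d (T : measurableType d) m n p (A : 'M[R]_(m, n)) (f : T -> 'M[R]_(n, p)) :
  measurable_fun setT f -> measurable_fun setT (fun x => A *m f x).
Proof. by move=> mf; apply: measurable_mulmx. Qed.

Lemma gaussian_rotation1 n : gaussian_rotation (1%:M : 'M[R]_n).
Proof.
split=> [|f mf f0]; first by rewrite trmx1 mulmx1.
by apply: eq_integral => g _; rewrite mul1mx.
Qed.

Lemma gaussian_rotationM n (Q1 Q2 : 'M[R]_n) :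
  gaussian_rotation Q1 -> gaussian_rotation Q2 -> gaussian_rotation (Q1 *m Q2).
Proof.
move=> [orth1 inv1] [orth2 inv2]; split=> [|f mf f0].
  by rewrite trmx_mul mulmxA -[_ *m Q1^T *m Q1]mulmxA orth1 mulmx1.
rewrite -(inv1 f mf f0) -(inv2 (fun g => f (Q1 *m g))).
- by apply: eq_integral => g _; rewrite mulmxA.
- by apply: measurableT_comp => //; exact: measurable_mulmxl.
- by move=> x; exact: f0.
Qed.

Lemma gaussian_rotation_block m n (Q : 'M[R]_n) :
  gaussian_rotation Q -> gaussian_rotation (block_mx (1%:M : 'M[R]_m) 0 0 Q).
Proof.
move=> [orth inv]; split=> [|f mf f0].
  rewrite tr_block_mx mulmx_block !trmx0 trmx1 !(mulmx0, mul0mx, mulmx1, addr0, add0r) orth.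
  by rewrite -scalar_mx_block.
have mQf : measurable_fun setT (fun g : 'cV[R]_(m + n) => f (block_mx (1%:M : 'M[R]_m) 0 0 Q *m g)).
  by apply: measurableT_comp => //; exact: measurable_mulmxl.
rewrite (integral_gaussian_col_mx 1 mQf (fun g => f0 _)) (integral_gaussian_col_mx 1 mf f0).
apply: eq_integral => A _.
have mA : measurable_fun setT (fun g => f (col_mx A g)).
  by apply: measurableT_comp => //; exact: measurable_col_mx.
rewrite -(inv _ mA (fun g => f0 _)); apply: eq_integral => B _.
by rewrite mul_block_col !mul0mx mul1mx addr0 add0r.
Qed.

(** The plane is always that of the first two coordinates, which is enough when the tail of a vector
    has already been rotated onto its first axis. *)
Definition givens_mx n (c s : R) : 'M[R]_(1 + (1 + n)) :=
  block_mx c%:M (row_mx (- s)%:M 0) (col_mx s%:M 0) (block_mx c%:M 0 0 1%:M).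

Lemma mul_givens_mx n c s (x y : R) (h : 'cV[R]_n) :
  givens_mx n c s *m col_mx x%:M (col_mx y%:M h) =
  col_mx (c * x - s * y)%:M (col_mx (s * x + c * y)%:M h).
Proof.
rewrite /givens_mx mul_block_col mul_row_col mul0mx addr0 mul_col_mx mul0mx.
rewrite mul_block_col !mul0mx mul1mx addr0 add0r add_col_mx add0r.
by rewrite -!scalar_mxM -!raddfD /= mulNr.
Qed.

Lemma measurable_scalar_mx d (T : measurableType d) n (f : T -> R) :
  measurable_fun setT f -> measurable_fun setT (fun x => (f x)%:M : 'M[R]_n).
Proof.
move=> mf; apply/measurable_fun_mxP => i j; under eq_fun do rewrite mxE.
by case: (i == j); [exact: mf|exact: measurable_cst].
Qed.

Lemma measurable_col2 d (T : measurableType d) n (f g : T -> R) (h : T -> 'cV[R]_n) :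
  measurable_fun setT f -> measurable_fun setT g -> measurable_fun setT h ->
  measurable_fun setT (fun x => col_mx (f x)%:M (col_mx (g x)%:M (h x)) : 'cV[R]_(1 + (1 + n))).
Proof.
move=> mf mg mh; apply: measurable_col_mx; first exact: measurable_scalar_mx.
by apply: measurable_col_mx => //; exact: measurable_scalar_mx.
Qed.

Lemma integral_gaussian_col1 n (f : 'cV[R]_(1 + n) -> \bar R) :
  measurable_fun setT f -> (forall x, 0 <= f x)%E ->
  (\int[gaussian_mx (1 + n) 1 1]_g f g =
   \int[normal_prob 0 1]_x \int[gaussian_mx n 1 1]_h f (col_mx x%:M h))%E.
Proof.
move=> mf f0; rewrite integral_gaussian_col_mx// gaussian_mx11//.
- apply: (measurable_fun_fubini_tonelli_F (m2 := gaussian_mx n 1 1)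
    (fun z : 'cV[R]_1 * 'cV[R]_n => f (col_mx z.1 z.2))) => //.
  by apply: (measurableT_comp mf); exact: measurable_col_mx.
- by move=> A; exact: integral_ge0.
Qed.

Lemma integral_gaussian_col2 n (f : 'cV[R]_(1 + (1 + n)) -> \bar R) :
  measurable_fun setT f -> (forall x, 0 <= f x)%E ->
  (\int[gaussian_mx (1 + (1 + n)) 1 1]_g f g =
   \int[normal_prob 0 1]_x \int[normal_prob 0 1]_y
     \int[gaussian_mx n 1 1]_h f (col_mx x%:M (col_mx y%:M h)))%E.
Proof.
move=> mf f0; rewrite integral_gaussian_col1//; apply: eq_integral => x _.
by rewrite integral_gaussian_col1//; apply: (measurableT_comp mf); exact: measurable_col_mx.
Qed.

Lemma gaussian_rotation_givens n (c s : R) : c ^+ 2 + s ^+ 2 = 1 ->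
  gaussian_rotation (givens_mx n c s).
Proof.
move=> cs; split=> [|f mf f0].
  rewrite /givens_mx tr_block_mx tr_row_mx tr_col_mx tr_block_mx !trmx0 trmx1 !tr_scalar_mx.
  rewrite mulmx_block mul_row_col mul_row_block mul_col_row mul_col_mx mul_mx_row.
  rewrite mulmx_block !(mulmx0, mul0mx, mulmx1, mul1mx, addr0, add0r).
  rewrite mul_block_col !mul0mx mulmx0 !addr0 -!scalar_mxM add_row_mx add_col_mx add_block_mx !addr0 !add0r -!raddfD /=.
  rewrite mulrNN [s * s + _]addrC -!expr2 cs.
  rewrite (_ : c * - s + _ = 0); last by ring.
  rewrite (_ : - s * c + _ = 0); last by ring.
  by rewrite raddf0 row_mx0 col_mx0 -!scalar_mx_block.
have mG : measurable_fun setT (fun g : 'cV[R]_(1 + (1 + n)) => f (givens_mx n c s *m g)).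
  by apply: measurableT_comp => //; exact: measurable_mulmxl.
rewrite (integral_gaussian_col2 mG (fun g => f0 _)) (integral_gaussian_col2 mf f0).
pose H (z : R * R) := (\int[gaussian_mx n 1 1]_h f (col_mx z.1%:M (col_mx z.2%:M h)))%E.
have mH : measurable_fun setT H.
  pose F (w : (R * R) * 'cV[R]_n) := f (col_mx w.1.1%:M (col_mx w.1.2%:M w.2)).
  apply: (measurable_fun_fubini_tonelli_F (m2 := gaussian_mx n 1 1) F); last by move=> w; exact: f0.
  apply: (measurableT_comp mf); apply: measurable_col2 => //.
    exact: (measurableT_comp measurable_fst measurable_fst).
  exact: (measurableT_comp measurable_snd measurable_fst).
rewrite -[RHS](normal_rotationT cs mH); last by move=> z; exact: integral_ge0.
apply: eq_integral => x _; apply: eq_integral => y _; apply: eq_integral => h _.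
by rewrite mul_givens_mx mulNr.
Qed.

(** The tail is rotated recursively onto its own first axis, and one plane rotation then merges the
    two remaining coordinates. The sign of [r] is left open, since in dimension one [r] is the entry
    itself. *)
Lemma rotate_to_first n (v : 'cV[R]_(1 + n)) :
  exists Q, gaussian_rotation Q /\ exists2 r : R, r ^+ 2 = dotv v v & Q *m v = col_mx r%:M 0.
Proof.
elim: n v => [|n IH] v; rewrite -(vsubmxK v).
  exists 1%:M; split; first exact: gaussian_rotation1.
  exists (usubmx v 0 0); last by rewrite mul1mx -mx11_scalar (flatmx0 (dsubmx v)).
  by rewrite dotv_col_mx [usubmx v]mx11_scalar dotv_scalar dotvE big_ord0 addr0 mxE.
set a := usubmx v; set w := dsubmx v.
have [Q [GQ [r r2 Qw]]] := IH w.
have dE : dotv (col_mx a w) (col_mx a w) = (a 0 0) ^+ 2 + r ^+ 2.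
  by rewrite dotv_col_mx r2 [a in dotv a a]mx11_scalar dotv_scalar.
have QvE : block_mx (1%:M : 'M[R]_1) 0 0 Q *m col_mx a w = col_mx (a 0 0)%:M (col_mx r%:M 0).
  by rewrite mul_block_col !mul0mx mul1mx addr0 add0r Qw -mx11_scalar.
have [N0|N0] := eqVneq ((a 0 0) ^+ 2 + r ^+ 2) 0.
  have /andP[/eqP a0 /eqP r0] : (a 0 0 == 0) && (r == 0).
    by move/eqP: N0; rewrite paddr_eq0 ?sqr_ge0// !sqrf_eq0.
  exists (block_mx 1%:M 0 0 Q); split; first exact: gaussian_rotation_block.
  by exists 0; [rewrite dE N0 expr0n|rewrite QvE a0 r0 raddf0 !col_mx0].
pose N := Num.sqrt ((a 0 0) ^+ 2 + r ^+ 2).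
have N2 : N ^+ 2 = (a 0 0) ^+ 2 + r ^+ 2 by rewrite sqr_sqrtr// addr_ge0 ?sqr_ge0.
have Nn0 : N != 0 by apply: contra_neq N0 => h; rewrite -N2 h expr0n.
have cs : (a 0 0 / N) ^+ 2 + (- r / N) ^+ 2 = 1.
  by rewrite !exprMn sqrrN -mulrDl -N2 -exprMn divff// expr1n.
exists (givens_mx n (a 0 0 / N) (- r / N) *m block_mx 1%:M 0 0 Q); split.
  apply: gaussian_rotationM; first exact: gaussian_rotation_givens.
  exact: gaussian_rotation_block.
exists N; first by rewrite dE N2.
rewrite -mulmxA QvE mul_givens_mx; congr col_mx.
  congr (_%:M); transitivity (((a 0 0) ^+ 2 + r ^+ 2) / N); first by field.
  by rewrite -N2 expr2 mulfK.
by rewrite (_ : _ + _ = 0) ?raddf0 ?col_mx0//; field.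
Qed.

(** The columns are independent standard Gaussian vectors and can be rotated one after the other. *)
Lemma gaussian_rotation_mx m n (Q : 'M[R]_m) (f : 'M[R]_(m, n) -> \bar R) :
  gaussian_rotation Q -> measurable_fun setT f -> (forall x, 0 <= f x)%E ->
  (\int[gaussian_mx m n 1]_G f (Q *m G) = \int[gaussian_mx m n 1]_G f G)%E.
Proof.
move=> [orth inv]; elim: n f => [|n IH]; last rewrite -[n.+1]add1n; move=> f mf f0.
  by apply: eq_integral => G _; congr f; rewrite [LHS]thinmx0 [RHS]thinmx0.
have mQf : measurable_fun setT (fun G : 'M[R]_(m, 1 + n) => f (Q *m G)).
  by apply: (measurableT_comp mf); exact: measurable_mulmxl.
have mfr (A : 'cV[R]_m) : measurable_fun setT (fun B : 'M[R]_(m, n) => f (row_mx A B)).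
  by apply: (measurableT_comp mf); exact: measurable_row_mx.
rewrite (integral_gaussian_row_mx (n1 := 1) 1 mQf (fun G => f0 _)).
rewrite (integral_gaussian_row_mx (n1 := 1) 1 mf f0).
rewrite -[RHS]inv; first last.
- by move=> A; exact: integral_ge0.
- apply: (measurable_fun_fubini_tonelli_F (m2 := gaussian_mx m n 1)
    (fun z : 'cV[R]_m * 'M[R]_(m, n) => f (row_mx z.1 z.2))) => //.
  by apply: (measurableT_comp mf); exact: measurable_row_mx.
apply: eq_integral => A _.
rewrite -(IH _ (mfr (Q *m A)) (fun B => f0 _)).
by apply: eq_integral => B _; rewrite mul_mx_row.
Qed.

Lemma gaussian_rotation_mxr m n (Q : 'M[R]_n) (f : 'M[R]_(m, n) -> \bar R) :
  gaussian_rotation Q -> measurable_fun setT f -> (forall x, 0 <= f x)%E ->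
  (\int[gaussian_mx m n 1]_G f (G *m Q^T) = \int[gaussian_mx m n 1]_G f G)%E.
Proof.
move=> GQ mf f0.
have mfQ : measurable_fun setT (fun G => f (G *m Q^T)).
  by apply: (measurableT_comp mf); exact: measurable_mulmx.
have mft : measurable_fun setT (fun G => f (G^T)).
  by apply: (measurableT_comp mf); exact: measurable_trmx.
rewrite (integral_gaussian_trmx _ mf f0) (integral_gaussian_trmx _ mfQ (fun G => f0 _)).
rewrite -(gaussian_rotation_mx GQ mft (fun G => f0 _)).
by apply: eq_integral => G _; rewrite trmx_mul.
Qed.

End gaussian_rotations.

(** * Estimates for the normal law *)

Section normal_facts.
Variable R : realType.
Local Notation mu := (@lebesgue_measure R).

(** The weight tilts the density of N(0, 1) into [s] times that of N(0, s^2). This single identity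
    yields the second moment, the bound on the fourth moment and the Laplace transform of the
    squared norm. *)
Lemma integral_normal_expR_sqr (s : R) : 0 < s ->
  (\int[normal_prob 0 1]_x (expR ((1 - s ^- 2) * x ^+ 2 / 2))%:E = s%:E)%E.
Proof.
move=> s0; have sn0 : s != 0 by apply: lt0r_neq0.
have me : measurable_fun setT (fun x : R => (expR ((1 - s ^- 2) * x ^+ 2 / 2))%:E).
  apply/measurable_EFinP; apply: measurableT_comp => //.
  by apply: measurable_funM => //; apply: measurable_funM => //; exact: measurable_funX.
rewrite (integral_normal_prob _ me); last by move=> x; rewrite lee_fin expR_ge0.
transitivity (\int[mu]_x (s%:E * (normal_pdf 0 s x)%:E))%E; last first.
  rewrite ge0_integralZl; first last.
  - by rewrite lee_fin ltW.
  - by move=> x _; rewrite lee_fin normal_pdf_ge0.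
  - by apply/measurable_EFinP; exact: measurable_normal_pdf.
  - exact: measurableT.
  by rewrite integral_normal_pdf mule1.
apply: eq_integral => x _; rewrite -!EFinM; congr EFin.
rewrite !normal_pdfE// ?oner_neq0// /normal_peak /normal_fun !subr0 expr1n mul1r.
rewrite mulrCA -expRD [RHS]mulrA; congr (_ * expR _).
  rewrite -[(s ^+ 2 * pi *+ 2)]mulrnAr sqrtrM ?sqr_ge0// sqrtr_sqr gtr0_norm//.
  by rewrite invfM mulrA divff ?mul1r.
by field.
Qed.

Lemma measurable_sqr : measurable_fun setT (fun x : R => (x ^+ 2)%:E).
Proof. by apply/measurable_EFinP; exact: measurable_funX. Qed.

Lemma integral_normal_cst (c : R) : (\int[normal_prob 0 1]_(x in [set: R]) (c%:E : \bar R) = c%:E)%E.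
Proof.
have h := @integral_cst _ (measurableTypeR R) R
  (normal_prob 0 1 : probability (measurableTypeR R) R) setT measurableT c%:E.
apply: (etrans h).
by rewrite -[RHS]mule1; congr (_ * _)%E; exact: (@probability_setT _ _ _ (normal_prob 0 1 : probability (measurableTypeR R) R)).
Qed.

Lemma integral_normal_sqrZ (c : R) : 0 <= c ->
  (\int[normal_prob 0 1]_x (c * x ^+ 2 : R)%:E =
   c%:E * \int[normal_prob 0 1]_x (x ^+ 2 : R)%:E)%E.
Proof.
move=> c0; rewrite -ge0_integralZl; first last.
- by rewrite lee_fin.
- by move=> x _; rewrite lee_fin sqr_ge0.
- exact: measurable_sqr.
- exact: measurableT.
by apply: eq_integral => x _; rewrite EFinM.
Qed.

Lemma measurable_sqrZ (c : R) : measurable_fun setT (fun x : R => (c * x ^+ 2)%:E).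
Proof. by apply/measurable_EFinP; apply: measurable_funM => //; exact: measurable_funX. Qed.

Lemma measurable_expR_sqr (c : R) : measurable_fun setT (fun x : R => (expR (c * x ^+ 2 / 2))%:E).
Proof.
apply/measurable_EFinP; apply: measurableT_comp => //.
by apply: measurable_funM => //; apply: measurable_funM => //; exact: measurable_funX.
Qed.

(* Integrating [1 + u <= expR u] at [u = (1 - s^-2) x^2 / 2], with [s] on either
   side of 1. *)
Lemma normal_second_moment : (\int[normal_prob 0 1]_x (x ^+ 2 : R)%:E = 1)%E.
Proof.
set I := (\int[normal_prob 0 1]_x (x ^+ 2 : R)%:E)%E.
have I0 : (0 <= I)%E by apply: integral_ge0 => x _; rewrite lee_fin sqr_ge0.
have above (s : R) : 1 < s -> (1 + ((1 - s ^- 2) / 2)%:E * I <= s%:E)%E.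
  move=> s1; have s0 : 0 < s by lra.
  have c0 : 0 <= (1 - s ^- 2) / 2.
    by rewrite divr_ge0// subr_ge0 invf_le1 ?exprn_gt0// exprn_ege1// ltW.
  rewrite -(integral_normal_expR_sqr s0) -integral_normal_sqrZ// -(integral_normal_cst 1).
  rewrite -ge0_integralD; first last.
  - exact: measurable_sqrZ.
  - by move=> x _; rewrite lee_fin mulr_ge0// sqr_ge0.
  - exact: measurable_cst.
  - by move=> x _; rewrite lee_fin.
  - exact: measurableT.
  apply: ge0_le_integral.
  - exact: measurableT.
  - by move=> x _; rewrite -EFinD lee_fin addr_ge0// mulr_ge0// sqr_ge0.
  - by apply: emeasurable_funD; [exact: measurable_cst|exact: measurable_sqrZ].
  - exact: measurable_expR_sqr.
  - move=> x _; rewrite -EFinD lee_fin; apply: le_trans (expR_ge1Dx _).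
    by rewrite lerD2l mulrAC.
have below (s : R) : 0 < s -> s < 1 -> (1 <= s%:E + ((s ^- 2 - 1) / 2)%:E * I)%E.
  move=> s0 s1.
  have c0 : 0 <= (s ^- 2 - 1) / 2.
    by rewrite divr_ge0// subr_ge0 invf_ge1 ?exprn_gt0// exprn_ile1// ltW.
  rewrite -(integral_normal_expR_sqr s0) -integral_normal_sqrZ// -(integral_normal_cst 1).
  rewrite -ge0_integralD; first last.
  - exact: measurable_sqrZ.
  - by move=> x _; rewrite lee_fin mulr_ge0// sqr_ge0.
  - exact: measurable_expR_sqr.
  - by move=> x _; rewrite lee_fin expR_ge0.
  - exact: measurableT.
  apply: ge0_le_integral.
  - exact: measurableT.
  - by move=> x _; rewrite lee_fin.
  - exact: measurable_cst.
  - by apply: emeasurable_funD; [exact: measurable_expR_sqr|exact: measurable_sqrZ].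
  - move=> x _; rewrite -EFinD lee_fin -lerBlDr; apply: le_trans (expR_ge1Dx _).
    by rewrite lerD2l -mulNr -mulNr opprB mulrAC.
have Ifin : I \is a fin_num.
  rewrite ge0_fin_numE// ltey; apply/eqP => Iy.
  have : (1 : R) < 2 by lra.
  move=> /above; rewrite Iy gt0_muley ?lte_fin; last by lra.
  by rewrite addey.
rewrite -(fineK Ifin) in I0 above below *.
move: (fine I) I0 above below => m; rewrite lee_fin => m0 above below.
(* [s] lies a quarter of the way from 1 to [m], hence on the same side of 1. With [m = 4 s - 3] the
   quantity in [id_s] factors as [(s - 1) ^+ 2 * (2 s + 3)], and its positivity contradicts [above]
   if [m > 1] and [below] if [m < 1]. *)
congr EFin; set s := (3 + m) / 4.
have id_s : s != 1 -> 0 < (s ^+ 2 - 1) * m - 2 * s ^+ 2 * (s - 1).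
  have -> : (s ^+ 2 - 1) * m - 2 * s ^+ 2 * (s - 1) = (s - 1) ^+ 2 * (2 * s + 3).
    by rewrite (_ : m = 4 * s - 3); [ring|rewrite /s; field].
  by move=> s1; rewrite mulr_gt0 ?exprn_even_gt0//= ?subr_eq0// /s; lra.
apply/eqP; rewrite eq_le; apply/andP; split; rewrite leNgt; apply/negP => h.
  have s1 : 1 < s by rewrite /s; lra.
  have := above s s1; rewrite -EFinM -EFinD lee_fin => hs.
  have : (s ^+ 2 - 1) * m <= 2 * s ^+ 2 * (s - 1).
    have -> : (s ^+ 2 - 1) * m = 2 * s ^+ 2 * ((1 - s ^- 2) / 2 * m) by field; lra.
    by apply: ler_wpM2l; [apply: mulr_ge0 => //; exact: sqr_ge0|lra].
  by move=> hs2; have := id_s (negbT (gt_eqF s1)); lra.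
have s1 : s < 1 by rewrite /s; lra.
have s0 : 0 < s by rewrite /s; lra.
have := below s s0 s1; rewrite -EFinM -EFinD lee_fin => hs.
have : 2 * s ^+ 2 * (1 - s) <= (1 - s ^+ 2) * m.
  have -> : (1 - s ^+ 2) * m = 2 * s ^+ 2 * ((s ^- 2 - 1) / 2 * m) by field; lra.
  by apply: ler_wpM2l; [apply: mulr_ge0 => //; exact: sqr_ge0|lra].
by move=> hs2; have := id_s (negbT (lt_eqF s1)); lra.
Qed.

End normal_facts.

Section normal_tails.
Variable R : realType.
Local Notation mu := (@lebesgue_measure R).

(** A crude value is harmless, as it only enters the number of samples. With [u = x^2 / 4],
    [x^4 = 16 u^2 <= 64 exp u], and the mean of [exp u] is the square root of 2. *)
Lemma normal_fourth_moment : (\int[normal_prob 0 1]_x (x ^+ 4 : R)%:E <= 128%:E)%E.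
Proof.
pose s : R := Num.sqrt 2.
have s2 : s ^+ 2 = 2 by rewrite sqr_sqrtr.
have s0 : 0 < s by rewrite sqrtr_gt0.
have sle : s <= 2 by rewrite -(@ler_pXn2r _ 2) ?nnegrE ?ltW// s2; lra.
apply: (@le_trans _ _ (64%:E * \int[normal_prob 0 1]_x (expR ((1 - s ^- 2) * x ^+ 2 / 2) : R)%:E)%E); last first.
  by rewrite integral_normal_expR_sqr// -EFinM lee_fin; lra.
rewrite -ge0_integralZl; first last.
- by rewrite lee_fin.
- by move=> x _; rewrite lee_fin expR_ge0.
- exact: measurable_expR_sqr.
- exact: measurableT.
apply: ge0_le_integral.
- exact: measurableT.
- by move=> x _; rewrite lee_fin exprn_even_ge0.
- by apply/measurable_EFinP; exact: measurable_funX.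
- by apply: emeasurable_funM; [exact: measurable_cst|exact: measurable_expR_sqr].
move=> x _; rewrite -EFinM lee_fin s2.
set u := (1 - 2^-1) * x ^+ 2 / 2.
have u0 : 0 <= u by rewrite /u; have := sqr_ge0 x; lra.
have -> : x ^+ 4 = 16 * u ^+ 2 by rewrite /u; field.
have -> : expR u = expR (u / 2) ^+ 2 by rewrite -expRM_natl; congr expR; lra.
have h : u / 2 <= expR (u / 2) by apply: le_trans (expR_ge1Dx _); lra.
have : (u / 2) ^+ 2 <= expR (u / 2) ^+ 2 by rewrite ler_pXn2r ?nnegrE ?expR_ge0//; lra.
have -> : (u / 2) ^+ 2 = u ^+ 2 / 4 by field.
lra.
Qed.

Lemma normal_peak1_le : normal_peak (1 : R) <= 2^-1.
Proof.
rewrite /normal_peak expr1n mul1r lef_pV2 ?posrE ?sqrtr_gt0//; last first.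
  by rewrite pmulrn_lgt0// pi_gt0.
rewrite -(@ler_pXn2r _ 2) ?nnegrE ?sqrtr_ge0// sqr_sqrtr; last by rewrite mulrn_wge0// pi_ge0.
by have := @pi_ge2 R; rewrite mulr2n expr2; lra.
Qed.

Lemma normal_peak1_ge : 3^-1 <= normal_peak (1 : R).
Proof.
rewrite /normal_peak expr1n mul1r lef_pV2 ?posrE ?sqrtr_gt0//; last first.
  by rewrite pmulrn_lgt0// pi_gt0.
rewrite -(@ler_pXn2r _ 2) ?nnegrE ?sqrtr_ge0// sqr_sqrtr; last by rewrite mulrn_wge0// pi_ge0.
have := @pihalf_02 R; rewrite mulr2n => /andP[_]; rewrite ltr_pdivrMr//; lra.
Qed.

Lemma normal_small_ball (t : R) : 0 <= t ->
  (normal_prob 0 1 [set x : R | (`|x| <= t)%R] <= t%:E)%E.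
Proof.
move=> t0; rewrite (_ : [set x | _] = `[- t, t]%classic); last first.
  by apply/seteqP; split => x /=; rewrite in_itv /= ler_norml.
apply: (@le_trans _ _ (\int[mu]_(x in `[(- t)%R, t]) (normal_peak 1)%:E)%E).
  apply: ge0_le_integral => //.
  - by move=> x _; rewrite lee_fin normal_pdf_ge0.
  - apply/measurable_EFinP; apply: measurable_funTS; exact: measurable_normal_pdf.
  - by move=> x _; rewrite lee_fin normal_pdf_ub// oner_neq0.
rewrite [leLHS]integral_cst//= lebesgue_measure_itv /= lte_fin.
have := normal_peak1_le; have := @normal_peak_ge0 R 1.
by case: ifP => _ p0 p1; rewrite -?EFinD -?EFinM ?mule0 lee_fin//; nra.
Qed.

(** On the unit window to the right of [sqrt d] the exponent [x^2 / 2] is at most [d + 1 <= 2 d] and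
    the peak is at least 1/3; the other half of [4 d] absorbs the 1/3, since [exp (2 d) >= 3]. *)
Lemma normal_tail_ge (d : nat) : (0 < d)%N ->
  ((expR (- (4 * d%:R)))%:E <= normal_prob 0 1 [set x : R | (Num.sqrt d%:R <= x)%R])%E.
Proof.
move=> d0; set t : R := Num.sqrt d%:R.
have t2 : t ^+ 2 = d%:R by rewrite sqr_sqrtr.
have t0 : 0 <= t by rewrite sqrtr_ge0.
have d1 : 1 <= d%:R :> R by rewrite ler1n.
apply: (@le_trans _ _ (\int[mu]_(x in `[t, (t + 1)%R]) (expR (- (4 * d%:R)))%:E)%E).
  rewrite [leRHS]integral_cst//= lebesgue_measure_itv /= lte_fin ltrDl ltr01.
  by rewrite -EFinD -EFinM lee_fin addrAC subrr add0r mulr1.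
apply: (@le_trans _ _ (\int[mu]_(x in `[t, (t + 1)%R]) (normal_pdf 0 1 x)%:E)%E).
  apply: ge0_le_integral => //.
  - apply/measurable_EFinP; apply: measurable_funTS; exact: measurable_normal_pdf.
  - move=> x; rewrite /= in_itv /= => /andP[x1 x2]; rewrite lee_fin.
    rewrite normal_pdfE ?oner_neq0// /normal_fun subr0 expr1n.
    apply: (@le_trans _ _ (3^-1 * expR (- (2 * d%:R)))); last first.
      apply: ler_pM; [by []|exact: expR_ge0|exact: normal_peak1_ge|].
      have : x ^+ 2 <= (t + 1) ^+ 2 by rewrite ler_pXn2r ?nnegrE//; lra.
      have : 2 * t <= t ^+ 2 + 1 by have := sqr_ge0 (t - 1); rewrite sqrrB1 -mulr_natl; lra.
      by rewrite ler_expR sqrrD1 t2 -mulr_natl; lra.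
    have -> : - (4 * d%:R) = - (2 * d%:R) + - (2 * d%:R) :> R by lra.
    rewrite expRD; apply: ler_wpM2r; first exact: expR_ge0.
    rewrite expRN lef_pV2 ?posrE ?expR_gt0//.
    by apply: le_trans (expR_ge1Dx _); lra.
rewrite /normal_prob; apply: ge0_subset_integral => //.
- rewrite (_ : [set x | _] = `[t, +oo[%classic)//.
  by apply/seteqP; split => x /=; rewrite in_itv /= andbT.
- apply/measurable_EFinP; apply: measurable_funTS; exact: measurable_normal_pdf.
- by move=> x _; rewrite lee_fin normal_pdf_ge0.
- by move=> x /=; rewrite in_itv /= => /andP[].
Qed.

End normal_tails.

Section gaussian_scaling.
Variable R : realType.

Lemma normal_prob_scale_set (s : R) (B : set R) : s != 0 -> measurable B ->
  normal_prob 0 s B = normal_prob 0 1 ((fun x => s * x) @^-1` B).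
Proof.
move=> s0 mB.
have mi : measurable_fun setT (fun x : R => (\1_B x : R)%:E).
  by apply/measurable_EFinP; exact: measurable_indic.
have := normal_prob_scale s0 mi (fun x => _).
rewrite (integral_indic (normal_prob 0 s : probability (measurableTypeR R) R) measurableT mB) setIT.
move=> ->; last by move=> x; rewrite lee_fin.
have mB' : measurable ((fun x : R => s * x) @^-1` B).
  by rewrite -[X in measurable X]setTI; apply: (measurable_funM (measurable_cst s) (@measurable_id _ _ _)).
have h := integral_indic (normal_prob 0 1 : probability (measurableTypeR R) R) measurableT mB'.
by rewrite setIT in h; apply: etrans h; apply: eq_integral.
Qed.

Lemma normal_probN (s : R) : normal_prob 0 (- s) = normal_prob 0 s.
Proof.
rewrite /normal_prob; apply/funext => B; congr (\int[_]_(x in _) _)%E.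
by apply/funext => x; rewrite /normal_pdf oppr_eq0 /normal_peak /normal_fun sqrrN.
Qed.

Lemma integral_gaussian_scale m n (s : R) (f : 'M[R]_(m, n) -> \bar R) : s != 0 ->
  measurable_fun setT f -> (forall x, 0 <= f x)%E ->
  (\int[gaussian_mx m n s]_M f M = \int[gaussian_mx m n 1]_M f (s *: M))%E.
Proof.
move=> s0 mf f0; have ms : measurable_fun setT (fun M : 'M[R]_(m, n) => s *: M).
  exact: measurable_scalemx.
apply: ge0_integral_law => //; apply: gaussian_mx_law => // B mB.
rewrite (_ : _ @^-1` _ = mx_rect (fun i j => (fun x => s * x) @^-1` B i j)).
  rewrite [LHS]gaussian_mx_rect.
    congr EFin; apply: eq_bigr => i _; apply: eq_bigr => j _.
    by rewrite (normal_prob_scale_set s0 (mB i j)).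
  move=> i j; rewrite -[X in measurable X]setTI.
  by apply: (measurable_funM (measurable_cst s) (@measurable_id _ _ _)).
by apply/seteqP; split => [M h i j|M h i j]; have := h i j; rewrite mxE.
Qed.

Lemma integral_gaussian_opp m n (f : 'M[R]_(m, n) -> \bar R) :
  measurable_fun setT f -> (forall x, 0 <= f x)%E ->
  (\int[gaussian_mx m n 1]_M f (- M)%R = \int[gaussian_mx m n 1]_M f M)%E.
Proof.
move=> mf f0.
have s0 : -1 != 0 :> R by rewrite oppr_eq0 oner_eq0.
transitivity (\int[gaussian_mx m n (-1)]_M f M)%E.
  by rewrite (integral_gaussian_scale s0 mf f0); apply: eq_integral => M _; rewrite scaleN1r.
apply: eq_measure_integral => A mA _.
apply: (@mx_measure_unique R m n (gaussian_mx m n (-1)) (gaussian_mx m n 1) _ A mA) => B mB.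
by rewrite (gaussian_mx_rect (-1) mB) (gaussian_mx_rect 1 mB) normal_probN.
Qed.

End gaussian_scaling.

(** * Markov, averaging by Fubini, and linear images of Gaussian matrices *)

Section probability_tools.
Variable R : realType.

Lemma le_measure_integral d (T : measurableType d) (P : probability T R) (A : set T)
    (h : T -> \bar R) : measurable A -> measurable_fun setT h -> (forall x, 0 <= h x)%E ->
  (forall x, A x -> 1 <= h x)%E -> (P A <= \int[P]_x h x)%E.
Proof.
move=> mA mh h0 hA; rewrite -(setIT A) -integral_indic//; apply: ge0_le_integral => //.
- exact/measurable_EFinP/measurable_indic.
- move=> x _; rewrite indicE; case: (boolP (x \in A)) => [xA|_]; last exact: h0.
  by apply: hA; rewrite inE in xA.
Qed.

Lemma markov_ge0 d (T : measurableType d) (P : probability T R) (h : T -> \bar R) (c : R) :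
  0 < c -> measurable_fun setT h -> (forall x, 0 <= h x)%E ->
  (P [set x | c%:E <= h x] <= (c^-1)%:E * \int[P]_x h x)%E.
Proof.
move=> c0 mh h0; rewrite -ge0_integralZl//; last by rewrite lee_fin invr_ge0 ltW.
apply: le_measure_integral.
- by have := emeasurable_fun_c_infty measurableT mh c%:E; rewrite setTI.
- by apply: emeasurable_funM => //; exact: measurable_cst.
- by move=> x; rewrite mule_ge0// lee_fin invr_ge0 ltW.
- move=> x /= cx; apply: (@le_trans _ _ ((c^-1)%:E * c%:E)%E).
    by rewrite -EFinM mulVf// gt_eqF.
  by apply: lee_wpmul2l => //; rewrite lee_fin invr_ge0 ltW.
Qed.

(** This replaces a union bound over a net. In the uses [t] is a random test vector and [u] the
    matrix: if every [u] with a bad direction is detected by at least a fraction [a] of the test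
    vectors, then the probability of such [u] is at most [1 / a] times the mean detection bound for
    a single test vector. *)
Lemma prob_averaging d1 d2 (T : measurableType d1) (U : measurableType d2)
    (P : probability T R) (Q : probability U R) (A : set (T * U)) (h : T -> \bar R) (a : R) :
  measurable A -> 0 < a -> measurable_fun setT h -> (forall t, Q (xsection A t) <= h t)%E ->
  (Q [set u | a%:E <= P (ysection A u)] <= (a^-1)%:E * \int[P]_t h t)%E.
Proof.
move=> mA a0 mh Ah.
apply: (@le_trans _ _ ((a^-1)%:E * \int[Q]_u P (ysection A u))%E).
  by apply: markov_ge0 => //; exact: measurable_fun_ysection.
apply: lee_wpmul2l; first by rewrite lee_fin invr_ge0 ltW.
rewrite (_ : (\int[Q]_u P (ysection A u) = \int[P]_t Q (xsection A t))%E).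
  apply: ge0_le_integral => //; exact: measurable_fun_xsection.
have PQE : (P \x Q)%E A = (P \x^ Q)%E A.
  apply: product_measure_unique => // B C mB mC.
  by rewrite [LHS]product_measure2E.
exact: esym PQE.
Qed.

Lemma dotv_ge0 n (x : 'cV[R]_n) : 0 <= dotv x x.
Proof. by rewrite dotvE sumr_ge0// => i _; rewrite -expr2 sqr_ge0. Qed.

Lemma dotvC n (x y : 'cV[R]_n) : dotv x y = dotv y x.
Proof. by rewrite !dotvE; apply: eq_bigr => i _; rewrite mulrC. Qed.

Lemma dotvDl n (x y z : 'cV[R]_n) : dotv (x + y) z = dotv x z + dotv y z.
Proof. by rewrite !dotvE -big_split; apply: eq_bigr => i _; rewrite mxE mulrDl. Qed.

Lemma dotvZl n a (x y : 'cV[R]_n) : dotv (a *: x) y = a * dotv x y.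
Proof. by rewrite !dotvE mulr_sumr; apply: eq_bigr => i _; rewrite mxE mulrA. Qed.

Lemma dotvDr n (x y z : 'cV[R]_n) : dotv z (x + y) = dotv z x + dotv z y.
Proof. by rewrite dotvC dotvDl !(dotvC z). Qed.

Lemma dotvZr n a (x y : 'cV[R]_n) : dotv x (a *: y) = a * dotv x y.
Proof. by rewrite dotvC dotvZl dotvC. Qed.

Lemma dotv_eq0 n (x : 'cV[R]_n) : dotv x x = 0 -> x = 0.
Proof.
rewrite dotvE => /eqP; rewrite psumr_eq0; last by move=> i _; rewrite -expr2 sqr_ge0.
move=> /allP h; apply/colP => i; rewrite mxE.
by have := h i (mem_index_enum i) => /=; rewrite -expr2 sqrf_eq0 => /eqP.
Qed.

Lemma dotv_mulmxl m n (A : 'M[R]_(m, n)) (x : 'cV[R]_n) (y : 'cV[R]_m) :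
  dotv (A *m x) y = dotv x (A^T *m y).
Proof. by rewrite /dotv trmx_mul mulmxA. Qed.

Lemma dotv_cauchy_schwarz n (x y : 'cV[R]_n) :
  dotv x y ^+ 2 <= dotv x x * dotv y y.
Proof.
have [y0|y0] := eqVneq (dotv y y) 0.
  rewrite (dotv_eq0 y0) (_ : dotv x 0 = 0) ?expr0n ?mulr_ge0 ?dotv_ge0//.
  by rewrite dotvE big1// => i _; rewrite mxE mulr0.
have yp : 0 < dotv y y by rewrite lt_def y0 dotv_ge0.
have := dotv_ge0 (dotv y y *: x + (- dotv x y) *: y).
rewrite !(dotvDl, dotvDr, dotvZl, dotvZr) (dotvC y x).
rewrite (_ : _ + _ = dotv y y * (dotv x x * dotv y y - dotv x y ^+ 2)); last by ring.
by rewrite pmulr_rge0// subr_ge0.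
Qed.

(* [G z] is a Gaussian vector with covariance [r^2 I]; for [k = 1] this is the law
   of a linear form. *)
Lemma integral_gaussian_mulmx k n (z : 'cV[R]_n.+1) (r : R) (f : 'cV[R]_k -> \bar R) :
  r ^+ 2 = dotv z z -> measurable_fun setT f -> (forall x, 0 <= f x)%E ->
  (\int[gaussian_mx k n.+1 1]_G f (G *m z) = \int[gaussian_mx k 1 1]_g f (r *: g))%E.
Proof.
move=> rz mf f0.
have [Q [GQ [s sz Qz]]] := rotate_to_first (z : 'cV[R]_(1 + n)).
have mz (w : 'cV[R]_n.+1) : measurable_fun setT (fun G : 'M[R]_(k, n.+1) => f (G *m w)).
  by apply: (measurableT_comp mf); exact: measurable_mulmx.
have mscale (c : R) : measurable_fun setT (fun g : 'cV[R]_k => f (c *: g)).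
  by apply: (measurableT_comp mf); exact: measurable_scalemx.
transitivity (\int[gaussian_mx k (1 + n) 1]_G f (G *m Q^T *m (col_mx s%:M 0 : 'cV[R]_(1 + n))))%E.
  by apply: eq_integral => G _; rewrite -Qz mulmxA -[G *m _ *m Q]mulmxA GQ.1 mulmx1.
rewrite (gaussian_rotation_mxr GQ (mz (col_mx s%:M 0 : 'cV[R]_(1 + n))) (fun G => f0 _)).
rewrite (integral_gaussian_row_mx (n1 := 1) 1 (mz (col_mx s%:M 0 : 'cV[R]_(1 + n))) (fun G => f0 _)).
transitivity (\int[gaussian_mx k 1 1]_A f (s *: A))%E.
  apply: eq_integral => A _.
  rewrite (_ : (fun B => _) = cst (f (s *: A))); last first.
    apply/funext => B.
    have E : row_mx A B *m col_mx s%:M 0 = s *: A.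
      by rewrite mul_row_col mulmx0 addr0 mul_mx_scalar.
    exact: (congr1 f E).
  by rewrite integral_cst//= [X in (_ * X)%E]probability_setT mule1.
(* The rotation yields a length [s] of uncontrolled sign; the symmetry of the Gaussian law makes the
   sign irrelevant. *)
have /orP[/eqP ->//|/eqP ->] : (r == s) || (r == - s) by rewrite -eqf_sqr rz sz.
rewrite -(integral_gaussian_opp (mscale (- s)) (fun g => f0 _)).
by apply: eq_integral => g _; rewrite scaleNr scalerN opprK.
Qed.

Lemma integral_gaussian_dotv n (z : 'cV[R]_n.+1) (r : R) (f : R -> \bar R) :
  r ^+ 2 = dotv z z -> measurable_fun setT f -> (forall x, 0 <= f x)%E ->
  (\int[gaussian_mx n.+1 1 1]_g f (dotv z g) = \int[normal_prob 0 1]_x f (r * x)%R)%E.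
Proof.
move=> rz mf f0.
have m00 : measurable_fun setT (fun A : 'M[R]_1 => f (A 0 0)).
  exact: (measurableT_comp mf (measurable_entry 0 0)).
have mg : measurable_fun setT (fun g : 'cV[R]_n.+1 => f (dotv z g)).
  by apply: (measurableT_comp mf); exact: measurable_dotv.
rewrite (integral_gaussian_trmx _ mg (fun g => f0 _)).
transitivity (\int[gaussian_mx 1 n.+1 1]_G f ((G *m z) 0 0)%R)%E.
  by apply: eq_integral => G _; rewrite dotvC /dotv trmxK.
rewrite (integral_gaussian_mulmx rz m00 (fun A => f0 _)).
have mr : measurable_fun setT (fun A : 'M[R]_1 => f ((r *: A) 0 0)%R).
  by apply: (measurableT_comp m00); exact: measurable_scalemx.
rewrite (gaussian_mx11 _ mr (fun A => f0 _)).
by apply: eq_integral => x _; rewrite !mxE mulr1n.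
Qed.

End probability_tools.

(** * Spectral estimates for Gaussian matrices *)

Section largest_eigenvalue.
Variable R : realType.

Lemma measurable_expR_dotv n (c : R) :
  measurable_fun setT (fun g : 'cV[R]_n => (expR (c * dotv g g))%:E).
Proof.
apply/measurable_EFinP; apply: measurableT_comp => //.
by apply: measurable_funM => //; exact: measurable_dotv.
Qed.

(** The Laplace transform of a chi-square variable at 1/4, which corresponds to tilting each
    coordinate to variance 2. *)
Lemma integral_gaussian_expR n :
  (\int[gaussian_mx n 1 1]_g (expR (4^-1 * dotv g g : R))%:E = (Num.sqrt 2 ^+ n)%:E)%E.
Proof.
elim: n => [|n IH].
  rewrite (_ : (fun g => _) = cst 1%E); last first.
    by apply/funext => g; rewrite dotvE big_ord0 mulr0 expR0.
  by rewrite integral_cst//= mul1e probability_setT.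
have h : forall g : 'cV[R]_(1 + n), (0 <= (expR (4^-1 * dotv g g))%:E)%E.
  by move=> g; rewrite lee_fin expR_ge0.
rewrite (@integral_gaussian_col1 _ n _ (@measurable_expR_dotv (1 + n) _) h).
have s0 : 0 < Num.sqrt 2 :> R by rewrite sqrtr_gt0.
transitivity (\int[normal_prob 0 1]_x ((Num.sqrt 2 ^+ n)%:E *
    (expR ((1 - Num.sqrt 2 ^- 2) * x ^+ 2 / 2) : R)%:E))%E.
  apply: eq_integral => x _; rewrite -IH.
  transitivity (\int[gaussian_mx n 1 1]_g ((expR (4^-1 * dotv g g : R))%:E *
     (expR ((1 - Num.sqrt 2 ^- 2) * x ^+ 2 / 2) : R)%:E))%E.
    apply: eq_integral => g _; rewrite -EFinM -expRD; congr (expR _)%:E.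
    by rewrite dotv_col_mx dotv_scalar sqr_sqrtr//; field.
  by rewrite ge0_integralZr//; exact: measurable_expR_dotv.
rewrite ge0_integralZl; first last.
- by rewrite lee_fin exprn_ge0// ltW.
- by move=> x _; rewrite lee_fin expR_ge0.
- exact: measurable_expR_sqr.
- exact: measurableT.
by rewrite (integral_normal_expR_sqr s0) -EFinM exprSr.
Qed.

(** Chernoff's bound with parameter 1/4; the square root of 2 is replaced by the larger [exp 1] to
    get a clean exponent. *)
Lemma gaussian_norm_tail n (t : R) :
  (gaussian_mx n 1 1 [set g : 'cV[R]_n | (t <= dotv g g)%R] <= (expR (n%:R - t / 4))%:E)%E.
Proof.
have mA : measurable [set g : 'cV[R]_n | (t <= dotv g g)%R].
  rewrite -[X in measurable X]setTI.
  have := @measurable_fun_ler _ 'cV[R]_n R setT (cst t) (fun g => dotv g g) (measurable_cst t)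
    (measurable_dotv (@measurable_id _ _ _) (@measurable_id _ _ _)).
  by move=> /(_ measurableT [set true] I).
apply: (@le_trans _ _ (\int[gaussian_mx n 1 1]_g
   ((expR (- (t / 4)))%:E * (expR (4^-1 * dotv g g))%:E))%E).
  apply: le_measure_integral => //.
  - by apply: emeasurable_funM; [exact: measurable_cst|exact: measurable_expR_dotv].
  - move=> g /= tg; rewrite -EFinM -expRD lee_fin -[leLHS]expR0 ler_expR; lra.
rewrite ge0_integralZl//; last exact: measurable_expR_dotv.
rewrite integral_gaussian_expR -EFinM lee_fin [n%:R - _]addrC expRD.
apply: ler_wpM2l; first exact: expR_ge0.
rewrite -[n%:R]mulr1 expRM_natl; apply: lerXn2r; rewrite ?nnegrE ?expR_ge0//.
rewrite -(@ler_pXn2r _ 2) ?nnegrE ?expR_ge0// sqr_sqrtr//.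
by have := expR_ge1Dx (1 : R); nra.
Qed.

Lemma measurable_le_dotv d (T : measurableType d) n (t : T -> R) (f g : T -> 'cV[R]_n) :
  measurable_fun setT t -> measurable_fun setT f -> measurable_fun setT g ->
  measurable [set x | t x <= dotv (f x) (g x)].
Proof.
move=> mt mf mg; rewrite -[X in measurable X]setTI.
by have := measurable_fun_ler mt (measurable_dotv mf mg) => /(_ measurableT [set true] I).
Qed.

Lemma measurable_le_sqr_dotv d (T : measurableType d) n (t : T -> R) (f g : T -> 'cV[R]_n) :
  measurable_fun setT t -> measurable_fun setT f -> measurable_fun setT g ->
  measurable [set x | t x <= dotv (f x) (g x) ^+ 2].
Proof.
move=> mt mf mg; rewrite -[X in measurable X]setTI.
have mfg := measurable_funX 2 (measurable_dotv mf mg).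
by have := measurable_fun_ler mt mfg => /(_ measurableT [set true] I).
Qed.

Lemma prob_gaussian_mulmx k n (z : 'cV[R]_n.+1) (r : R) (B : set 'cV[R]_k) :
  r ^+ 2 = dotv z z -> measurable B ->
  gaussian_mx k n.+1 1 [set G | B (G *m z)] = gaussian_mx k 1 1 [set g | B (r *: g)].
Proof.
move=> rz mB.
have mi : measurable_fun setT (fun g : 'cV[R]_k => (\1_B g : R)%:E).
  by apply/measurable_EFinP; exact: measurable_indic.
have mz : measurable_fun setT (fun G : 'M[R]_(k, n.+1) => G *m z) by exact: measurable_mulmx.
have mr : measurable_fun setT (fun g : 'cV[R]_k => r *: g) by exact: measurable_scalemx.
have m1 : measurable [set G : 'M[R]_(k, n.+1) | B (G *m z)].
  by rewrite -[X in measurable X]setTI; exact: mz.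
have m2 : measurable [set g : 'cV[R]_k | B (r *: g)].
  by rewrite -[X in measurable X]setTI; exact: mr.
have i0 (g : 'cV[R]_k) : (0 <= (\1_B g : R)%:E)%E by rewrite lee_fin.
have := integral_gaussian_mulmx rz mi i0.
have h1 := integral_indic (gaussian_mx k n.+1 1) measurableT m1.
have h2 := integral_indic (gaussian_mx k 1 1) measurableT m2.
rewrite setIT in h1; rewrite setIT in h2; rewrite -h1 -h2 => h; apply: etrans (etrans _ h) _.
  exact: eq_integral.
exact: eq_integral.
Qed.

Lemma prob_gaussian_dotv n (z : 'cV[R]_n.+1) (r : R) (B : set R) :
  r ^+ 2 = dotv z z -> measurable B ->
  gaussian_mx n.+1 1 1 [set g | B (dotv z g)] = normal_prob 0 1 [set x | B (r * x)].
Proof.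
move=> rz mB.
have mi : measurable_fun setT (fun g : R => (\1_B g : R)%:E).
  by apply/measurable_EFinP; exact: measurable_indic.
have mz : measurable_fun setT (fun g : 'cV[R]_n.+1 => dotv z g) by exact: measurable_dotv.
have mr : measurable_fun setT (fun x : R => r * x) by exact: measurable_funM.
have m1 : measurable [set g : 'cV[R]_n.+1 | B (dotv z g)].
  by rewrite -[X in measurable X]setTI; exact: mz.
have m2 : measurable [set x : R | B (r * x)].
  by rewrite -[X in measurable X]setTI; exact: mr.
have i0 (g : R) : (0 <= (\1_B g : R)%:E)%E by rewrite lee_fin.
have := integral_gaussian_dotv rz mi i0.
have h1 := integral_indic (gaussian_mx n.+1 1 1) measurableT m1.
have h2 := integral_indic (normal_prob 0 1 : probability (measurableTypeR R) R) measurableT m2.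
rewrite setIT in h1; rewrite setIT in h2; rewrite -h1 => h; apply: etrans (etrans _ (etrans h _)) h2.
  exact: eq_integral.
exact: eq_integral.
Qed.

End largest_eigenvalue.

Section operator_norm.
Variable R : realType.

(* If [G^T x] is too long, [x . G z = G^T x . z >= sqrt d |G^T x|] with probability at
   least [expR (- 4 d)] over a Gaussian [z], and then [|G z|] is too large. *)
Lemma gaussian_opnorm_tail n (K : R) : 0 <= K ->
  exists B : set 'M[R]_n.+1, [/\ measurable B,
    (gaussian_mx n.+1 n.+1 1 B <= (2 * expR (5 * n.+1%:R - K * n.+1%:R / 4))%:E)%E &
    forall G, ~ B G -> forall x, dotv (G^T *m x) (G^T *m x) <= K ^+ 2 * n.+1%:R * dotv x x].
Proof.
move=> K0; set d : R := n.+1%:R; have d0 : 0 < d by rewrite /d ltr0n.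
pose e := expR (d - K * d / 4).
pose P := gaussian_mx n.+1 1 (1 : R); pose Q := gaussian_mx n.+1 n.+1 (1 : R).
pose A := [set p : 'cV[R]_n.+1 * 'M[R]_n.+1 | (K * d) ^+ 2 <= dotv (p.2 *m p.1) (p.2 *m p.1)].
have mA : measurable A.
  by apply: measurable_le_dotv => //; apply: measurable_mulmx.
pose T := [set z : 'cV[R]_n.+1 | K * d <= dotv z z].
have mT : measurable T by apply: measurable_le_dotv => //.
(* Test vectors with [|z|^2 >= K d] are given up. For the others [G z] is [|z|] times a Gaussian
   [g], so [|G z| >= K d] forces [|g|^2 >= K d]. Both events have probability at most [e], whence
   the factor 2 in the bound. *)
pose h (z : 'cV[R]_n.+1) := ((\1_T z : R)%:E + e%:E)%E.
have mh : measurable_fun setT h.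
  by apply: emeasurable_funD => //; apply/measurable_EFinP; exact: measurable_indic.
have Ah z : (Q (xsection A z) <= h z)%E.
  rewrite /h indicE; case: (boolP (z \in T)) => zT.
    by apply: (le_trans (probability_le1 _ (measurable_xsection _ mA))); rewrite -EFinD lee_fin lerDl expR_ge0.
  rewrite add0e; pose r := Num.sqrt (dotv z z).
  have rz : r ^+ 2 = dotv z z by rewrite sqr_sqrtr// dotv_ge0.
  have mB : measurable [set g : 'cV[R]_n.+1 | (K * d) ^+ 2 <= dotv g g] by apply: measurable_le_dotv.
  rewrite (_ : xsection A z = [set G | [set g : 'cV[R]_n.+1 | (K * d) ^+ 2 <= dotv g g] (G *m z)]); last first.
    by apply/seteqP; split => G; rewrite /xsection /= inE.
  rewrite /Q (prob_gaussian_mulmx rz mB); apply: le_trans (gaussian_norm_tail _ (K * d)).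
  apply: le_measure; rewrite ?inE.
  - by apply: measurable_le_dotv => //; exact: measurable_scalemx.
  - exact: measurable_le_dotv.
  move=> g /=; rewrite dotvZl dotvZr mulrA -expr2 rz => hg.
  have zlt : dotv z z < K * d by move: zT; rewrite notin_setE /T /= => /negP; rewrite -ltNge.
  have Kd0 : 0 < K * d by apply: le_lt_trans (dotv_ge0 z) zlt.
  rewrite -(ler_pM2l Kd0) -expr2; apply: le_trans hg _.
  by apply: ler_wpM2r; [exact: dotv_ge0|exact: ltW].
(* The lower bound of [normal_tail_ge] on the detection probability; dividing by it raises the
   exponent from [d] to [5 d]. *)
pose a := expR (- (4 * d)).
have a0 : 0 < a by rewrite expR_gt0.
exists [set G | (a%:E <= P (ysection A G))%E]; split.
- have := emeasurable_fun_c_infty measurableT (measurable_fun_ysection P mA) a%:E.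
  by rewrite setTI.
- apply: le_trans (prob_averaging P mA a0 mh Ah) _.
  have hI : (\int[P]_z h z <= (2 * e)%:E)%E.
    rewrite /h ge0_integralD//; first last.
    + by move=> z _; rewrite lee_fin expR_ge0.
    + by apply/measurable_EFinP; exact: measurable_indic.
    rewrite integral_indic// setIT integral_cst// [X in (_ * X)%E]probability_setT mule1.
    rewrite mulr_natl mulr2n EFinD; apply: leeD => //; exact: gaussian_norm_tail.
  apply: le_trans (lee_wpmul2l _ hI) _; first by rewrite lee_fin invr_ge0 ltW.
  rewrite -EFinM lee_fin /a /e expRN invrK mulrCA -expRD.
  by rewrite ler_pM2l// ler_expR; lra.
move=> G /= /negP; rewrite -ltNge => hG x; rewrite leNgt; apply/negP => hx.
set w := G^T *m x in hx.
pose r := Num.sqrt (dotv w w).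
have rw : r ^+ 2 = dotv w w by rewrite sqr_sqrtr// dotv_ge0.
have x0 : 0 <= dotv x x by exact: dotv_ge0.
have w0 : 0 < dotv w w.
  by apply: le_lt_trans hx; rewrite !mulr_ge0// ?sqr_ge0// ltW.
have r0 : 0 < r by rewrite sqrtr_gt0.
move: hG; rewrite ltNge => /negP; apply.
apply: le_trans (normal_tail_ge R (ltn0Sn n)) _.
rewrite (_ : [set y | _] = [set y | `[Num.sqrt d * r, +oo[%classic (r * y)]); last first.
  apply/seteqP; split => y /=; rewrite in_itv /= andbT [r * y]mulrC ler_pM2r//.
rewrite -(prob_gaussian_dotv rw)//.
apply: le_measure; rewrite ?inE.
- rewrite -[X in measurable X]setTI.
  have mw : measurable_fun setT (fun g : 'cV[R]_n.+1 => dotv w g) by exact: measurable_dotv.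
  by apply: mw.
- exact: measurable_ysection.
move=> z hz'; have hz : Num.sqrt d * r <= dotv w z by move: hz'; rewrite /= in_itv /= andbT.
rewrite /ysection /= inE /A /=.
have Cs := dotv_cauchy_schwarz x (G *m z).
have E : dotv x (G *m z) = dotv w z by rewrite dotvC dotv_mulmxl dotvC.
have h1 : d * dotv w w <= dotv w z ^+ 2.
  have -> : d * dotv w w = (Num.sqrt d * r) ^+ 2 by rewrite exprMn sqr_sqrtr ?ltW// rw.
  have s0 : 0 <= Num.sqrt d * r by rewrite mulr_ge0 ?sqrtr_ge0// ltW.
  by apply: lerXn2r; rewrite ?nnegrE//; exact: le_trans hz.
rewrite E in Cs.
have xp : 0 < dotv x x.
  rewrite lt_def x0 andbT; apply/eqP => xx0; move: w0.
  by rewrite /w (dotv_eq0 xx0) mulmx0 /dotv mulmx0 mxE ltxx.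
rewrite -(ler_pM2l xp); apply: le_trans Cs; apply: le_trans h1.
rewrite exprMn expr2 [d ^+ 2]expr2.
have := ltW hx; move=> /(ler_wpM2l (ltW d0)); rewrite expr2; apply: le_trans.
by rewrite le_eqVlt; apply/orP; left; apply/eqP; ring.
Qed.

End operator_norm.

(** * The inverse of a Gaussian matrix through its cofactors; almost sure invertibility *)

Section gaussian_inverse.
Variable R : realType.

(** The generalized cross product of the rows of [B]: the coefficients of the determinant as a
    linear form in a row placed on top of [B]. The zero row is a placeholder, as these cofactors do
    not see it. *)
Definition first_cofactors n (B : 'M[R]_(n, 1 + n)) : 'cV[R]_(1 + n) :=
  \col_j cofactor (col_mx (0 : 'rV[R]_(1 + n)) B) 0 j.

Lemma cofactor_col_mx n (a a' : 'rV[R]_(1 + n)) (B : 'M[R]_(n, 1 + n)) j :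
  cofactor (col_mx a B) 0 j = cofactor (col_mx a' B) 0 j.
Proof.
rewrite /cofactor; congr (_ * \det _); apply/matrixP => i k; rewrite !mxE.
by rewrite -!rshift1 (unsplitK (inr _)).
Qed.

Lemma det_col_mx n (a : 'rV[R]_(1 + n)) (B : 'M[R]_(n, 1 + n)) :
  \det (col_mx a B : 'M[R]_(1 + n)) = dotv (first_cofactors B) a^T.
Proof.
rewrite (expand_det_row _ 0) dotvE; apply: eq_bigr => j _; rewrite !mxE.
rewrite (cofactor_col_mx a 0) mulrC; congr (_ * _).
have -> : (0 : 'I_(1 + n)) = lshift n (0 : 'I_1) by apply/val_inj.
by rewrite (unsplitK (inl _)).
Qed.

Lemma first_cofactors0 n (B : 'M[R]_(n, 1 + n)) :
  first_cofactors B 0 0 = \det (rsubmx B).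
Proof.
rewrite mxE /cofactor /= expr0 mul1r; congr (\det _); apply/matrixP => i j; rewrite !mxE.
by rewrite -!rshift1 (unsplitK (inr _)).
Qed.

Lemma invmx_col_mx n (a : 'rV[R]_(1 + n)) (B : 'M[R]_(n, 1 + n)) (s : R) :
  let G : 'M[R]_(1 + n) := col_mx a B in \det G != 0 ->
  invmx G *m (col_mx s%:M 0 : 'cV[R]_(1 + n)) = (s / \det G) *: first_cofactors B.
Proof.
move=> G G0; rewrite /invmx unitmxE unitfE G0 -scalemxAl.
rewrite -[\adj G](@hsubmxK _ (1 + n) 1 n) mul_row_col mulmx0 addr0 mul_mx_scalar scalerA mulrC.
congr (_ *: _); apply/colP => j; rewrite !mxE (cofactor_col_mx 0 a).
by congr (cofactor _ _ _); apply/val_inj.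
Qed.

Lemma measurable_neq0 d (T : measurableType d) (g : T -> R) :
  measurable_fun setT g -> measurable_fun setT (fun x => g x != 0).
Proof. by move=> mg; apply: measurable_neg; apply: measurable_fun_eqr. Qed.

(** Rotate [v] to [s e_1]. With [a] the first row and [C] the cofactors of the remaining rows,
    [|G^-1 v|^2 = s^2 |C|^2 / (C . a)^2]. Given the remaining rows, [C . a] is distributed as [|C|]
    times a standard normal variable, so [|C|] cancels. Singular matrices contribute 0 on the left,
    hence an inequality. *)
Lemma integral_gaussian_invmx n (v : 'cV[R]_(1 + n)) (f : R -> \bar R) :
  measurable_fun setT f -> (forall x, 0 <= f x)%E ->
  (\int[gaussian_mx (1 + n) (1 + n) 1]_G
     (if (\det G != 0)%R then f (dotv (invmx G *m v) (invmx G *m v)) else 0) <=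
   \int[normal_prob 0 1]_x f (dotv v v / x ^+ 2)%R)%E.
Proof.
move=> mf f0.
pose F (w : 'cV[R]_(1 + n)) (G : 'M[R]_(1 + n)) : \bar R :=
  (if (\det G != 0)%R then f (dotv (invmx G *m w) (invmx G *m w)) else 0)%E.
have mF w : measurable_fun setT (F w).
  apply: measurable_fun_ifT.
  - by apply: measurable_neq0; exact: measurable_det.
  - apply: (measurableT_comp mf); apply: measurable_dotv.
      by apply: measurable_mulmx => //; exact: measurable_invmx.
    by apply: measurable_mulmx => //; exact: measurable_invmx.
  - exact: measurable_cst.
have F0 w G : (0 <= F w G)%E by rewrite /F; case: ifP.
have [Q [GQ [s sv Qv]]] := rotate_to_first v.
have Qu : Q \in unitmx by case/mulmx1_unit: GQ.1.
set w : 'cV[R]_(1 + n) := col_mx s%:M 0.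
have FE G : F v G = F w (Q *m G).
  have Qd : \det Q != 0 by rewrite -unitfE -unitmxE.
  rewrite /F det_mulmx mulf_eq0 (negbTE Qd) /=.
  case: ifP => // G0; have Gu : G \in unitmx by rewrite unitmxE unitfE.
  have QGu : Q *m G \in unitmx by rewrite unitmx_mul Qu Gu.
  suff -> : invmx (Q *m G) *m w = invmx G *m v by [].
  have h : Q *m G *m (invmx G *m v) = w by rewrite -mulmxA mulKVmx.
  by rewrite -h mulKmx.
rewrite (_ : (\int[_]_G _ = \int[gaussian_mx (1 + n) (1 + n) 1]_G F w G)%E); last first.
  rewrite -(gaussian_rotation_mx GQ (mF w) (F0 w)); apply: eq_integral => G _; exact: FE.
rewrite (integral_gaussian_col_mx (m1 := 1) (m2 := n) 1 (mF w) (F0 w)).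
pose F2 (z : 'M[R]_(1, 1 + n) * 'M[R]_(n, 1 + n)) := F w (col_mx z.1 z.2).
have mF2 : measurable_fun setT F2.
  by apply: (measurableT_comp (mF w)); apply: (measurable_col_mx (m1 := 1)).
rewrite (fubini_tonelli (m1 := gaussian_mx 1 (1 + n) 1) (m2 := gaussian_mx n (1 + n) 1) F2 mF2 (fun z => F0 _ _)).
set I := (\int[normal_prob 0 1]_x _)%E.
have I0 : (0 <= I)%E by apply: integral_ge0.
have inner B : (\int[gaussian_mx 1 (1 + n) 1]_a F2 (a, B) <= I)%E.
  set C := first_cofactors B; pose r := Num.sqrt (dotv C C).
  have rC : r ^+ 2 = dotv C C by rewrite sqr_sqrtr// dotv_ge0.
  pose phi (t : R) : \bar R := (if (t != 0)%R then f (s ^+ 2 * r ^+ 2 / t ^+ 2)%R else 0)%E.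
  have mphi : measurable_fun setT phi.
    apply: measurable_fun_ifT => //; first exact: measurable_neq0.
    apply: (measurableT_comp mf); apply: measurable_funM => //.
    by apply: measurableT_comp; [exact: measurable_invr|exact: measurable_funX].
  have phi0 t : (0 <= phi t)%E by rewrite /phi; case: ifP.
  have mCg : measurable_fun setT (fun g : 'cV[R]_(1 + n) => phi (dotv C g)).
    by apply: (measurableT_comp mphi); exact: measurable_dotv.
  have mCa : measurable_fun setT (fun a : 'rV[R]_(1 + n) => phi (dotv C a^T)).
    by apply: (measurableT_comp mphi); apply: measurable_dotv => //; exact: measurable_trmx.
  rewrite (_ : (\int[_]_a _ = \int[gaussian_mx 1 (1 + n) 1]_a phi (dotv C a^T))%E); last first.
    apply: eq_integral => a _; rewrite /F2 /F /phi /=.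
    have := @invmx_col_mx n a B s; rewrite /= (det_col_mx a B) -/C; case: ifP => // t0 ->//.
    by rewrite dotvZl dotvZr rC; congr f; rewrite -/C; field.
  rewrite (integral_gaussian_trmx _ mCa (fun a => phi0 _)).
  rewrite (_ : (\int[_]_a _ = \int[gaussian_mx (1 + n) 1 1]_g phi (dotv C g))%E); last first.
    by apply: eq_integral => g _; rewrite trmxK.
  rewrite (integral_gaussian_dotv rC mphi phi0).
  apply: ge0_le_integral.
  - exact: measurableT.
  - by move=> x _.
  - by apply: (measurableT_comp mphi); exact: measurable_funM.
  - apply: (measurableT_comp mf); apply: measurable_funM => //.
    by apply: measurableT_comp; [exact: measurable_invr|exact: measurable_funX].
  - move=> x _; rewrite /phi; case: ifP => //; rewrite mulf_eq0 negb_or => /andP[r0 x0].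
    by rewrite exprMn invfM mulrA mulfK ?expf_neq0// sv.
apply: (@le_trans _ _ (\int[gaussian_mx n (1 + n) 1]_B (cst I) B)%E).
  apply: ge0_le_integral => //.
  - by move=> B _; apply: integral_ge0 => a _; exact: F0.
  - exact: (measurable_fun_fubini_tonelli_G (m1 := gaussian_mx 1 (1 + n) 1) F2 mF2 (fun z => F0 _ _)).
by rewrite integral_cst// [X in (_ * X)%E]probability_setT mule1.
Qed.

(** The first cofactor of the lower rows is a Gaussian determinant of smaller size, almost surely
    nonzero by induction. The cofactor vector [C] is then nonzero, and [C . a] is a nondegenerate
    normal variable, which vanishes with probability 0. *)
Lemma gaussian_det_neq0 n : (\int[gaussian_mx n n 1]_G ((\det G == 0)%:R : R)%:E = 0)%E.
Proof.
elim: n => [|n IH].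
  by apply: integral0_eq => G _; rewrite det_mx00 oner_eq0.
have mz d (T : measurableType d) (g : T -> R) : measurable_fun setT g ->
    measurable_fun setT (fun x => ((g x == 0)%:R : R)%:E).
  move=> mg; apply/measurable_EFinP.
  rewrite (_ : (fun x => _) = fun x => if g x == 0 then 1 else 0 : R); last first.
    by apply/funext => x; case: eqP.
  by apply: measurable_fun_ifT => //; exact: measurable_fun_eqr.
have z0 (b : bool) : (0 <= (b%:R : R)%:E)%E by rewrite lee_fin.
have mdet : measurable_fun setT (fun G : 'M[R]_(1 + n) => ((\det G == 0)%:R : R)%:E).
  by apply: mz; exact: measurable_det.
rewrite (integral_gaussian_col_mx (m1 := 1) (m2 := n) 1 mdet (fun G => z0 _)).
pose F2 (z : 'M[R]_(1, 1 + n) * 'M[R]_(n, 1 + n)) := ((\det (col_mx z.1 z.2 : 'M[R]_(1 + n)) == 0)%:R : R)%:E.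
have mF2 : measurable_fun setT F2.
  by apply: (measurableT_comp mdet); apply: (measurable_col_mx (m1 := 1)).
rewrite (fubini_tonelli (m1 := gaussian_mx 1 (1 + n) 1) (m2 := gaussian_mx n (1 + n) 1) F2 mF2 (fun z => z0 _)).
have mrs : measurable_fun setT (fun B : 'M[R]_(n, 1 + n) => ((\det (rsubmx B) == 0)%:R : R)%:E).
  apply: mz; apply: measurable_det; apply/measurable_fun_mxP => i j.
  by under eq_fun do rewrite mxE; exact: measurable_entry.
apply/eqP; rewrite eq_le integral_ge0 ?andbT//; last first.
  by move=> B _; apply: integral_ge0 => a _; exact: z0.
apply: (@le_trans _ _ (\int[gaussian_mx n (1 + n) 1]_B ((\det (rsubmx B) == 0)%:R : R)%:E)%E).
  apply: ge0_le_integral => //.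
  - by move=> B _; apply: integral_ge0 => a _; exact: z0.
  - exact: (measurable_fun_fubini_tonelli_G (m1 := gaussian_mx 1 (1 + n) 1) F2 mF2 (fun z => z0 _)).
  move=> B _; case: eqP => [dB|/eqP dB].
    apply: (@le_trans _ _ (\int[gaussian_mx 1 (1 + n) 1]_a cst 1 a)%E).
      apply: ge0_le_integral => //.
      + by move=> a _; exact: z0.
      + exact: (measurableT_comp mF2 (measurable_pair2 B)).
      + by move=> a _; rewrite /F2 lee_fin; case: eqP.
    by rewrite integral_cst// [X in (_ * X)%E]probability_setT mule1.
  set C := first_cofactors B; pose r := Num.sqrt (dotv C C).
  have rC : r ^+ 2 = dotv C C by rewrite sqr_sqrtr// dotv_ge0.
  have r0 : r != 0.
    apply: contra_neq dB => r0; rewrite -first_cofactors0 -/C.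
    by move: rC; rewrite r0 expr0n /= => /esym/dotv_eq0 ->; rewrite mxE.
  have mg0 : measurable_fun setT (fun t : R => ((t == 0)%:R : R)%:E) by apply: mz.
  have mCa : measurable_fun setT (fun a : 'rV[R]_(1 + n) => ((dotv C a^T == 0)%:R : R)%:E).
    by apply: mz; apply: measurable_dotv => //; exact: measurable_trmx.
  rewrite (_ : (\int[_]_a _ = \int[gaussian_mx 1 (1 + n) 1]_a ((dotv C a^T == 0)%:R : R)%:E)%E); last first.
    by apply: eq_integral => a _; rewrite /F2 /= det_col_mx.
  rewrite (integral_gaussian_trmx _ mCa (fun a => z0 _)).
  rewrite (_ : (\int[_]_a _ = \int[gaussian_mx (1 + n) 1 1]_g ((dotv C g == 0)%:R : R)%:E)%E); last first.
    by apply: eq_integral => g _; rewrite trmxK.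
  rewrite (integral_gaussian_dotv rC mg0 (fun t => z0 _)).
  have m0 : measurable [set x : R | (`|x| <= 0)%R].
    by rewrite (_ : [set x | _] = [set 0])//; apply/seteqP; split => x /=; rewrite normr_le0 => /eqP.
  have := normal_small_ball (lexx (0 : R)).
  have h := integral_indic (normal_prob 0 1 : probability (measurableTypeR R) R) measurableT m0.
  rewrite setIT in h; rewrite -h => h0; apply: le_trans h0.
  rewrite le_eqVlt; apply/orP; left; apply/eqP; apply: eq_integral => x _.
  by rewrite mulf_eq0 (negbTE r0) /= indicE; congr ((nat_of_bool _)%:R)%:E; apply/idP/idP; rewrite inE /= normr_le0.
have h0 (A : 'M[R]_(n, 1)) : (\int[gaussian_mx n n 1]_B ((\det (rsubmx (row_mx A B)) == 0)%:R : R)%:E = 0)%E.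
  by rewrite -[RHS]IH; apply: eq_integral => B _; rewrite row_mxKr.
rewrite (integral_gaussian_row_mx (n1 := 1) (n2 := n) 1 mrs (fun B => z0 _)).
by rewrite (eq_integral (cst 0%E)) ?integral_cst ?mul0e// => A _; exact: h0.
Qed.

End gaussian_inverse.

(** * Lower bounds for the spectrum and for the trace of the inverse *)

Section smallest_eigenvalue.
Variable R : realType.

Lemma prob_setU_le d (T : measurableType d) (P : probability T R) (A B : set T) (a b : R) :
  measurable A -> measurable B -> (P A <= a%:E)%E -> (P B <= b%:E)%E ->
  (P (A `|` B) <= (a + b)%:E)%E.
Proof.
move=> mA mB Aa Bb; apply: (le_trans (measureU2 P mA mB)).
by rewrite EFinD; exact: leeD.
Qed.

Lemma measurable_singular n : measurable [set G : 'M[R]_n | \det G == 0].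
Proof.
rewrite -[X in measurable X]setTI.
have := @measurable_fun_eqr _ 'M[R]_n R setT (fun G => \det G) (cst 0)
  (measurable_det (@measurable_id _ _ _)) (measurable_cst (0 : R)).
by move=> /(_ measurableT [set true] I).
Qed.

Lemma gaussian_singular n : gaussian_mx n n 1 [set G : 'M[R]_n | \det G == 0] = 0%E.
Proof.
have h := integral_indic (gaussian_mx n n 1) measurableT (@measurable_singular n).
rewrite setIT in h; rewrite -h -[RHS](@gaussian_det_neq0 R n); apply: eq_integral => G _.
by rewrite indicE; congr ((nat_of_bool _)%:R)%:E; apply/idP/idP; rewrite inE.
Qed.

Lemma integral_gaussian_dotv2 n :
  (\int[gaussian_mx n 1 1]_g (dotv g g : R)%:E = n%:R%:E)%E.
Proof.
elim: n => [|n IH].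
  by apply: integral0_eq => g _; rewrite dotvE big_ord0.
have md k : measurable_fun setT (fun g : 'cV[R]_k => (dotv g g)%:E).
  by apply/measurable_EFinP; exact: measurable_dotv.
rewrite (@integral_gaussian_col1 _ n _ (md (1 + n)%N) (fun g => _)); last first.
  by move=> g; rewrite lee_fin dotv_ge0.
transitivity (\int[normal_prob 0 1]_x ((x ^+ 2 : R)%:E + (n%:R : R)%:E))%E.
  apply: eq_integral => x _; rewrite -IH.
  transitivity (\int[gaussian_mx n 1 1]_g (cst (x ^+ 2 : R)%:E g + (dotv g g : R)%:E))%E.
    by apply: eq_integral => g _; rewrite dotv_col_mx dotv_scalar EFinD.
  rewrite ge0_integralD; first last.
  - exact: md.
  - by move=> g _; rewrite lee_fin dotv_ge0.
  - exact: measurable_cst.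
  - by move=> g _; rewrite lee_fin sqr_ge0.
  - exact: measurableT.
  by rewrite integral_cst// [X in (_ * X)%E]probability_setT mule1.
rewrite ge0_integralD; first last.
- exact: measurable_cst.
- by move=> x _; rewrite lee_fin.
- exact: measurable_sqr.
- by move=> x _; rewrite lee_fin sqr_ge0.
- exact: measurableT.
by rewrite normal_second_moment integral_normal_cst -EFinD -natr1 addrC.
Qed.

Lemma normal_half_mass : ((2^-1)%:E <= normal_prob 0 1 [set x : R | (4^-1 <= x ^+ 2)%R])%E.
Proof.
have mS : measurable [set x : R | (4^-1 <= x ^+ 2)%R].
  rewrite -[X in measurable X]setTI.
  have := @measurable_fun_ler _ R R setT (cst (4^-1)) (fun x => x ^+ 2) (measurable_cst _) (measurable_funX 2 (@measurable_id _ _ _)).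
  by move=> /(_ measurableT [set true] I).
have mS' : measurable [set x : R | (`|x| <= 2^-1)%R].
  rewrite (_ : [set x | _] = `[(- 2^-1)%R, 2^-1]%classic)//.
  by apply/seteqP; split => x /=; rewrite in_itv /= ler_norml.
have h := @probability_setC _ (measurableTypeR R) R (normal_prob 0 1 : probability (measurableTypeR R) R) _ mS'.
apply: (@le_trans _ _ (normal_prob 0 1 (~` [set x : R | (`|x| <= 2^-1)%R]))).
  have -> : (2^-1)%:E = (1 - (2^-1)%:E :> \bar R)%E by rewrite -EFinB; congr EFin; lra.
  by rewrite [leRHS]h leeB//; apply: normal_small_ball; lra.
apply: (@le_measure _ R (measurableTypeR R) (normal_prob 0 1 : probability (measurableTypeR R) R)); rewrite ?inE//.
  exact: measurableC.
move=> x /= /negP; rewrite -ltNge => hx.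
have -> : x ^+ 2 = `|x| ^+ 2 by rewrite -normrX ger0_norm// sqr_ge0.
have -> : 4^-1 = 2^-1 ^+ 2 :> R by field.
by apply: lerXn2r; rewrite ?nnegrE// ltW.
Qed.

Lemma measurable_invr_dotv n (v : 'cV[R]_n) :
  measurable_fun setT (fun G : 'M[R]_n => dotv (invmx G *m v) (invmx G *m v)).
Proof. by apply: measurable_dotv; apply: measurable_mulmx => //; exact: measurable_invmx. Qed.

(** The event [|v|^2 / x^2 >= y] means [|x| <= |v| / sqrt y]. Any [t] above this quotient is
    allowed, so that a function of [|v|^2] with known mean can be chosen instead of the root
    itself. *)
Lemma prob_gaussian_invmx_ge n (v : 'cV[R]_n.+1) (y t : R) : 0 < y -> 0 <= t ->
  dotv v v <= t ^+ 2 * y ->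
  (gaussian_mx n.+1 n.+1 1 [set G | (\det G != 0)%R /\ (y <= dotv (invmx G *m v) (invmx G *m v))%R]
    <= t%:E)%E.
Proof.
move=> y0 t0 vt.
pose f (u : R) : \bar R := (\1_`[y, +oo[ u)%:E.
have mf : measurable_fun setT f by apply/measurable_EFinP; exact: measurable_indic.
have f0 u : (0 <= f u)%E by rewrite lee_fin.
apply: (@le_trans _ _ (\int[gaussian_mx n.+1 n.+1 1]_G
     (if (\det G != 0)%R then f (dotv (invmx G *m v) (invmx G *m v)) else 0))%E).
  apply: le_measure_integral.
  - rewrite (_ : [set G | _] = ~` [set G : 'M[R]_n.+1 | \det G == 0] `&`
       [set G | y <= dotv (invmx G *m v) (invmx G *m v)]).
      apply: measurableI; first by apply: measurableC; exact: measurable_singular.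
      by apply: measurable_le_dotv => //; apply: measurable_mulmx => //; exact: measurable_invmx.
    by apply/seteqP; split => G /= [h1 h2]; split=> //; apply/negP.
  - apply: measurable_fun_ifT => //.
    + by apply: measurable_neq0; exact: measurable_det.
    + by apply: (measurableT_comp mf); exact: measurable_invr_dotv.
  - by move=> G; case: ifP.
  - by move=> G /= [-> yG]; rewrite /f indicE mem_set//= in_itv /= yG.
apply: le_trans (integral_gaussian_invmx (n := n) v mf f0) _.
have mS' : measurable [set x : R | (`|x| <= t)%R].
  rewrite (_ : [set x | _] = `[(- t)%R, t]%classic)//.
  by apply/seteqP; split => x /=; rewrite in_itv /= ler_norml.
apply: le_trans (normal_small_ball t0).
have h := integral_indic (normal_prob 0 1 : probability (measurableTypeR R) R) measurableT mS'.
rewrite setIT in h; rewrite -h; apply: ge0_le_integral => //.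
- apply: (measurableT_comp mf); apply: measurable_funM => //.
  by apply: measurableT_comp; [exact: measurable_invr|exact: measurable_funX].
- by apply/measurable_EFinP; exact: measurable_indic.
move=> x _; rewrite lee_fin !indicE.
case: (boolP (_ \in `[y, +oo[%classic)) => [|_]; last by rewrite ler_nat.
rewrite inE /= in_itv /= andbT => yx.
have x0 : 0 < x ^+ 2.
  rewrite lt_def sqr_ge0 andbT; apply/eqP => x0; move: yx; rewrite x0 invr0 mulr0; lra.
have xt : `|x| <= t.
  rewrite -(@ler_pXn2r _ 2) ?nnegrE// -normrX ger0_norm ?sqr_ge0//.
  rewrite -(ler_pM2r y0) mulrC; apply: le_trans vt.
  by move: yx; rewrite ler_pdivlMr.
by rewrite mem_set.
Qed.

(* If [w := G^T x] is too short, [w . (G^-1 v) = x . v] forces [|G^-1 v|] to be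
   large as soon as [|x . v| >= |x| / 2]. *)
Lemma gaussian_smin_tail n (e : R) : 0 < e ->
  exists B : set 'M[R]_n.+1, [/\ measurable B,
    (gaussian_mx n.+1 n.+1 1 B <= (4 * e)%:E)%E &
    forall G, ~ B G -> forall x, e ^+ 2 / n.+1%:R * dotv x x <= dotv (G^T *m x) (G^T *m x)].
Proof.
move=> e0; set d : R := n.+1%:R; have d0 : 0 < d by rewrite /d ltr0n.
(* If [|G^T x|^2 < e^2 / d |x|^2] and [|x . v| >= |x| / 2], Cauchy-Schwarz gives
   [|G^-1 v|^2 >= d / (4 e^2)]. *)
pose y := d / (4 * e ^+ 2).
have e20 : 0 < e ^+ 2 by rewrite exprn_gt0.
have y0 : 0 < y by rewrite divr_gt0// mulr_gt0.
pose P := gaussian_mx n.+1 1 (1 : R); pose Q := gaussian_mx n.+1 n.+1 (1 : R).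
pose A := [set p : 'cV[R]_n.+1 * 'M[R]_n.+1 | \det p.2 != 0 /\
  y <= dotv (invmx p.2 *m p.1) (invmx p.2 *m p.1)].
have mA : measurable A.
  rewrite (_ : A = (snd @^-1` (~` [set G : 'M[R]_n.+1 | \det G == 0])) `&`
       [set p | y <= dotv (invmx p.2 *m p.1) (invmx p.2 *m p.1)]).
    apply: measurableI.
      rewrite -[X in measurable X]setTI; apply: measurable_snd => //.
      by apply: measurableC; exact: measurable_singular.
    by apply: measurable_le_dotv => //; apply: measurable_mulmx => //; exact: measurable_invmx.
  by apply/seteqP; split => G /= [h1 h2]; split=> //; apply/negP.
(* By the AM-GM inequality [|v| / sqrt y = 2 e sqrt (|v|^2 / d)] is at most [e (|v|^2 / d + 1)]. The
   latter is affine in [|v|^2] and has mean [2 e]; the detection probability 1/2 doubles this to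
   [4 e]. *)
pose h (v : 'cV[R]_n.+1) := ((e / d)%:E * (dotv v v)%:E + e%:E)%E.
have md : measurable_fun setT (fun g : 'cV[R]_n.+1 => (dotv g g)%:E).
  by apply/measurable_EFinP; exact: measurable_dotv.
have med : measurable_fun setT (fun g : 'cV[R]_n.+1 => ((e / d)%:E * (dotv g g)%:E)%E).
  by apply: emeasurable_funM.
have ed0 : 0 <= e / d by rewrite ltW// divr_gt0.
have mh : measurable_fun setT h by apply: emeasurable_funD.
have Ah v : (Q (xsection A v) <= h v)%E.
  rewrite (_ : xsection A v = [set G | (\det G != 0)%R /\ (y <= dotv (invmx G *m v) (invmx G *m v))%R]); last first.
    by apply/seteqP; split => G; rewrite /xsection /= inE.
  rewrite /h -EFinM -EFinD; apply: prob_gaussian_invmx_ge => //.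
    by apply: addr_ge0; [apply: mulr_ge0 => //; exact: dotv_ge0|exact: ltW].
  set q := dotv v v.
  have -> : (e / d * q + e) ^+ 2 * y = (q - d) ^+ 2 / (4 * d) + q.
    by rewrite /y; field; rewrite !gt_eqF.
  by rewrite lerDr divr_ge0 ?sqr_ge0// mulr_ge0// ltW.
have a0 : 0 < 2^-1 :> R by lra.
(* Singular matrices, a null set, join the exceptional set, so that [invmx G] is a true inverse
   outside it. *)
exists ([set G | ((2^-1)%:E <= P (ysection A G))%E] `|` [set G : 'M[R]_n.+1 | \det G == 0]).
have mB : measurable [set G | ((2^-1)%:E <= P (ysection A G))%E].
  have := emeasurable_fun_c_infty measurableT (measurable_fun_ysection P mA) (2^-1)%:E.
  by rewrite setTI.
split.
- by apply: measurableU => //; exact: measurable_singular.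
- rewrite -[4 * e]addr0; apply: prob_setU_le => //; last by rewrite gaussian_singular.
    exact: measurable_singular.
  apply: le_trans (prob_averaging P mA a0 mh Ah) _.
  rewrite /h ge0_integralD; first last.
  + exact: measurable_cst.
  + by move=> v _; rewrite lee_fin ltW.
  + exact: med.
  + by move=> v _; rewrite -EFinM lee_fin mulr_ge0// dotv_ge0.
  + exact: measurableT.
  rewrite integral_cst// [X in (_ + _ * X)%E]probability_setT mule1.
  rewrite ge0_integralZl//; last by move=> v _; rewrite lee_fin dotv_ge0.
  rewrite integral_gaussian_dotv2 -/d.
  have -> : ((e / d)%:E * d%:E + e%:E = (2 * e)%:E :> \bar R)%E.
    by rewrite -[((e / d)%:E * d%:E)%E]EFinM -EFinD divfK ?gt_eqF//; congr EFin; lra.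
  by rewrite -EFinM lee_fin invrK; lra.
move=> G /= /not_orP[/negP hG /negP Gd] x; rewrite leNgt; apply/negP => hx.
have Gu : G \in unitmx by rewrite unitmxE unitfE.
set w := G^T *m x in hx.
have xp : 0 < dotv x x.
  rewrite lt_def dotv_ge0 andbT; apply/eqP => xx0; move: hx.
  by rewrite xx0 mulr0 ltNge dotv_ge0.
pose r := Num.sqrt (dotv x x).
have rx : r ^+ 2 = dotv x x by rewrite sqr_sqrtr// dotv_ge0.
apply: (negP hG); apply: le_trans normal_half_mass _.
rewrite (_ : [set t | _] = [set t | [set u | r ^+ 2 / 4 <= u ^+ 2] (r * t)]); last first.
  by apply/seteqP; split => t /=; rewrite exprMn ler_pM2l ?rx.
rewrite -(prob_gaussian_dotv rx); last first.
  rewrite -[X in measurable X]setTI.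
  have := @measurable_fun_ler _ R R setT (cst (r ^+ 2 / 4)) (fun x => x ^+ 2) (measurable_cst _) (measurable_funX 2 (@measurable_id _ _ _)).
  by move=> /(_ measurableT [set true] I).
apply: le_measure; rewrite ?inE.
- by apply: measurable_le_sqr_dotv.
- exact: measurable_ysection.
move=> v /= hv; rewrite /ysection /= inE /A /=; split => //.
set u := invmx G *m v.
have E : dotv x v = dotv w u.
  by rewrite /w dotv_mulmxl trmxK /u mulKVmx.
have Cs := dotv_cauchy_schwarz w u; rewrite -E in Cs.
have := le_trans hv Cs; rewrite rx => h1.
have h2 : dotv x x / 4 <= e ^+ 2 / d * dotv x x * dotv u u.
  by apply: le_trans h1 _; apply: ler_wpM2r; [exact: dotv_ge0|exact: ltW].
rewrite /y ler_pdivrMr ?mulr_gt0//.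
have := ler_wpM2l (ltW d0) h2 => h3.
rewrite -(ler_pM2r xp); move: h3.
have -> : d * (e ^+ 2 / d * dotv x x * dotv u u) = e ^+ 2 * dotv x x * dotv u u.
  by field; rewrite gt_eqF.
by move=> h3; nra.
Qed.

Lemma invmx_gram n (G : 'M[R]_n) : G \in unitmx ->
  invmx (gram G) = (invmx G)^T *m invmx G.
Proof.
move=> Gu; have GGu : gram G \in unitmx by rewrite unitmx_mul Gu unitmx_tr.
rewrite -[LHS]mul1mx -[1%:M](_ : (invmx G)^T *m invmx G *m gram G = _) ?mulmxK//.
by rewrite /gram !mulmxA mulmxKV// -trmx_mul mulmxV// trmx1.
Qed.

Lemma mxtrace_inv_gram n (G : 'M[R]_n) : G \in unitmx ->
  \tr (invmx (gram G)) = \sum_i dotv (invmx G *m delta_mx i 0) (invmx G *m delta_mx i 0 : 'cV[R]_n).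
Proof.
move=> Gu; rewrite invmx_gram// /mxtrace; apply: eq_bigr => i _.
rewrite /dotv trmx_mul mulmxA -[_ *m (invmx G)^T *m invmx G]mulmxA.
by rewrite trmx_delta -rowE -colE !mxE.
Qed.

(* The diagonal entries [h_i] of [invmx (gram G)] satisfy [E (1 / h_i) <= 1]; then
   Markov's inequality and [h >= 2 e - e^2 / h] bound their sum from below. *)
Lemma gaussian_trace_tail n (e : R) : 0 < e ->
  exists B : set 'M[R]_n.+1, [/\ measurable B,
    (gaussian_mx n.+1 n.+1 1 B <= e%:E)%E &
    forall G, ~ B G -> G \in unitmx /\ e * n.+1%:R <= \tr (invmx (gram G))].
Proof.
move=> e0; set d : R := n.+1%:R; have d0 : 0 < d by rewrite /d ltr0n.
pose ei i : 'cV[R]_n.+1 := delta_mx i 0.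
(* The absolute value makes [f] nonnegative on the whole line. At [1 / x^2] it returns [x^2], so
   each mean in [IF] is bounded by the second moment 1. *)
pose f (u : R) : \bar R := (`|u|^-1)%:E.
have mf : measurable_fun setT f.
  apply/measurable_EFinP; apply: measurableT_comp; first exact: measurable_invr.
  exact: normr_measurable.
have f0 u : (0 <= f u)%E by rewrite lee_fin invr_ge0.
pose F i (G : 'M[R]_n.+1) : \bar R :=
  (if (\det G != 0)%R then f (dotv (invmx G *m ei i) (invmx G *m ei i)) else 0)%E.
have mF i : measurable_fun setT (F i).
  apply: measurable_fun_ifT => //.
  - by apply: measurable_neq0; exact: measurable_det.
  - by apply: (measurableT_comp mf); exact: measurable_invr_dotv.
have F0 i G : (0 <= F i G)%E by rewrite /F; case: ifP.
have IF i : (\int[gaussian_mx n.+1 n.+1 1]_G F i G <= 1)%E.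
  apply: le_trans (integral_gaussian_invmx (n := n) (ei i) mf f0) _.
  rewrite -normal_second_moment le_eqVlt; apply/orP; left; apply/eqP.
  apply: eq_integral => x _; rewrite /f; congr EFin.
  have -> : dotv (ei i) (ei i) = 1.
    rewrite dotvE (bigD1 i)//= big1 ?addr0 => [|j ji]; first by rewrite !mxE !eqxx mulr1.
    by rewrite !mxE (negbTE ji) mul0r.
  by rewrite mul1r normfV invrK ger0_norm// sqr_ge0.
pose S (G : 'M[R]_n.+1) : \bar R := (\sum_i F i G)%E.
have mS : measurable_fun setT S by apply: emeasurable_sum.
have S0 G : (0 <= S G)%E by rewrite sume_ge0.
exists ([set G | ((d / e)%:E <= S G)%E] `|` [set G : 'M[R]_n.+1 | \det G == 0]).
have mB : measurable [set G | ((d / e)%:E <= S G)%E].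
  by have := emeasurable_fun_c_infty measurableT mS (d / e)%:E; rewrite setTI.
split.
- by apply: measurableU => //; exact: measurable_singular.
- have := @prob_setU_le _ _ (gaussian_mx n.+1 n.+1 1) _ _ e 0 mB (@measurable_singular n.+1).
  rewrite addr0; apply; last by rewrite gaussian_singular.
  have de0 : 0 < d / e by rewrite divr_gt0.
  apply: le_trans (markov_ge0 (gaussian_mx n.+1 n.+1 1) de0 mS S0) _.
  rewrite ge0_integral_sum//.
  apply: (@le_trans _ _ (((d / e)^-1)%:E * \sum_(i < n.+1) 1)%E).
    apply: lee_wpmul2l; first by rewrite lee_fin invr_ge0 ltW.
    by apply: lee_sum => i _; exact: IF.
  rewrite sumEFin sumr_const card_ord -EFinM lee_fin -/d invf_div.
  by rewrite divfK ?gt_eqF.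
move=> G /= /not_orP[/negP hG /negP Gd].
have Gu : G \in unitmx by rewrite unitmxE unitfE.
split => //; rewrite mxtrace_inv_gram//.
pose hh i := dotv (invmx G *m ei i) (invmx G *m ei i).
have hh0 i : 0 < hh i.
  rewrite lt_def dotv_ge0 andbT; apply/eqP => /dotv_eq0 /(congr1 (mulmx G)).
  rewrite mulKVmx// mulmx0 => /colP /(_ i); rewrite !mxE !eqxx /= => /eqP.
  by rewrite oner_eq0.
have SE : S G = (\sum_i (hh i)^-1)%:E.
  rewrite /S -sumEFin; apply: eq_bigr => i _.
  by rewrite /F Gd /f ger0_norm ?dotv_ge0.
move: hG; rewrite SE -ltNge lte_fin => hG.
(* This is [(h - e)^2 >= 0] divided by [h]. Summed against [sum 1 / h_i < d / e] it gives
   [2 e d - e d = e d]. *)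
have key i : 2 * e - e ^+ 2 / hh i <= hh i.
  rewrite -(ler_pM2r (hh0 i)) mulrBl divfK ?gt_eqF//.
  have := sqr_ge0 (hh i - e); rewrite sqrrB -mulr_natl; move: (hh i) => q.
  by rewrite expr2; lra.
apply: (@le_trans _ _ (\sum_i (2 * e - e ^+ 2 / hh i))); last first.
  by apply: ler_sum => i _; exact: key.
rewrite big_split /= sumr_const card_ord -[X in X *+ _]mulr1 -mulrnAr -/d.
rewrite sumrN -mulr_sumr.
have : e ^+ 2 * (\sum_i (hh i)^-1) <= e ^+ 2 * (d / e) by apply: ler_wpM2l; [exact: sqr_ge0|exact: ltW].
have -> : e ^+ 2 * (d / e) = e * d by field; rewrite gt_eqF.
lra.
Qed.

End smallest_eigenvalue.

(** * From unit variance to the Wishart normalization *)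

Section wishart_tails.
Variable R : realType.

Lemma loewner_scalar_le n (a : R) (W : 'M[R]_n) : W^T = W ->
  (forall x, a * dotv x x <= dotv x (W *m x)) -> loewner_le a%:M W.
Proof.
move=> Ws h; split; first by rewrite linearB /= Ws tr_scalar_mx.
move=> x; rewrite mulmxBl mul_scalar_mx dotvDr -scaleN1r dotvZr dotvZr mulN1r subr_ge0.
exact: h.
Qed.

Lemma loewner_le_scalar n (a : R) (W : 'M[R]_n) : W^T = W ->
  (forall x, dotv x (W *m x) <= a * dotv x x) -> loewner_le W a%:M.
Proof.
move=> Ws h; split; first by rewrite linearB /= Ws tr_scalar_mx.
move=> x; rewrite mulmxBl mul_scalar_mx dotvDr -scaleN1r dotvZr dotvZr mulN1r subr_ge0.
exact: h.
Qed.

Lemma dotv_gram n (X : 'M[R]_n) (x : 'cV[R]_n) :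
  dotv x (gram X *m x) = dotv (X^T *m x) (X^T *m x).
Proof. by rewrite /gram -mulmxA dotv_mulmxl trmxK. Qed.

Lemma tr_gram n (X : 'M[R]_n) : (gram X)^T = gram X.
Proof. by rewrite /gram trmx_mul trmxK. Qed.

Lemma gramZ n (s : R) (G : 'M[R]_n) : gram (s *: G) = s ^+ 2 *: gram G.
Proof.
apply/matrixP => i j; rewrite !mxE mulr_sumr; apply: eq_bigr => k _; rewrite !mxE.
by ring.
Qed.

(** Stated for the factor [X] rather than for [W = X X^T], because [(X^-1)^T] will serve as the
    square root of [W^-1]. Entries of variance [1 / d] turn the bounds [e^2 / d], [K^2 d] and
    [eta d] for unit variance into [e^2 / d^2], [K^2] and [eta d^2]. *)
Lemma wishart_factor_good n (e eta K : R) : 0 < e -> 0 < eta -> 0 <= K ->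
  let d : R := n.+1%:R in
  exists B : set 'M[R]_n.+1, [/\ measurable B,
    (gaussian_mx n.+1 n.+1 (Num.sqrt d^-1) B <=
       (4 * e + eta + 2 * expR (5 * d - K * d / 4))%:E)%E &
    forall X, ~ B X -> [/\ X \in unitmx, loewner_le (e ^+ 2 / d ^+ 2)%:M (gram X),
      loewner_le (gram X) (K ^+ 2)%:M & eta * d ^+ 2 <= \tr (invmx (gram X))]].
Proof.
move=> e0 eta0 K0 d; have d0 : 0 < d by rewrite /d ltr0n.
have [B1 [mB1 PB1 hB1]] := gaussian_smin_tail n e0.
have [B2 [mB2 PB2 hB2]] := gaussian_trace_tail n eta0.
have [B3 [mB3 PB3 hB3]] := gaussian_opnorm_tail n K0.
pose s := Num.sqrt d^-1; pose B := B1 `|` B2 `|` B3.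
have s2 : s ^+ 2 = d^-1 by rewrite sqr_sqrtr// invr_ge0 ltW.
have s0 : 0 < s by rewrite sqrtr_gt0 invr_gt0.
have mB : measurable B by apply: measurableU => //; exact: measurableU.
have mf : measurable_fun setT (fun X : 'M[R]_n.+1 => s^-1 *: X) by exact: measurable_scalemx.
have mC : measurable ((fun X : 'M[R]_n.+1 => s^-1 *: X) @^-1` B).
  by rewrite -[X in measurable X]setTI; exact: mf.
exists ((fun X : 'M[R]_n.+1 => s^-1 *: X) @^-1` B); split => //.
- set C := _ @^-1` _ in mC *.
  have h := integral_indic (gaussian_mx n.+1 n.+1 s) measurableT mC.
  have h1 := integral_indic (gaussian_mx n.+1 n.+1 1) measurableT mB.
  rewrite setIT in h; rewrite setIT in h1; rewrite -h.
  have mi : measurable_fun setT (fun g : 'M[R]_n.+1 => (\1_C g : R)%:E).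
    by apply/measurable_EFinP; exact: measurable_indic.
  rewrite (integral_gaussian_scale (lt0r_neq0 s0) mi); last by move=> X; rewrite lee_fin.
  apply: (@le_trans _ _ (gaussian_mx n.+1 n.+1 1 B)).
    rewrite -h1 le_eqVlt; apply/orP; left; apply/eqP; apply: eq_integral => G _.
    rewrite !indicE; congr ((nat_of_bool _)%:R)%:E.
    have E : s^-1 *: (s *: G) = G by rewrite scalerA mulVf ?scale1r// gt_eqF.
    by apply/idP/idP; rewrite !inE /C /= E.
  by apply: prob_setU_le => //; [exact: measurableU|exact: prob_setU_le].
move=> X; rewrite /= => hX; set G := s^-1 *: X in hX.
have [nB1 nB2 nB3] : [/\ ~ B1 G, ~ B2 G & ~ B3 G].
  by split => h; apply: hX; rewrite /B /=; [left; left|left; right|right].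
have XE : X = s *: G by rewrite /G scalerA mulfV ?scale1r// gt_eqF.
have gE : gram X = d^-1 *: gram G.
  by rewrite [in LHS]XE gramZ s2.
have [Gu htr] := hB2 G nB2.
have sN0 : s != 0 by rewrite gt_eqF.
split.
- by rewrite XE unitmxZ// unitfE.
- apply: loewner_scalar_le; first exact: tr_gram.
  move=> x; rewrite gE -scalemxAl dotvZr dotv_gram.
  have := hB1 G nB1 x; rewrite -/d => h.
  rewrite (_ : _ * _ = d^-1 * (e ^+ 2 / d * dotv x x)); last by field; rewrite gt_eqF.
  by rewrite ler_pM2l ?invr_gt0.
- apply: loewner_le_scalar; first exact: tr_gram.
  move=> x; rewrite gE -scalemxAl dotvZr dotv_gram.
  have := hB3 G nB3 x; rewrite -/d => h.
  by rewrite ler_pdivrMl// mulrA [d * _]mulrC.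
- rewrite gE invmxZ; last first.
    by rewrite unitmxZ ?unitfE ?invr_eq0 ?gt_eqF// unitmx_mul Gu unitmx_tr.
  rewrite invrK mxtraceZ expr2 mulrCA ler_pM2l//.
Qed.

End wishart_tails.

(** * Estimating the trace from samples *)

Section gaussian_moments.
Variable R : realType.

Lemma integral_gaussian_dotv_sqr n (a : 'cV[R]_n.+1) :
  (\int[gaussian_mx n.+1 1 1]_g (dotv a g ^+ 2 : R)%:E = (dotv a a)%:E)%E.
Proof.
pose r := Num.sqrt (dotv a a).
have ra : r ^+ 2 = dotv a a by rewrite sqr_sqrtr// dotv_ge0.
rewrite (@integral_gaussian_dotv _ _ a r (fun u => (u ^+ 2)%:E) ra (@measurable_sqr R)); last first.
  by move=> x; rewrite lee_fin sqr_ge0.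
transitivity (\int[normal_prob 0 1]_x (r ^+ 2 * x ^+ 2 : R)%:E)%E.
  by apply: eq_integral => x _; rewrite exprMn.
by rewrite integral_normal_sqrZ ?sqr_ge0// normal_second_moment mule1 ra.
Qed.

Lemma integral_gaussian_dotv_pow4 n (a : 'cV[R]_n.+1) :
  (\int[gaussian_mx n.+1 1 1]_g (dotv a g ^+ 4 : R)%:E <= (128 * dotv a a ^+ 2)%:E)%E.
Proof.
pose r := Num.sqrt (dotv a a).
have ra : r ^+ 2 = dotv a a by rewrite sqr_sqrtr// dotv_ge0.
have m4 : measurable_fun setT (fun u : R => (u ^+ 4)%:E).
  by apply/measurable_EFinP; exact: measurable_funX.
have p4 (u : R) : (0 <= (u ^+ 4)%:E)%E by rewrite lee_fin exprn_even_ge0.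
rewrite (integral_gaussian_dotv ra m4 p4).
have -> : (\int[normal_prob 0 1]_x ((r * x) ^+ 4)%:E = (r ^+ 4)%:E * \int[normal_prob 0 1]_x (x ^+ 4 : R)%:E)%E.
  rewrite -ge0_integralZl; first last.
  - exact: p4.
  - by move=> x _.
  - exact: m4.
  - exact: measurableT.
  by apply: eq_integral => x _; rewrite exprMn.
have -> : (128 * dotv a a ^+ 2)%:E = ((r ^+ 4)%:E * 128%:E)%E.
  by rewrite -EFinM -ra -exprM mulrC.
apply: lee_wpmul2l; first exact: p4.
exact: normal_fourth_moment.
Qed.

Lemma dotv_mulmx_sum n (A : 'M[R]_n) (g : 'cV[R]_n) :
  dotv (A *m g) (A *m g) = \sum_i dotv (row i A)^T g ^+ 2.
Proof.
rewrite dotvE; apply: eq_bigr => i _; rewrite -expr2; congr (_ ^+ 2).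
by rewrite mxE dotvE; apply: eq_bigr => j _; rewrite !mxE.
Qed.

Lemma mxtrace_mul_tr n (A : 'M[R]_n) :
  \tr (A *m A^T) = \sum_i dotv (row i A)^T (row i A)^T.
Proof.
rewrite /mxtrace; apply: eq_bigr => i _; rewrite mxE dotvE.
by apply: eq_bigr => j _; rewrite !mxE.
Qed.

Lemma gaussian_sqnorm_mean n (A : 'M[R]_n.+1) :
  (\int[gaussian_mx n.+1 1 1]_g (dotv (A *m g) (A *m g) : R)%:E = (\tr (A *m A^T))%:E)%E.
Proof.
transitivity (\int[gaussian_mx n.+1 1 1]_g (\sum_(i < n.+1) (dotv (row i A)^T g ^+ 2 : R)%:E))%E.
  by apply: eq_integral => g _; rewrite dotv_mulmx_sum sumEFin.
rewrite ge0_integral_sum//.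
- rewrite mxtrace_mul_tr -sumEFin; apply: eq_bigr => i _.
  exact: integral_gaussian_dotv_sqr.
- by move=> i; apply/measurable_EFinP; apply: measurable_funX; exact: measurable_dotv.
- by move=> i g _; rewrite lee_fin sqr_ge0.
Qed.

(** Cauchy-Schwarz with weights [r_i = |a_i|], the row lengths, bounds [(sum (a_i . g)^2)^2] by
    [sum r_i^2] times [sum (a_i . g)^4 / r_i^2]. This avoids mixed moments of different rows, and
    each term of the last sum has mean at most [128 r_i^2]. *)
Lemma gaussian_sqnorm_second n (A : 'M[R]_n.+1) :
  (\int[gaussian_mx n.+1 1 1]_g (dotv (A *m g) (A *m g) ^+ 2 : R)%:E <=
   (128 * \tr (A *m A^T) ^+ 2)%:E)%E.
Proof.
set T := \tr (A *m A^T).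
pose a i : 'cV[R]_n.+1 := (row i A)^T; pose r i := Num.sqrt (dotv (a i) (a i)).
have ra i : r i ^+ 2 = dotv (a i) (a i) by rewrite sqr_sqrtr// dotv_ge0.
have TE : T = \sum_i r i ^+ 2 by rewrite /T mxtrace_mul_tr; apply: eq_bigr => i _; rewrite ra.
have T0 : 0 <= T by rewrite TE sumr_ge0// => i _; exact: sqr_ge0.
have pw g : dotv (A *m g) (A *m g) ^+ 2 <= T * \sum_i dotv (a i) g ^+ 4 / r i ^+ 2.
  pose u : 'cV[R]_n.+1 := \col_i r i.
  pose v : 'cV[R]_n.+1 := \col_i (dotv (a i) g ^+ 2 / r i).
  have uv : dotv u v = dotv (A *m g) (A *m g).
    rewrite dotv_mulmx_sum dotvE; apply: eq_bigr => i _; rewrite !mxE mulrC.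
    (* For a zero row the quotient is 0 by convention, and so is the term that it has to
       reproduce. *)
    have [r0|r0] := eqVneq (r i) 0; last by rewrite divfK.
    rewrite r0 mulr0; have : dotv (a i) (a i) = 0 by rewrite -ra r0 expr0n.
    move=> /dotv_eq0; rewrite /a => ->.
    by rewrite dotvE big1 ?expr0n// => j _; rewrite mxE mul0r.
  have uu : dotv u u = T by rewrite TE dotvE; apply: eq_bigr => i _; rewrite !mxE expr2.
  have vv : dotv v v = \sum_i dotv (a i) g ^+ 4 / r i ^+ 2.
    rewrite dotvE; apply: eq_bigr => i _; rewrite !mxE.
    by rewrite -expr2 exprMn exprVn -exprM.
  by rewrite -uv -vv -uu; exact: dotv_cauchy_schwarz.
have mpw i : measurable_fun setT (fun g : 'cV[R]_n.+1 => (dotv (a i) g ^+ 4)%:E).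
  by apply/measurable_EFinP; apply: measurable_funX; exact: measurable_dotv.
have mpw' i : measurable_fun setT (fun g : 'cV[R]_n.+1 => ((r i ^- 2)%:E * (dotv (a i) g ^+ 4)%:E)%E).
  by apply: emeasurable_funM.
have p4 i g : (0 <= (r i ^- 2)%:E * (dotv (a i) g ^+ 4)%:E)%E.
  by rewrite -EFinM lee_fin mulr_ge0 ?invr_ge0 ?sqr_ge0// exprn_even_ge0.
have msum : measurable_fun setT (fun g : 'cV[R]_n.+1 =>
    \sum_(i < n.+1) ((r i ^- 2)%:E * (dotv (a i) g ^+ 4)%:E))%E.
  by apply: emeasurable_sum.
apply: (@le_trans _ _ (\int[gaussian_mx n.+1 1 1]_g
   (T%:E * \sum_(i < n.+1) ((r i ^- 2)%:E * (dotv (a i) g ^+ 4 : R)%:E)))%E).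
  apply: ge0_le_integral.
  - exact: measurableT.
  - by move=> g _; rewrite lee_fin sqr_ge0.
  - apply/measurable_EFinP; apply: measurable_funX; apply: measurable_dotv.
      exact: measurable_mulmx.
    exact: measurable_mulmx.
  - exact: emeasurable_funM.
  - move=> g _; rewrite (eq_bigr (fun i => (dotv (a i) g ^+ 4 / r i ^+ 2)%:E)).
      by rewrite sumEFin -EFinM lee_fin; exact: pw.
    by move=> i _; rewrite -EFinM mulrC.
rewrite ge0_integralZl; first last.
- by rewrite lee_fin.
- by move=> g _; rewrite sume_ge0.
- exact: msum.
- exact: measurableT.
rewrite ge0_integral_sum//.
apply: (@le_trans _ _ (T%:E * \sum_(i < n.+1) (128 * r i ^+ 2)%:E)%E).
  apply: lee_wpmul2l; first by rewrite lee_fin.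
  apply: lee_sum => i _; rewrite ge0_integralZl; first last.
  - by rewrite lee_fin invr_ge0 sqr_ge0.
  - by move=> g _; rewrite lee_fin exprn_even_ge0.
  - exact: mpw.
  - exact: measurableT.
  apply: (@le_trans _ _ ((r i ^- 2)%:E * (128 * dotv (a i) (a i) ^+ 2)%:E)%E).
    apply: lee_wpmul2l; first by rewrite lee_fin invr_ge0 sqr_ge0.
    exact: integral_gaussian_dotv_pow4.
  rewrite -EFinM lee_fin -ra.
  have [->|r0] := eqVneq (r i) 0; first by rewrite expr0n /= expr0n /= !mulr0.
  by rewrite le_eqVlt; apply/orP; left; apply/eqP; field.
by rewrite sumEFin -EFinM lee_fin -mulr_sumr -TE mulrCA expr2.
Qed.

End gaussian_moments.

Section iid_sums.
Variable R : realType.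

Definition tuple_sum d (T : measurableType d) (f : T -> R) k (t : k.-tuple T) : R :=
  \sum_(i < k) f (tnth t i).

Lemma tuple_sum_cons d (T : measurableType d) (f : T -> R) k (x : T) (t : k.-tuple T) :
  tuple_sum f (tuple_cons (x, t)) = f x + tuple_sum f t.
Proof.
rewrite /tuple_sum big_ord_recl; congr (f _ + _).
by apply: eq_bigr => i _; congr f; rewrite !(tnth_nth x).
Qed.

Lemma measurable_tuple_sum d (T : measurableType d) (f : T -> R) k :
  measurable_fun setT f -> measurable_fun setT (@tuple_sum d T f k).
Proof.
move=> mf; apply: measurable_sum => i.
exact: (measurableT_comp mf (measurable_tnth i)).
Qed.

Lemma integral_iid_tuple d (T : measurableType d) (P : probability T R) k
    (F : k.+1.-tuple T -> \bar R) : measurable_fun setT F -> (forall t, 0 <= F t)%E ->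
  (\int[iid_tuple P k.+1]_t F t =
   \int[P]_x \int[iid_tuple P k]_t F (tuple_cons (x, t)))%E.
Proof.
move=> mF F0; have mc := @measurable_tuple_cons d T k.
rewrite (@ge0_integral_law R _ _ _ _ (P \x iid_tuple P k)%E (iid_tuple P k.+1) (@tuple_cons d T k) mc _ F mF F0)//.
exact: (fubini_tonelli1 (m1 := P) (m2 := iid_tuple P k) (F \o @tuple_cons d T k) (measurableT_comp mF mc) (fun z => F0 _)).
Qed.

Lemma integral_prob_cst d (T : measurableType d) (P : probability T R) (c : R) :
  (\int[P]_(x in [set: T]) (c%:E : \bar R) = c%:E)%E.
Proof. by rewrite [LHS]integral_cst// [X in (_ * X)%E]probability_setT mule1. Qed.

Section moments.
Context d (T : measurableType d) (P : probability T R).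
Variables (f : T -> R) (m M : R).
Hypotheses (mf : measurable_fun setT f) (f0 : forall x, 0 <= f x).
Hypothesis (fm : (\int[P]_x (f x)%:E = m%:E)%E).
Hypothesis (fM : (\int[P]_x (f x ^+ 2)%:E <= M%:E)%E).

Lemma tuple_sum_ge0 k (t : k.-tuple T) : 0 <= tuple_sum f t.
Proof. by rewrite sumr_ge0. Qed.

Let m0 : 0 <= m.
Proof. by rewrite -lee_fin -fm; apply: integral_ge0 => x _; rewrite lee_fin. Qed.

Lemma iid_sum_mean k : (\int[iid_tuple P k]_t (tuple_sum f t)%:E = (k%:R * m)%:E)%E.
Proof.
elim: k => [|k IH].
  by rewrite mul0r; apply: integral0_eq => t _; rewrite /tuple_sum big_ord0.
have mS j : measurable_fun setT (fun t : j.-tuple T => (tuple_sum f t)%:E).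
  by apply/measurable_EFinP; exact: measurable_tuple_sum.
rewrite integral_iid_tuple//; last by move=> t; rewrite lee_fin tuple_sum_ge0.
transitivity (\int[P]_x ((f x)%:E + (k%:R * m)%:E))%E.
  apply: eq_integral => x _; rewrite -IH -(integral_prob_cst (iid_tuple P k) (f x)).
  rewrite -ge0_integralD; first last.
  - exact: mS.
  - by move=> t _; rewrite lee_fin tuple_sum_ge0.
  - exact: measurable_cst.
  - by move=> t _; rewrite lee_fin.
  - exact: measurableT.
  by apply: eq_integral => t _; rewrite tuple_sum_cons EFinD.
rewrite ge0_integralD; first last.
- exact: measurable_cst.
- by move=> x _; rewrite lee_fin mulr_ge0.
- exact/measurable_EFinP.
- by move=> x _; rewrite lee_fin.
- exact: measurableT.
by rewrite fm integral_prob_cst -EFinD -natr1 mulrDl mul1r addrC.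
Qed.

Lemma iid_sum_second k : (\int[iid_tuple P k]_t (tuple_sum f t ^+ 2)%:E <=
  (k%:R * M + (k%:R * k%:R - k%:R) * m ^+ 2)%:E)%E.
Proof.
elim: k => [|k IH].
  rewrite !mul0r subrr mul0r addr0 integral0_eq// => t _.
  by rewrite /tuple_sum big_ord0 expr0n.
have mS j : measurable_fun setT (fun t : j.-tuple T => (tuple_sum f t)%:E).
  by apply/measurable_EFinP; exact: measurable_tuple_sum.
have mS2 j : measurable_fun setT (fun t : j.-tuple T => (tuple_sum f t ^+ 2)%:E).
  by apply/measurable_EFinP; apply: measurable_funX; exact: measurable_tuple_sum.
have mf2 : measurable_fun setT (fun x => (f x ^+ 2)%:E).
  by apply/measurable_EFinP; exact: measurable_funX.
rewrite integral_iid_tuple//; last by move=> t; rewrite lee_fin sqr_ge0.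
set s := (\int[iid_tuple P k]_t (tuple_sum f t ^+ 2)%:E)%E in IH *.
have s0 : (0 <= s)%E by apply: integral_ge0 => t _; rewrite lee_fin sqr_ge0.
have c0 : 0 <= 2 * (k%:R * m) by rewrite !mulr_ge0.
have mlin : measurable_fun setT (fun x => ((2 * (k%:R * m))%:E * (f x)%:E)%E).
  by apply: emeasurable_funM => //; exact/measurable_EFinP.
have lin0 x : (0 <= (2 * (k%:R * m))%:E * (f x)%:E)%E by rewrite mule_ge0// lee_fin.
have -> : (\int[P]_x \int[iid_tuple P k]_t (tuple_sum f (tuple_cons (x, t)) ^+ 2)%:E =
  \int[P]_x ((f x ^+ 2)%:E + ((2 * (k%:R * m))%:E * (f x)%:E) + s))%E.
  apply: eq_integral => x _.
  transitivity (\int[iid_tuple P k]_t ((f x ^+ 2)%:E + (2 * f x)%:E * (tuple_sum f t)%:E +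
     (tuple_sum f t ^+ 2)%:E))%E.
    apply: eq_integral => t _; rewrite tuple_sum_cons -EFinM -!EFinD; congr EFin.
    by ring.
  have ml : measurable_fun setT (fun t : k.-tuple T => ((2 * f x)%:E * (tuple_sum f t)%:E)%E).
    by apply: emeasurable_funM; [exact: measurable_cst|exact: mS].
  have l0 (t : k.-tuple T) : (0 <= (2 * f x)%:E * (tuple_sum f t)%:E)%E.
    by rewrite mule_ge0 ?lee_fin ?mulr_ge0 ?tuple_sum_ge0.
  rewrite ge0_integralD; first last.
  - exact: mS2.
  - by move=> t _; rewrite lee_fin sqr_ge0.
  - by apply: emeasurable_funD.
  - by move=> t _; rewrite adde_ge0// lee_fin sqr_ge0.
  - exact: measurableT.
  rewrite ge0_integralD; first last.
  - exact: ml.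
  - by move=> t _.
  - exact: measurable_cst.
  - by move=> t _; rewrite lee_fin sqr_ge0.
  - exact: measurableT.
  rewrite integral_prob_cst ge0_integralZl; first last.
  - by rewrite lee_fin mulr_ge0.
  - by move=> t _; rewrite lee_fin tuple_sum_ge0.
  - exact: mS.
  - exact: measurableT.
  rewrite iid_sum_mean -!EFinM; congr (_ + _%:E + _)%E; ring.
rewrite ge0_integralD; first last.
- exact: measurable_cst.
- by move=> x _.
- by apply: emeasurable_funD.
- by move=> x _; rewrite adde_ge0// lee_fin sqr_ge0.
- exact: measurableT.
rewrite ge0_integralD; first last.
- exact: mlin.
- by move=> x _; exact: lin0.
- exact: mf2.
- by move=> x _; rewrite lee_fin sqr_ge0.
- exact: measurableT.
rewrite ge0_integralZl; first last.
- by rewrite lee_fin.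
- by move=> x _; rewrite lee_fin.
- exact/measurable_EFinP.
- exact: measurableT.
rewrite fm [X in (_ + X)%E](_ : _ = s); last first.
  by rewrite [LHS]integral_cst// [X in (_ * X)%E]probability_setT mule1.
apply: (@le_trans _ _ (M%:E + (2 * (k%:R * m) * m)%:E + (k%:R * M + (k%:R * k%:R - k%:R) * m ^+ 2)%:E)%E).
  by rewrite -EFinM; apply: leeD => //; apply: leeD.
rewrite -!EFinD lee_fin le_eqVlt; apply/orP; left; apply/eqP.
by rewrite -natr1; ring.
Qed.

Lemma iid_sum_chebyshev k (a : R) : 0 < a ->
  (iid_tuple P k [set t | (a ^+ 2 <= (tuple_sum f t - k%:R * m) ^+ 2)%R] <=
   (k%:R * M / a ^+ 2)%:E)%E.
Proof.
move=> a0; have a20 : 0 < a ^+ 2 by rewrite exprn_gt0.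
have mS : measurable_fun setT (fun t : k.-tuple T => (tuple_sum f t)%:E).
  by apply/measurable_EFinP; exact: measurable_tuple_sum.
have mS2 : measurable_fun setT (fun t : k.-tuple T => (tuple_sum f t ^+ 2)%:E).
  by apply/measurable_EFinP; apply: measurable_funX; exact: measurable_tuple_sum.
have mD : measurable_fun setT (fun t : k.-tuple T => ((tuple_sum f t - k%:R * m) ^+ 2)%:E).
  apply/measurable_EFinP; apply: measurable_funX; apply: measurable_funB => //.
  exact: measurable_tuple_sum.
have D0 (t : k.-tuple T) : (0 <= ((tuple_sum f t - k%:R * m) ^+ 2)%:E)%E.
  by rewrite lee_fin sqr_ge0.
have := markov_ge0 (iid_tuple P k) a20 mD D0.
rewrite (_ : [set x | _] = [set t | (a ^+ 2 <= (tuple_sum f t - k%:R * m) ^+ 2)%R]); last first.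
  by apply/seteqP; split => t /=; rewrite lee_fin.
move=> h; apply: (le_trans h); rewrite [k%:R * M / _]mulrC EFinM.
apply: lee_wpmul2l; first by rewrite lee_fin invr_ge0 ltW.
have km0 : 0 <= 2 * (k%:R * m) by rewrite !mulr_ge0.
set D := (\int[_]_x _)%E.
(* The cross term of the expanded square is moved to the side of [D], so that only nonnegative
   functions are integrated. *)
have : (D + (2 * (k%:R * m) * (k%:R * m))%:E <=
   (k%:R * M + (k%:R * k%:R - k%:R) * m ^+ 2)%:E + ((k%:R * m) ^+ 2)%:E)%E.
  rewrite EFinM -iid_sum_mean -(integral_prob_cst (iid_tuple P k) ((k%:R * m) ^+ 2)).
  rewrite -ge0_integralZl; first last.
  - by rewrite lee_fin.
  - by move=> t _; rewrite lee_fin tuple_sum_ge0.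
  - exact: mS.
  - exact: measurableT.
  rewrite -ge0_integralD; first last.
  - by apply: emeasurable_funM; [exact: measurable_cst|exact: mS].
  - by move=> t _; rewrite -EFinM lee_fin mulr_ge0 ?tuple_sum_ge0.
  - exact: mD.
  - by move=> t _.
  - exact: measurableT.
  apply: (@le_trans _ _ (\int[iid_tuple P k]_t ((tuple_sum f t ^+ 2)%:E + ((k%:R * m) ^+ 2)%:E))%E).
    rewrite le_eqVlt; apply/orP; left; apply/eqP; apply: eq_integral => t _.
    rewrite -EFinM -!EFinD; congr EFin; ring.
  rewrite ge0_integralD; first last.
  - exact: measurable_cst.
  - by move=> t _; rewrite lee_fin sqr_ge0.
  - exact: mS2.
  - by move=> t _; rewrite lee_fin sqr_ge0.
  - exact: measurableT.
  by apply: leeD => //; exact: iid_sum_second.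
rewrite -EFinD -leeBrDr//= -EFinB => h'; apply: (le_trans h').
rewrite lee_fin; have := mulr_ge0 (ler0n R k) (sqr_ge0 m).
by rewrite !exprMn !expr2; lra.
Qed.

End moments.
End iid_sums.

(** * Independent samples from nearby laws: total variation and couplings *)

Section iid_comparison.
Variable R : realType.

Lemma product_prob_swap d1 d2 (T : measurableType d1) (U : measurableType d2)
    (P : probability T R) (Q : probability U R) A : measurable A ->
  ((P \x Q) A = \int[Q]_u P (ysection A u))%E.
Proof.
move=> mA; have PQE : (P \x Q)%E A = (P \x^ Q)%E A.
  apply: product_measure_unique => // B C mB mC.
  by rewrite [LHS]product_measure2E.
exact: PQE.
Qed.

Lemma measurable_tuple_cons_preimage d (T : measurableType d) k (B : set (k.+1.-tuple T)) :
  measurable B -> measurable (@tuple_cons d T k @^-1` B).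
Proof. by move=> mB; rewrite -[X in measurable X]setTI; apply: measurable_tuple_cons. Qed.

(* Replace the factors one at a time. *)
Lemma iid_tuple_approx d (T : measurableType d) (P Q : probability T R) (c : R) :
  (forall B, measurable B -> P B <= Q B + c%:E)%E ->
  forall k B, measurable B -> (iid_tuple P k B <= iid_tuple Q k B + (k%:R * c)%:E)%E.
Proof.
move=> PQ.
have c0 : 0 <= c.
  have := PQ set0 measurable0; rewrite !measure0 add0e lee_fin; exact.
elim=> [|k IH] B mB; first by rewrite mul0r adde0.
have mB' := measurable_tuple_cons_preimage mB; set B' := _ @^-1` B in mB'.
have -> : iid_tuple P k.+1 B = (P \x iid_tuple P k)%E B' by [].
have -> : iid_tuple Q k.+1 B = (Q \x iid_tuple Q k)%E B' by [].
apply: (@le_trans _ _ ((Q \x iid_tuple P k) B' + c%:E)%E).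
  rewrite !product_prob_swap//.
  apply: (@le_trans _ _ (\int[iid_tuple P k]_u (Q (ysection B' u) + c%:E))%E).
    apply: ge0_le_integral => //.
    - exact: measurable_fun_ysection.
    - by apply: emeasurable_funD => //; exact: measurable_fun_ysection.
    - by move=> u _; apply: PQ; exact: measurable_ysection.
  rewrite ge0_integralD; first last.
  - exact: measurable_cst.
  - by move=> u _; rewrite lee_fin.
  - exact: measurable_fun_ysection.
  - by move=> u _.
  - exact: measurableT.
  by rewrite integral_prob_cst.
rewrite -natr1 mulrDl mul1r EFinD addeA; apply: leeD => //.
apply: (@le_trans _ _ (\int[Q]_u (iid_tuple Q k (xsection B' u) + (k%:R * c)%:E))%E).
  apply: ge0_le_integral => //.
  - exact: measurable_fun_xsection.
  - by apply: emeasurable_funD => //; exact: measurable_fun_xsection.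
  - by move=> u _; apply: IH; exact: measurable_xsection.
rewrite ge0_integralD; first last.
- exact: measurable_cst.
- by move=> u _; rewrite lee_fin mulr_ge0.
- exact: measurable_fun_xsection.
- by move=> u _.
- exact: measurableT.
by rewrite integral_prob_cst.
Qed.

Lemma measurable_map_tuple d1 d2 (T : measurableType d1) (U : measurableType d2)
    (phi : T -> U) k : measurable_fun setT phi ->
  measurable_fun setT (fun t : k.-tuple T => [tuple of map phi t]).
Proof.
move=> mphi; apply/measurable_fun_tnthP => i.
rewrite (_ : _ \o _ = fun t : k.-tuple T => phi (tnth t i)).
  exact: (measurableT_comp mphi (measurable_tnth i)).
by apply/funext => t /=; rewrite tnth_map.
Qed.

Lemma iid_tuple_map d1 d2 (T : measurableType d1) (U : measurableType d2)
    (P : probability T R) (Q : probability U R) (phi : T -> U) :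
  measurable_fun setT phi -> (forall B, measurable B -> Q B = P (phi @^-1` B)) ->
  forall k B, measurable B ->
  iid_tuple Q k B = iid_tuple P k ((fun t : k.-tuple T => [tuple of map phi t]) @^-1` B).
Proof.
move=> mphi QP; elim=> [|k IH] B mB.
  rewrite /= !diracE; congr ((nat_of_bool _)%:R)%:E; apply/idP/idP; rewrite !inE /=.
    by rewrite [X in B X](tuple0 _) [X in _ -> B X](tuple0 _).
  by rewrite [X in B X](tuple0 _) [X in _ -> B X](tuple0 _).
have mB' := measurable_tuple_cons_preimage mB; set B' := _ @^-1` B in mB'.
have mC : measurable ((fun t : k.+1.-tuple T => [tuple of map phi t]) @^-1` B).
  by rewrite -[X in measurable X]setTI; exact: measurable_map_tuple.
have mC' := measurable_tuple_cons_preimage mC; set C' := _ @^-1` _ in mC'.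
have -> : iid_tuple Q k.+1 B = (\int[Q]_x iid_tuple Q k (xsection B' x))%E by [].
transitivity (\int[P]_x iid_tuple P k (xsection C' x))%E; last by [].
rewrite (@ge0_integral_law R _ _ _ _ P Q phi mphi QP)//; last exact: measurable_fun_xsection.
apply: eq_integral => x _; rewrite IH; last exact: measurable_xsection.
congr (iid_tuple _ _ _); apply/seteqP; split => t; rewrite /xsection /= !inE /B' /C' /=;
  by rewrite (_ : tuple_cons (phi x, [tuple of map phi t]) = [tuple of map phi (tuple_cons (x, t))])//; apply/val_inj.
Qed.

Lemma tv_dist_le d (T : measurableType d) (P Q : probability T R) (c : R) :
  (tv_dist P Q <= c%:E)%E -> forall B, measurable B -> (P B <= Q B + c%:E)%E.
Proof.
move=> h B mB.
have : (`|P B - Q B| <= c%:E)%E.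
  by apply: le_trans h; apply: ereal_sup_ubound; exists B.
have fP : P B \is a fin_num by exact: fin_num_measure.
have fQ : Q B \is a fin_num by exact: fin_num_measure.
rewrite -(fineK fP) -(fineK fQ) -EFinB -EFinD !lee_fin => h'.
have := le_trans (ler_norm _) h'; lra.
Qed.

(** The factor 2 gives a coupling without attainment of the infimum: if the infimum were at least
    [2 c d^2], the scaled distance would be at least [sqrt 2] times [c]. *)
Lemma wasserstein2_coupling n (P Q : set 'cV[R]_n -> \bar R) (c d : R) : 0 < c -> 0 < d ->
  ((Num.sqrt (c / d ^+ 2))%:E * wasserstein2 P Q <= c%:E)%E ->
  exists2 g : probability ('cV[R]_n * 'cV[R]_n)%type R, coupling P Q g &
    (\int[g]_z (dotv (z.1 - z.2) (z.1 - z.2))%:E <= (2 * c * d ^+ 2)%:E)%E.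
Proof.
move=> c0 d0; rewrite /wasserstein2; set S := [set _ | _ in _] => h.
have y0 : 0 < 2 * c * d ^+ 2 by rewrite !mulr_gt0.
have [Slt|Sge] := ltP (ereal_inf S) (2 * c * d ^+ 2)%:E.
  have [z [g gc <-] gz] := ereal_inf_lt Slt.
  by exists g => //; exact: ltW.
have : ((Num.sqrt (c / d ^+ 2))%:E * (Num.sqrt (2 * c * d ^+ 2))%:E <= c%:E)%E.
  apply: le_trans h; apply: lee_wpmul2l; first by rewrite lee_fin sqrtr_ge0.
  rewrite -(powR12_sqrt (ltW y0)) -poweR_EFin.
  apply: gt0_ler_poweR => //; rewrite ?in_itv /= ?andbT ?leey ?lee_fin ?(ltW y0)//.
  by rewrite andbT; apply: le_trans Sge; rewrite lee_fin ltW.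
have cd0 : 0 <= c / d ^+ 2 by apply: ltW; rewrite divr_gt0 ?exprn_gt0.
rewrite -EFinM lee_fin -(sqrtrM _ cd0).
have -> : c / d ^+ 2 * (2 * c * d ^+ 2) = 2 * c ^+ 2 by field; rewrite gt_eqF.
move=> h2; exfalso.
have : Num.sqrt (2 * c ^+ 2) ^+ 2 <= c ^+ 2 by apply: lerXn2r; rewrite ?nnegrE ?sqrtr_ge0 ?(ltW c0).
rewrite sqr_sqrtr ?mulr_ge0 ?sqr_ge0//; have := exprn_gt0 2 c0; lra.
Qed.

End iid_comparison.

(** * The mean squared norm of approximate samples *)

Section sampler_estimate.
Variable R : realType.

Definition sqnorm_mean n k (t : k.-tuple 'cV[R]_n) : R :=
  k%:R^-1 * tuple_sum (fun y : 'cV[R]_n => dotv y y) t.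

Definition bad_estimate n k (T : R) : set (k.-tuple 'cV[R]_n) :=
  [set t | ~~ (2^-1 * T <= sqnorm_mean t <= 2 * T)].

Lemma measurable_sqnorm_mean n k : measurable_fun setT (@sqnorm_mean n k).
Proof.
apply: measurable_funM => //; apply: measurable_tuple_sum.
exact: measurable_dotv.
Qed.

Lemma measurable_bad_estimate n k (T : R) : measurable (@bad_estimate n k T).
Proof.
rewrite -[X in measurable X]setTI.
have m1 := @measurable_fun_ler _ _ R setT (cst (2^-1 * T)) (@sqnorm_mean n k) (measurable_cst _) (@measurable_sqnorm_mean n k).
have m2 := @measurable_fun_ler _ _ R setT (@sqnorm_mean n k) (cst (2 * T)) (@measurable_sqnorm_mean n k) (measurable_cst _).
have m3 := measurable_neg (measurable_and m1 m2).
exact: (m3 measurableT [set true] I).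
Qed.

(** Young's inequality, read off from [|y / 2 - 2 (x - y)|^2 >= 0]. The factor of [|y|^2] must stay
    close to 1 to fit the window of the estimate, while that of [|x - y|^2] is immaterial. *)
Lemma dotv_split n (x y : 'cV[R]_n) :
  dotv x x <= 5 / 4 * dotv y y + 5 * dotv (x - y) (x - y).
Proof.
have -> : dotv x x = dotv (y + (x - y)) (y + (x - y)) by rewrite addrCA subrr addr0.
move: (x - y) => z; have := dotv_ge0 (2^-1 *: y + (- 2) *: z).
rewrite !(dotvDl, dotvDr, dotvZl, dotvZr) (dotvC z y).
lra.
Qed.

Lemma dotvNN n (x : 'cV[R]_n) : dotv (- x) (- x) = dotv x x.
Proof. by rewrite !dotvE; apply: eq_bigr => i _; rewrite !mxE mulrNN. Qed.

Lemma tuple_sum_split n k (t : k.-tuple ('cV[R]_n * 'cV[R]_n)) :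
  let S1 := tuple_sum (fun z : 'cV[R]_n * 'cV[R]_n => dotv z.1 z.1) t in
  let S2 := tuple_sum (fun z : 'cV[R]_n * 'cV[R]_n => dotv z.2 z.2) t in
  let D := tuple_sum (fun z : 'cV[R]_n * 'cV[R]_n => dotv (z.1 - z.2) (z.1 - z.2)) t in
  S1 <= 5 / 4 * S2 + 5 * D /\ S2 <= 5 / 4 * S1 + 5 * D.
Proof.
rewrite /tuple_sum !mulr_sumr -!big_split /=; split; apply: ler_sum => i _.
  exact: dotv_split.
have := dotv_split (tnth t i).2 (tnth t i).1.
by rewrite -[(tnth t i).2 - (tnth t i).1]opprB dotvNN.
Qed.

Lemma tuple_sum_map d1 d2 (T : measurableType d1) (U : measurableType d2) (phi : T -> U)
    (f : U -> R) k (t : k.-tuple T) :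
  tuple_sum f [tuple of map phi t] = tuple_sum (f \o phi) t.
Proof. by apply: eq_bigr => i _; rewrite tnth_map. Qed.

Lemma measurable_mulmx_cst n (A : 'M[R]_n) : measurable_fun setT (fun g : 'cV[R]_n => A *m g).
Proof. exact: measurable_mulmx. Qed.

(** The margins are [25/16 + 1/20 < 2] above and [4/5 * (3/4 - 1/20) > 1/2] below. *)
Lemma split_window (x S1 S2 D : R) : 3 / 4 * x <= S2 -> S2 <= 5 / 4 * x -> D < x / 100 ->
  S1 <= 5 / 4 * S2 + 5 * D -> S2 <= 5 / 4 * S1 + 5 * D -> 2^-1 * x <= S1 <= 2 * x.
Proof. by move=> *; apply/andP; split; lra. Qed.

(** The three terms are Chebyshev's bound for exact samples, the total variation of [k] samples, and
    Markov's bound on the transport cost. Their sum covers both alternatives, so the bound does not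
    depend on which one holds. *)
Lemma sampler_estimate n (A : 'M[R]_n.+1) (Phat P : probability 'cV[R]_n.+1 R)
    (k : nat) (c eta : R) :
  (forall B, measurable B -> P B = pushforward (gaussian_mx n.+1 1 1) (fun g : 'cV[R]_n.+1 => A *m g) B) ->
  (0 < k)%N -> 0 < c -> 0 < eta -> eta * n.+1%:R ^+ 2 <= \tr (A *m A^T) ->
  (tv_dist Phat P <= c%:E)%E \/
    ((Num.sqrt (c / n.+1%:R ^+ 2))%:E * wasserstein2 Phat P <= c%:E)%E ->
  (iid_tuple Phat k (bad_estimate (\tr (A *m A^T))) <=
    (2048 / k%:R + k%:R * c + 200 * c / eta)%:E)%E.
Proof.
move=> PA k0 c0 eta0; set T := \tr (A *m A^T); set d : R := n.+1%:R => Teta close.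
have d0 : 0 < d by rewrite /d ltr0n.
have T0 : 0 < T by apply: lt_le_trans Teta; rewrite mulr_gt0// exprn_gt0.
have kR0 : 0 < k%:R :> R by rewrite ltr0n.
pose q (y : 'cV[R]_n.+1) : R := dotv y y.
have mq : measurable_fun setT q by exact: measurable_dotv.
have q0 y : 0 <= q y by exact: dotv_ge0.
have mA := @measurable_mulmx_cst n.+1 A.
have Iq : (\int[P]_y (q y)%:E = T%:E)%E.
  rewrite (@ge0_integral_law R _ _ _ _ (gaussian_mx n.+1 1 1) P _ mA PA (fun y => (q y)%:E)).
  - exact: gaussian_sqnorm_mean.
  - exact/measurable_EFinP.
  - by move=> y; rewrite lee_fin.
have Iq2 : (\int[P]_y (q y ^+ 2)%:E <= (128 * T ^+ 2)%:E)%E.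
  rewrite (@ge0_integral_law R _ _ _ _ (gaussian_mx n.+1 1 1) P _ mA PA (fun y => (q y ^+ 2)%:E)).
  - exact: gaussian_sqnorm_second.
  - by apply/measurable_EFinP; exact: measurable_funX.
  - by move=> y; rewrite lee_fin sqr_ge0.
(* A deviation of a quarter of the mean: [k * 128 T^2 / a^2 = 2048 / k]. *)
pose a := k%:R * T / 4.
have a0 : 0 < a by rewrite divr_gt0 ?mulr_gt0.
pose Dev : set (k.-tuple 'cV[R]_n.+1) := [set t | a ^+ 2 <= (tuple_sum q t - k%:R * T) ^+ 2].
have mDev : measurable Dev.
  rewrite -[X in measurable X]setTI.
  have ms : measurable_fun setT (fun t : k.-tuple 'cV[R]_n.+1 => (tuple_sum q t - k%:R * T) ^+ 2).
    by apply: measurable_funX; apply: measurable_funB => //; exact: measurable_tuple_sum.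
  exact: (measurable_fun_ler (measurable_cst (a ^+ 2)) ms measurableT (Y := [set true])).
have PDev : (iid_tuple P k Dev <= (2048 / k%:R)%:E)%E.
  apply: le_trans (iid_sum_chebyshev mq q0 Iq Iq2 k a0) _.
  rewrite lee_fin le_eqVlt; apply/orP; left; apply/eqP; rewrite /a; field.
  by rewrite !gt_eqF.
have notDev (t : k.-tuple 'cV[R]_n.+1) : ~ Dev t ->
    3 / 4 * (k%:R * T) <= tuple_sum q t <= 5 / 4 * (k%:R * T).
  move=> /negP; rewrite -ltNge => h.
  have : `|tuple_sum q t - k%:R * T| < a.
    rewrite -(@ltr_pXn2r _ 2) ?nnegrE ?(ltW a0)//.
    by rewrite -normrX ger0_norm ?sqr_ge0.
  by rewrite ltr_norml /a => /andP[h1 h2]; apply/andP; split; lra.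
have kTn : k%:R != 0 :> R by rewrite gt_eqF.
have estE (t : k.-tuple 'cV[R]_n.+1) : (2^-1 * T <= sqnorm_mean t <= 2 * T) =
    (2^-1 * (k%:R * T) <= tuple_sum q t <= 2 * (k%:R * T)).
  rewrite /sqnorm_mean -/q ler_pdivlMl// ler_pdivrMl//.
  by rewrite mulrCA [k%:R * (2 * T)]mulrCA.
have kT0 : 0 < k%:R * T by rewrite mulr_gt0.
case: close => [tv|w2].
  apply: le_trans (iid_tuple_approx (tv_dist_le tv) (@measurable_bad_estimate n.+1 k T)) _.
  apply: (@le_trans _ _ ((2048 / k%:R)%:E + (k%:R * c)%:E)%E); last first.
    by rewrite -EFinD lee_fin lerDl divr_ge0 ?mulr_ge0// ltW.
  apply: leeD => //; apply: le_trans PDev.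
  apply: le_measure; rewrite ?inE//; first exact: measurable_bad_estimate.
  move=> t; rewrite /bad_estimate /= estE => /negP h; apply: contrapT => /notDev /andP[h1 h2].
  by apply: h; apply/andP; split; lra.
have [g gc gI] := wasserstein2_coupling c0 d0 w2.
have E1 B (mB : measurable B) : Phat B = g (fst @^-1` B) by have [] := gc B mB.
have E2 B (mB : measurable B) : P B = g (snd @^-1` B) by have [] := gc B mB.
(* Approximate and exact samples become the two coordinates of the same independent pairs, so both
   sums and the transport cost live on one space. *)
rewrite (iid_tuple_map measurable_fst E1); last exact: measurable_bad_estimate.
pose V : measurableType _ := ('cV[R]_n.+1 * 'cV[R]_n.+1)%type.
pose u (z : V) : R := dotv (z.1 - z.2) (z.1 - z.2).
have mu : measurable_fun setT u by apply: measurable_dotv; exact: measurable_submx.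
have u0 z : 0 <= u z by exact: dotv_ge0.
have Iu_fin : (\int[g]_z (u z)%:E)%E \is a fin_num.
  rewrite ge0_fin_numE; first exact: le_lt_trans gI (ltry _).
  by apply: integral_ge0 => z _; rewrite lee_fin.
pose m := fine (\int[g]_z (u z)%:E)%E.
have Iu : (\int[g]_z (u z)%:E = m%:E)%E by rewrite fineK.
have m_le : m <= 2 * c * d ^+ 2 by rewrite -lee_fin -Iu.
have b0 : 0 < k%:R * T / 100 by rewrite divr_gt0.
have mus : measurable_fun setT (fun t : k.-tuple V => (tuple_sum u t)%:E).
  by apply/measurable_EFinP; exact: measurable_tuple_sum.
have us0 (t : k.-tuple V) : (0 <= (tuple_sum u t)%:E)%E by rewrite lee_fin tuple_sum_ge0.
(* The fraction 1/100 is the one required by [split_window]. The mean cost per pair is at most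
   [2 c d^2] and [T >= eta d^2], hence the bound [200 c / eta]. *)
pose Far : set (k.-tuple V) := [set t | ((k%:R * T / 100)%:E <= (tuple_sum u t)%:E)%E].
have mFar : measurable Far.
  have := emeasurable_fun_c_infty measurableT mus (k%:R * T / 100)%:E.
  by rewrite setTI.
have PFar : (iid_tuple g k Far <= (200 * c / eta)%:E)%E.
  apply: le_trans (markov_ge0 (iid_tuple g k) b0 mus us0) _.
  rewrite (iid_sum_mean mu u0 Iu) -EFinM lee_fin.
  have -> : (k%:R * T / 100)^-1 * (k%:R * m) = 100 * m / T by field; rewrite !gt_eqF.
  rewrite ler_pdivrMr//; apply: (@le_trans _ _ (200 * c / eta * (eta * d ^+ 2))).
    have -> : 200 * c / eta * (eta * d ^+ 2) = 100 * (2 * c * d ^+ 2) by field; rewrite gt_eqF.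
    by rewrite ler_pM2l.
  apply: ler_wpM2l Teta; exact: (ltW (divr_gt0 (mulr_gt0 (ltr0n _ 200) c0) eta0)).
have mDev2 : measurable ((fun t : k.-tuple V => [tuple of map snd t]) @^-1` Dev).
  by rewrite -[X in measurable X]setTI; apply: measurable_map_tuple.
have PDev2 : (iid_tuple g k ((fun t : k.-tuple V => [tuple of map snd t]) @^-1` Dev) <= (2048 / k%:R)%:E)%E.
  by rewrite -(iid_tuple_map measurable_snd E2).
apply: (@le_trans _ _ (2048 / k%:R + 200 * c / eta)%:E); last first.
  by rewrite lee_fin lerD2r lerDl mulr_ge0// ltW.
apply: le_trans (prob_setU_le mDev2 mFar PDev2 PFar).
apply: le_measure; rewrite ?inE.
- rewrite -[X in measurable X]setTI; apply: measurable_map_tuple => //.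
  exact: measurable_bad_estimate.
- exact: measurableU.
move=> t; rewrite /bad_estimate /= estE => /negP h; apply: contrapT => /not_orP[/notDev /andP[h1 h2]].
rewrite /Far /= lee_fin => /negP; rewrite -ltNge => h3.
apply: h; move: h1 h2; rewrite !tuple_sum_map => h1 h2.
have [h4 h5] := tuple_sum_split t.
move: h1 h2 h3 h4 h5; rewrite /q /u /comp.
exact: split_window.
Qed.

End sampler_estimate.

(** * Query algorithms *)

Section measurable_run.
Context (R : realType) dX dA dO (X : measurableType dX) (A : measurableType dA)
  (O : measurableType dO) (n : nat).

(** Joint measurability in the seed and the parameter of the oracle is what makes the success event,
    a set of pairs of a seed and a matrix [W], measurable. *)
Lemma measurable_joint_run (alg : query_algorithm R X A O n) d (U : measurableType d)
    (oracle : U -> X -> A) :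
  measurable_fun setT (fun z : U * X => oracle z.1 z.2) ->
  measurable_fun setT (fun z : seed alg * U => run alg (oracle z.2) z.1).
Proof.
move=> mo.
have mt k : measurable_fun setT (fun z : seed alg * U => transcript alg (oracle z.2) z.1 k).
  elim: k => [|k IH] /=; first exact: measurable_cst.
  apply: measurable_cons => //.
  have mq : measurable_fun setT (fun z : seed alg * U =>
      query alg k (z.1, transcript alg (oracle z.2) z.1 k)).
    by apply: (measurableT_comp (@measurable_query _ _ _ _ _ _ _ _ alg k)); apply: measurable_fun_pair.
  have mp : measurable_fun setT (fun z : seed alg * U =>
      (z.2, query alg k (z.1, transcript alg (oracle z.2) z.1 k))).
    by apply: measurable_fun_pair => //; exact: mt.
  exact: (measurableT_comp mo mp).
apply: (measurableT_comp (@measurable_output _ _ _ _ _ _ _ _ alg)).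
by apply: measurable_fun_pair => //; exact: mt.
Qed.

Lemma measurable_run (alg : query_algorithm R X A O n) (oracle : X -> A) :
  measurable_fun setT oracle -> measurable_fun setT (run alg oracle).
Proof.
move=> mo.
have h := @measurable_joint_run alg _ unit (fun _ => oracle) (measurableT_comp mo measurable_snd).
exact: (measurableT_comp h (measurable_pair2 tt)).
Qed.

End measurable_run.

Section gradient_queries.
Context (R : realType) (d n : nat) (S : sampler R d n).

(* The value of the potential at a query point is half the inner product of the
   query point with the gradient, and the past query points can be recomputed. *)
Fixpoint full_answers k : seed S * k.-tuple 'cV[R]_d -> k.-tuple (R * 'cV[R]_d)%type :=
  match k with
  | 0%N => fun _ => [tuple]
  | j.+1 => fun z =>
      let h := full_answers (z.1, [tuple of behead z.2]) in
      let y := tnth z.2 ord0 in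
      [the j.+1.-tuple (R * 'cV[R]_d)%type of (2^-1 * dotv (query S j (z.1, h)) y, y) :: h]
  end.

Lemma measurable_full_answers k : measurable_fun setT (@full_answers k).
Proof.
elim: k => [|k IH] /=; first exact: measurable_cst.
have mh : measurable_fun setT (fun z : seed S * k.+1.-tuple 'cV[R]_d =>
    full_answers (z.1, [tuple of behead z.2])).
  apply: (measurableT_comp IH); apply: measurable_fun_pair => //.
  exact: (measurableT_comp (@measurable_behead _ _ _) measurable_snd).
have my : measurable_fun setT (fun z : seed S * k.+1.-tuple 'cV[R]_d => tnth z.2 ord0).
  exact: (measurableT_comp (measurable_tnth ord0) measurable_snd).
apply: measurable_cons => //; apply: measurable_fun_pair => //.
apply: measurable_funM => //; apply: measurable_dotv => //.
apply: (measurableT_comp (@measurable_query _ _ _ _ _ _ _ _ S k)).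
by apply: measurable_fun_pair.
Qed.

Lemma measurable_gradient_query k :
  measurable_fun setT (fun z : seed S * k.-tuple 'cV[R]_d => query S k (z.1, full_answers z)).
Proof.
apply: (measurableT_comp (@measurable_query _ _ _ _ _ _ _ _ S k)).
by apply: measurable_fun_pair => //; exact: measurable_full_answers.
Qed.

Lemma measurable_gradient_output :
  measurable_fun setT (fun z : seed S * n.-tuple 'cV[R]_d => output (z.1, full_answers z)).
Proof.
apply: (measurableT_comp (@measurable_output _ _ _ _ _ _ _ _ S)).
by apply: measurable_fun_pair => //; exact: measurable_full_answers.
Qed.

Definition gradient_only : query_algorithm R 'cV[R]_d 'cV[R]_d 'cV[R]_d n :=
  QueryAlgorithm (seed_law S) measurable_gradient_query measurable_gradient_output.

(** Valid for singular [W] as well, because [invmx] is an involution on all matrices. *)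
Lemma full_answers_transcript (W : 'M[R]_d) (w : seed S) k :
  full_answers (w, transcript gradient_only (mulmx W) w k) =
  transcript S (gaussian_oracle (invmx W)) w k.
Proof.
elim: k => [//|k IH] /=; apply/val_inj => /=.
have bE (y : 'cV[R]_d) (h : k.-tuple 'cV[R]_d) : [tuple of behead [tuple of y :: h]] = h.
  exact/val_inj.
by rewrite bE IH /gaussian_oracle /potential invmxK (tnth_nth 0) /=.
Qed.

Lemma run_gradient_only (W : 'M[R]_d) (w : seed S) :
  run gradient_only (mulmx W) w = run S (gaussian_oracle (invmx W)) w.
Proof. by rewrite /run /= full_answers_transcript. Qed.

End gradient_queries.

(** * Running algorithms one after the other with independent seeds *)

Section sequential.
Context (R : realType) dX dA dO1 dO2 (X : measurableType dX) (A : measurableType dA)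
  (O1 : measurableType dO1) (O2 : measurableType dO2) (n1 n2 : nat).
Variables (a1 : query_algorithm R X A O1 n1) (a2 : query_algorithm R X A O2 n2).

(** The default [point] makes slicing total in all three lengths, which spares casts between tuple
    types; every use stays in range. *)
Definition subtuple m j k (h : k.-tuple A) : j.-tuple A :=
  [tuple nth point h (m + i) | i < j].

Lemma measurable_subtuple m j k : measurable_fun setT (@subtuple m j k).
Proof.
apply/measurable_fun_tnthP => i.
rewrite (_ : _ \o _ = fun h : k.-tuple A => nth point h (m + i)); last first.
  by apply/funext => h /=; rewrite tnth_mktuple.
have [mk|mk] := ltnP (m + i) k.
  rewrite (_ : (fun h => _) = fun h : k.-tuple A => tnth h (Ordinal mk)).
    exact: measurable_tnth.
  by apply/funext => h; rewrite (tnth_nth point).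
rewrite (_ : (fun h => _) = cst point); first exact: measurable_cst.
by apply/funext => h; rewrite nth_default// size_tuple.
Qed.

(* The most recent answer comes first, so the answers to [a2] precede those to [a1]. *)
Definition sequential_query k : (seed a1 * seed a2) * k.-tuple A -> X :=
  if (k < n1)%N then fun z => query a1 k (z.1.1, z.2)
  else fun z => query a2 (k - n1) (z.1.2, subtuple 0 (k - n1) z.2).

Definition sequential_output (z : (seed a1 * seed a2) * (n2 + n1).-tuple A) : O1 * O2 :=
  (output (z.1.1, subtuple n2 n1 z.2), output (z.1.2, subtuple 0 n2 z.2)).

Lemma measurable_sequential_query k : measurable_fun setT (@sequential_query k).
Proof.
have m11 : measurable_fun setT (fun z : (seed a1 * seed a2) * k.-tuple A => z.1.1).
  exact: (measurableT_comp measurable_fst measurable_fst).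
have m12 : measurable_fun setT (fun z : (seed a1 * seed a2) * k.-tuple A => z.1.2).
  exact: (measurableT_comp measurable_snd measurable_fst).
rewrite /sequential_query; case: ifP => _.
  by apply: (measurableT_comp (@measurable_query _ _ _ _ _ _ _ _ a1 k)); apply: measurable_fun_pair.
apply: (measurableT_comp (@measurable_query _ _ _ _ _ _ _ _ a2 (k - n1))).
apply: measurable_fun_pair => //.
exact: (measurableT_comp (@measurable_subtuple 0 (k - n1) k) measurable_snd).
Qed.

Lemma measurable_sequential_output : measurable_fun setT sequential_output.
Proof.
have m11 : measurable_fun setT (fun z : (seed a1 * seed a2) * (n2 + n1).-tuple A => z.1.1).
  exact: (measurableT_comp measurable_fst measurable_fst).
have m12 : measurable_fun setT (fun z : (seed a1 * seed a2) * (n2 + n1).-tuple A => z.1.2).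
  exact: (measurableT_comp measurable_snd measurable_fst).
apply: measurable_fun_pair.
  apply: (measurableT_comp (@measurable_output _ _ _ _ _ _ _ _ a1)).
  apply: measurable_fun_pair => //.
  exact: (measurableT_comp (@measurable_subtuple n2 n1 (n2 + n1)) measurable_snd).
apply: (measurableT_comp (@measurable_output _ _ _ _ _ _ _ _ a2)).
apply: measurable_fun_pair => //.
exact: (measurableT_comp (@measurable_subtuple 0 n2 (n2 + n1)) measurable_snd).
Qed.

Definition sequential : query_algorithm R X A (O1 * O2)%type (n2 + n1) :=
  QueryAlgorithm (seed_law a1 \x seed_law a2)%E
    measurable_sequential_query measurable_sequential_output.

Variable oracle : X -> A.

Lemma transcript_sequential1 (w : seed a1 * seed a2) k : (k <= n1)%N ->
  transcript sequential oracle w k = transcript a1 oracle w.1 k.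
Proof.
elim: k => [//|k IH] kn; apply/val_inj => /=.
by rewrite /sequential_query kn /= IH// ltnW.
Qed.

(** An equality of sequences, since histories of different lengths are concatenated. *)
Lemma transcript_sequential2 (w : seed a1 * seed a2) j :
  transcript sequential oracle w (j + n1) =
  transcript a2 oracle w.2 j ++ transcript a1 oracle w.1 n1 :> seq A.
Proof.
elim: j => [|j IH]; first by rewrite add0n transcript_sequential1.
rewrite addSn /= IH; congr (oracle _ :: _).
rewrite /sequential_query ltnNge leq_addl /= addnK; congr (query a2 j (_, _)).
apply: eq_from_tnth => i.
by rewrite tnth_mktuple IH nth_cat size_tuple add0n ltn_ord -tnth_nth.
Qed.

Lemma run_sequential (w : seed a1 * seed a2) :
  run sequential oracle w = (run a1 oracle w.1, run a2 oracle w.2).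
Proof.
rewrite /run /= /sequential_output /=.
have -> : subtuple n2 n1 (transcript sequential oracle w (n2 + n1)) = transcript a1 oracle w.1 n1.
  apply: eq_from_tnth => i; rewrite tnth_mktuple transcript_sequential2 nth_cat size_tuple.
  by rewrite ltnNge leq_addr /= addKn -tnth_nth.
have -> // : subtuple 0 n2 (transcript sequential oracle w (n2 + n1)) = transcript a2 oracle w.2 n2.
apply: eq_from_tnth => i; rewrite tnth_mktuple transcript_sequential2 nth_cat size_tuple.
by rewrite add0n ltn_ord -tnth_nth.
Qed.

End sequential.

Section composition.
Context (R : realType) dX dA dO dO' (X : measurableType dX) (A : measurableType dA)
  (O : measurableType dO) (O' : measurableType dO') (n : nat).
Variables (alg : query_algorithm R X A O n) (phi : O -> O').
Hypothesis mphi : measurable_fun setT phi.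

Definition map_output : query_algorithm R X A O' n :=
  QueryAlgorithm (seed_law alg) (@measurable_query _ _ _ _ _ _ _ _ alg)
    (measurableT_comp mphi (@measurable_output _ _ _ _ _ _ _ _ alg)).

Lemma run_map_output oracle (w : seed alg) :
  run map_output oracle w = phi (run alg oracle w).
Proof.
by rewrite /run /=; congr (phi (output (_, _))).
Qed.

End composition.

Section iterate.
Context (R : realType) dX dA dO (X : measurableType dX) (A : measurableType dA)
  (O : measurableType dO) (n : nat).
Variable alg : query_algorithm R X A O n.

Definition trivial_algorithm : query_algorithm R X A (0.-tuple O) 0 :=
  QueryAlgorithm (seed_law alg) (fun k => measurable_cst (point : X))
    (measurable_cst ([tuple] : 0.-tuple O)).

Lemma measurable_swap_cons k :
  measurable_fun setT (fun z : k.-tuple O * O => tuple_cons (z.2, z.1)).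
Proof.
apply: (measurableT_comp (@measurable_tuple_cons _ O k)).
by apply: measurable_fun_pair.
Qed.

(** The fresh run comes second, so that the query count [n + j * n] of [sequential] is [j.+1 * n] by
    computation. *)
Fixpoint iterate k : query_algorithm R X A (k.-tuple O) (k * n) :=
  match k with
  | 0%N => trivial_algorithm
  | j.+1 => map_output (sequential (iterate j) alg) (@measurable_swap_cons j)
  end.

(** For a fixed oracle, independent seeds give independent outputs. [law] is the set function
    [output_law] packaged as a probability, which [iid_tuple] requires. *)
Lemma output_law_iterate (oracle : X -> A) (law : probability O R) :
  measurable_fun setT oracle ->
  (forall D, measurable D -> law D = output_law alg oracle D) ->
  forall k D, measurable D -> output_law (iterate k) oracle D = iid_tuple law k D.
Proof.
move=> mo lawE; elim=> [|k IH] D mD.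
  rewrite /output_law /pushforward /= diracE.
  have [D0|D0] := boolP ([tuple] \in D).
    rewrite (_ : _ @^-1` _ = setT) ?probability_setT//.
    by apply/seteqP; split => // w _ /=; move: D0; rewrite inE.
  rewrite (_ : _ @^-1` _ = set0) ?measure0//.
  by apply/seteqP; split => // w /= h; move: D0; rewrite notin_setE.
have mB := measurable_tuple_cons_preimage mD; set B := _ @^-1` D in mB.
have mr := measurable_run (alg := iterate k) mo.
have mr1 := measurable_run (alg := alg) mo.
transitivity ((seed_law (iterate k) \x seed_law alg)%E
    [set w | B (run alg oracle w.2, run (iterate k) oracle w.1)]).
  rewrite /output_law (_ : run (iterate k.+1) oracle =
      fun w => tuple_cons (run alg oracle w.2, run (iterate k) oracle w.1))//.
  by apply/funext => w; rewrite run_map_output run_sequential.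
set C := [set w | _].
have mC : measurable C.
  rewrite -[C]setTI /C.
  have mp : measurable_fun setT (fun w : seed (iterate k) * seed alg =>
      (run alg oracle w.2, run (iterate k) oracle w.1)).
    apply: measurable_fun_pair.
      exact: (measurableT_comp mr1 measurable_snd).
    exact: (measurableT_comp mr measurable_fst).
  exact: mp.
have -> : iid_tuple law k.+1 D = (\int[law]_x iid_tuple law k (xsection B x))%E by [].
rewrite (@ge0_integral_law R _ _ _ _ (seed_law alg) law _ mr1 lawE)//; last first.
  exact: measurable_fun_xsection.
rewrite product_prob_swap//; apply: eq_integral => u _.
rewrite -IH; last exact: measurable_xsection.
congr (seed_law _ _); apply/seteqP; split => w; rewrite /ysection /xsection /= !inE //.
Qed.

End iterate.

(** * The trace estimator *)

Section trace_estimator.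
Variable R : realType.

Lemma pushforward_probability d1 d2 (T : measurableType d1) (U : measurableType d2)
    (P : probability T R) (phi : T -> U) : measurable_fun setT phi ->
  exists Q : probability U R, Q = pushforward P phi :> (set U -> \bar R).
Proof.
move=> mphi.
pose f : {mfun T >-> U} := HB.pack phi (isMeasurableFun.Build _ _ _ _ phi mphi).
by exists (distribution P f).
Qed.

Lemma loewner_le_trans n (A B C : 'M[R]_n) :
  loewner_le A B -> loewner_le B C -> loewner_le A C.
Proof.
have CA : C - A = (C - B) + (B - A) by rewrite addrA subrK.
rewrite /loewner_le CA => -[tAB pAB] [tBC pBC]; split.
  by rewrite linearD /= tAB tBC.
by move=> x; rewrite mulmxDl dotvDr addr_ge0.
Qed.

Lemma loewner_le_scalar_mx n (a b : R) : a <= b -> loewner_le (a%:M : 'M[R]_n) b%:M.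
Proof.
move=> ab; split; first by rewrite -raddfB /= tr_scalar_mx.
by move=> x; rewrite -raddfB /= mul_scalar_mx dotvZr mulr_ge0 ?dotv_ge0// subr_ge0.
Qed.

(** The conditions [c <= e^2] and [K^2 <= c^-1] place the spectrum of a good [W] inside the range
    promised to the sampler. The failure probability is the sum of that of a bad [X] and that of the
    seeds for a good one. *)
Lemma trace_estimator n q k (c e eta K : R) (S : sampler R n.+1 q) :
  sampler_correct c S -> (0 < k)%N -> 0 < c -> 0 < e -> 0 < eta -> 0 < K ->
  c <= e ^+ 2 -> K ^+ 2 <= c^-1 ->
  exists T : matvec_estimator R n.+1 (k * q),
    ((1 - (4 * e + eta + 2 * expR (5 * n.+1%:R - K * n.+1%:R / 4) +
      (2048 / k%:R + k%:R * c + 200 * c / eta)))%:E <= trace_inv_success T)%E.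
Proof.
move=> Sc k0 c0 e0 eta0 K0 ce cK.
have [B [mB PB good]] := wishart_factor_good n e0 eta0 (ltW K0).
set p := 4 * e + _ + _ in PB *; set r := 2048 / _ + _ + _.
have r0 : 0 <= r.
  apply: addr_ge0; last exact: divr_ge0 (mulr_ge0 (ler0n _ _) (ltW c0)) (ltW eta0).
  apply: addr_ge0; first exact: divr_ge0 (ler0n _ _) (ler0n _ _).
  exact: mulr_ge0 (ler0n _ _) (ltW c0).
pose I := iterate (gradient_only S) k.
pose T := map_output I (@measurable_sqnorm_mean R n.+1 k).
exists T; rewrite /trace_inv_success; set Succ := [set z | _].
have mSucc : measurable Succ.
  have mtr : measurable_fun setT (fun z : seed T * 'M[R]_n.+1 => \tr (invmx z.2) : R).
    by apply: measurable_mxtrace; apply: measurable_invmx; exact: measurable_snd.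
  have mo : measurable_fun setT (fun z : 'M[R]_n.+1 * 'cV[R]_n.+1 => z.1 *m z.2).
    exact: measurable_mulmx.
  have mrun := measurable_joint_run (alg := T) mo.
  have m1 : measurable_fun setT (fun z : seed T * 'M[R]_n.+1 => 2^-1 * \tr (invmx z.2) : R).
    exact: measurable_funM.
  have m2 : measurable_fun setT (fun z : seed T * 'M[R]_n.+1 => 2 * \tr (invmx z.2) : R).
    exact: measurable_funM.
  rewrite -[Succ]setTI.
  have m3 := measurable_and (measurable_fun_ler m1 mrun) (measurable_fun_ler mrun m2).
  exact: (m3 measurableT [set true] Logic.I).
pose G := gaussian_mx n.+1 n.+1 (Num.sqrt (n.+1%:R^-1 : R)).
have mF := measurableC mSucc.
(* The sampler's guarantee concerns one fixed covariance, so failure is bounded for each [X]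
   separately: trivially by 1 on [B], and by [r] outside it. *)
have pt X : (seed_law T (ysection (~` Succ) (gram X)) <= (\1_B X)%:E + r%:E)%E.
  have [BX|/good[uX lo hi tr]] := pselect (B X).
    rewrite indicE mem_set// -EFinD; apply: le_trans (probability_le1 _ _) _.
      exact: measurable_ysection.
    by rewrite lee_fin lerDl.
  apply: (@le_trans _ _ r%:E); last by rewrite leeDr// lee_fin indicE.
  set W := gram X.
  have uW : W \in unitmx by rewrite /W /gram unitmx_mul unitmx_tr uX.
  (* A square root of [W^-1], which exhibits N(0, W^-1) as the law of [A g]. *)
  pose A := (invmx X)^T.
  have AE : A *m A^T = invmx W by rewrite trmxK -invmx_gram.
  have [P PE] := pushforward_probability (gaussian_mx n.+1 1 1) (@measurable_mulmx_cst R n.+1 A).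
  have mS : measurable_fun setT (mulmx W : 'cV[R]_n.+1 -> 'cV[R]_n.+1).
    exact: measurable_mulmx_cst.
  have [Q QE] := pushforward_probability (seed_law (gradient_only S))
    (measurable_run (alg := gradient_only S) mS).
  have QE' : Q = output_law S (gaussian_oracle (invmx W)) :> (set _ -> \bar R).
    rewrite QE /output_law; congr (pushforward _ _).
    by apply/funext => w; rewrite run_gradient_only.
  have close : (tv_dist Q P <= c%:E)%E \/
      ((Num.sqrt (c / n.+1%:R ^+ 2))%:E * wasserstein2 Q P <= c%:E)%E.
    rewrite QE'; apply: Sc; rewrite ?invmxK ?unitmx_inv//.
    - apply: loewner_le_trans lo; apply: loewner_le_scalar_mx.
      by rewrite ler_pM2r ?invr_gt0 ?exprn_gt0.
    - exact: loewner_le_trans hi (loewner_le_scalar_mx _ _).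
    - by exists A => // D _; rewrite PE.
  have PE' D : measurable D -> P D = pushforward (gaussian_mx n.+1 1 1) (fun g : 'cV[R]_n.+1 => A *m g) D.
    by rewrite PE.
  have := sampler_estimate PE' k0 c0 eta0 _ close.
  rewrite AE => /(_ tr); apply: le_trans.
  have QE2 D : measurable D -> Q D = output_law (gradient_only S) (mulmx W) D by rewrite QE.
  rewrite -(output_law_iterate mS QE2 (@measurable_bad_estimate R n.+1 k _)).
  rewrite [X in (X <= _)%E](_ : _ = output_law I (mulmx W) (bad_estimate (\tr (invmx W))))//.
  congr (seed_law T _); apply/seteqP; split => w; rewrite /ysection /= inE /Succ /= /bad_estimate /=.
    by move=> /negP.
  by move=> /negP.
have PF : ((seed_law T \x wishart R n.+1) (~` Succ) <= (p + r)%:E)%E.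
  rewrite product_prob_swap//.
  have mys : measurable_fun setT (fun W => seed_law T (ysection (~` Succ) W)).
    exact: measurable_fun_ysection.
  rewrite (@ge0_integral_law R _ _ _ _ G (wishart R n.+1) _ (@measurable_gram R n.+1) (fun _ _ => erefl) _ mys); last first.
    by move=> W; exact: measure_ge0.
  apply: (@le_trans _ _ (\int[G]_X ((\1_B X)%:E + r%:E))%E).
    apply: ge0_le_integral.
    - exact: measurableT.
    - by move=> X _; exact: measure_ge0.
    - exact: (measurableT_comp mys (@measurable_gram R n.+1)).
    - by apply: emeasurable_funD => //; apply/measurable_EFinP; exact: measurable_indic.
    - by move=> X _; exact: pt.
  rewrite ge0_integralD; first last.
  - exact: measurable_cst.
  - by move=> X _; rewrite lee_fin.
  - by apply/measurable_EFinP; exact: measurable_indic.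
  - by move=> X _; rewrite lee_fin indicE.
  - exact: measurableT.
  rewrite integral_indic// setIT integral_prob_cst (EFinD p r).
  exact: leeD PB (lexx _).
have := probability_setC (seed_law T \x wishart R n.+1)%E mF.
rewrite setCK => ->; rewrite EFinB; apply: leeB => //.
Qed.

(** With [K = 24 + 4 / s] the exponent is [- (1 + 1 / s) d]: the part [24 / 4 = 6] beats the 5 lost
    by averaging, and [exp (- u) <= 1 / (1 + u)] makes the rest at most [s], uniformly in [d]. *)
Lemma expR_tail_small (d : nat) (s : R) : (0 < d)%N -> 0 < s ->
  2 * expR (5 * d%:R - (24 + 4 * s^-1) * d%:R / 4) <= 2 * s.
Proof.
move=> d0 s0; have d1 : 1 <= d%:R :> R by rewrite ler1n.
have si : 0 < s^-1 by rewrite invr_gt0.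
rewrite ler_pM2l//.
have -> : 5 * d%:R - (24 + 4 * s^-1) * d%:R / 4 = - ((1 + s^-1) * d%:R) by field; rewrite gt_eqF.
rewrite expRN -[leRHS]invrK lef_pV2 ?posrE ?expR_gt0//.
apply: le_trans (expR_ge1Dx _); apply: (@le_trans _ _ (s^-1 * d%:R)).
  by rewrite ler_peMr// ltW.
by rewrite mulrDl mul1r; have := ltW (lt_le_trans ltr01 d1); lra.
Qed.

End trace_estimator.

Theorem theorem17 (R : realType) (delta : R) (delta_gt0 : 0 < delta) :
  exists2 c : R, 0 < c &
    forall d n : nat, c^-1 <= d%:R ->
      (exists S : sampler R d n, sampler_correct c S) ->
      exists m : nat, m%:R <= c^-1 * n%:R /\
        exists T : matvec_estimator R d m,
          ((1 - delta)%:E <= trace_inv_success T)%E.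
Proof.
(* The failure budget: [4 e = delta / 4], and [delta / 8] for each of the five other terms, in all
   [7 delta / 8]. *)
pose e := delta / 16; pose eta := delta / 8; pose K := 24 + 4 * (delta / 16)^-1.
have e0 : 0 < e by rewrite divr_gt0.
have eta0 : 0 < eta by rewrite divr_gt0.
have K0 : 0 < K by rewrite addr_gt0// mulr_gt0// invr_gt0.
(* [16384 = 8 * 2048] makes Chebyshev's term [2048 / k] at most [delta / 8]; [k] does not depend on
   the dimension. *)
pose k := (Num.truncn (16384 / delta)).+1.
have kR0 : 0 < k%:R :> R by rewrite ltr0n.
have k_ge : 16384 / delta <= k%:R by rewrite ltW// truncnS_gt.
(* The first two entries put the spectrum into the sampler's range; the last two make [k c] and
   [200 c / eta] at most [eta]. *)
pose c := Num.min (Num.min (e ^+ 2) (K ^- 2)) (Num.min (eta / k%:R) (eta ^+ 2 / 200)).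
have c0 : 0 < c by rewrite !lt_min !divr_gt0 ?exprn_gt0 ?invr_gt0 ?exprn_gt0.
(* The further bound by [1 / k] turns the [k q] queries into at most [c1^-1 q]. *)
pose c1 := Num.min c k%:R^-1.
have [h1 h2 h3 h4 h5] : [/\ c1 <= e ^+ 2, c1 <= K ^- 2, c1 <= eta / k%:R, c1 <= eta ^+ 2 / 200 &
    c1 <= k%:R^-1].
  have := lexx c1; rewrite {2}/c1 {1}/c !le_min => /andP[/andP[/andP[-> ->] /andP[-> ->]] ->].
  by [].
have c10 : 0 < c1 by rewrite lt_min c0 invr_gt0.
exists c1 => // d q cd [S Sc].
(* Dimension 0 is excluded by [c1^-1 <= d]. *)
case: d cd S Sc => [|n] cd S Sc.
  by move: cd; rewrite leNgt invr_gt0 c10.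
have c1K : K ^+ 2 <= c1^-1 by rewrite -[leLHS]invrK lef_pV2// posrE invr_gt0 exprn_gt0.
have [T PT] := trace_estimator Sc (ltn0Sn _ : (0 < k)%N) c10 e0 eta0 K0 h1 c1K.
exists (k * q)%N; split.
  by rewrite natrM ler_wpM2r// -[leLHS]invrK lef_pV2// posrE invr_gt0.
exists T; apply: le_trans PT; rewrite lee_fin lerD2l lerN2.
have b1 : 2 * expR (5 * n.+1%:R - K * n.+1%:R / 4) <= 2 * (delta / 16).
  exact: expR_tail_small.
have b2 : 2048 / k%:R <= delta / 8.
  rewrite ler_pdivrMr//; move: k_ge; rewrite ler_pdivrMr//; lra.
have b3 : k%:R * c1 <= delta / 8 by rewrite mulrC -ler_pdivlMr.
have b4 : 200 * c1 / eta <= delta / 8.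
  rewrite ler_pdivrMr//; move: h4; rewrite /eta; lra.
by move: b1 b2 b3 b4; rewrite /e /eta; lra.
Qed.
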